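(* Let $n\ge 2$, let $q$ be a quadratic form on $\mathbb{Q}^{n+1}$ of Witt index $m\le 1$, and let $Z=Z(q_\mathbb{R})\subseteq\mathbb{P}^n(\mathbb{R})$, assumed to satisfy $Z^{\mathrm{li}}\neq\emptyset$. Let $\rho_n\in(1,2)$ be the unique positive root of $x^n-(x^{n-1}+\cdots+x+1)$. Then: (i) $\limsup_{X\to\infty}X^{1/\rho_n}\mathcal{D}_\xi(X)>0$ for each $\xi\in Z^{\mathrm{li}}$; (ii) $\limsup_{X\to\infty}X^{1/\rho_n}\mathcal{D}_\xi(X)<\infty$ for infinitely many $\xi\in Z^{\mathrm{li}}$.
   Context: A quadratic form on $\mathbb{Q}^{n+1}$ is a map given by a non-zero homogeneous quadratic polynomial in $\mathbb{Q}[t_0,\dots,t_n]$; $q_\mathbb{R}$ is the same polynomial on $\mathbb{R}^{n+1}$ and $Z(q_\mathbb{R})$ its zero set in $\mathbb{P}^n(\mathbb{R})$. With $b(\mathbf{x},\mathbf{y})=q(\mathbf{x}+\mathbf{y})-q(\mathbf{x})-q(\mathbf{y})$, a hyperbolic plane is a 2-dimensional subspace with basis $\mathbf{x},\mathbf{y}$, $q(\mathbf{x})=q(\mathbf{y})=0$, $b(\mathbf{x},\mathbf{y})\neq0$; the Witt index is the unique $m$ with $\mathbb{Q}^{n+1}=\ker(q)\perp H_1\perp\cdots\perp H_m\perp W$, $H_i$ hyperbolic planes, $W$ anisotropic, $\ker(q)$ the kernel of $b$. Norms: Euclidean on $\mathbb{R}^{n+1}$, and on $\bigwedge^2\mathbb{R}^{n+1}$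 the norm making $\mathbf{e}_i\wedge\mathbf{e}_j$ ($i<j$) orthonormal. For $\xi=[\boldsymbol{\xi}]$, $D_\xi(\mathbf{x})=\|\mathbf{x}\wedge\boldsymbol{\xi}\|/\|\boldsymbol{\xi}\|$ and $\mathcal{D}_\xi(X)=\min\{D_\xi(\mathbf{x}):\mathbf{x}\in\mathbb{Z}^{n+1}\setminus\{0\},\|\mathbf{x}\|\le X\}$ for $X\ge 1$. $Z^{\mathrm{li}}$ is the set of points of $Z$ whose representatives have $\mathbb{Q}$-linearly independent coordinates. *)

(* Defs.v *)
From HB Require Import structures.
From mathcomp Require Import all_boot all_order all_algebra.
From mathcomp Require Import all_classical all_reals all_analysis.
From mathcomp Require Import ring lra zify.
(* The notations of mpoly clash with those of the analysis library. *)
From mathcomp Require Import -(notations) mpoly.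

Set Implicit Arguments.
Unset Strict Implicit.
Unset Printing Implicit Defensive.

Import Order.TTheory GRing.Theory Num.Theory.
Import numFieldNormedType.Exports.

Local Open Scope classical_set_scope.
Local Open Scope ring_scope.

Definition is_quadratic_form (n : nat) (q : mpoly n.+1 rat) : Prop :=
  q != 0 /\ q \is ishomog1 2 (@mdeg n.+1).

Definition qeval (K : fieldType) (n : nat) (q : mpoly n.+1 K)
    (x : 'rV[K]_n.+1) : K :=
  meval (fun i => x 0 i) q.

Definition bilin (n : nat) (q : mpoly n.+1 rat) (x y : 'rV[rat]_n.+1) : rat :=
  qeval q (x + y) - qeval q x - qeval q y.

Definition is_kernel (n : nat) (q : mpoly n.+1 rat)
    (K : {vspace 'rV[rat]_n.+1}) : Prop :=
  forall x, x \in K <-> forall y, bilin q x y = 0.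

Definition hyperbolic_plane (n : nat) (q : mpoly n.+1 rat)
    (H : {vspace 'rV[rat]_n.+1}) : Prop :=
  exists x y, [/\ basis_of H [:: x; y], qeval q x = 0, qeval q y = 0 &
                  bilin q x y != 0].

Definition anisotropic (n : nat) (q : mpoly n.+1 rat)
    (W : {vspace 'rV[rat]_n.+1}) : Prop :=
  forall x, x \in W -> x != 0 -> qeval q x != 0.

Definition orthogonal_spaces (n : nat) (q : mpoly n.+1 rat)
    (U V : {vspace 'rV[rat]_n.+1}) : Prop :=
  forall x y, x \in U -> y \in V -> bilin q x y = 0.

(* Uniqueness of m is Witt's theorem. *)
Definition has_Witt_index (n : nat) (q : mpoly n.+1 rat) (m : nat)
    : Prop :=
  exists (K : {vspace 'rV[rat]_n.+1}) (H : 'I_m -> {vspace 'rV[rat]_n.+1})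
         (W : {vspace 'rV[rat]_n.+1}),
  [/\ is_kernel q K, forall i, hyperbolic_plane q (H i) & anisotropic q W] /\
  [/\ forall i, orthogonal_spaces q K (H i), orthogonal_spaces q K W,
      forall i j, i != j -> orthogonal_spaces q (H i) (H j) &
      forall i, orthogonal_spaces q (H i) W] /\
  ((K + (\sum_(i < m) H i) + W)%VS = fullv /\
   directv (K + (\sum_(i < m) H i) + W)).

(* Points of P^n(R) are the lines of R^(n+1) through the origin. *)
Definition proj_space (R : realType) (n : nat) : Type :=
  {U : {vspace 'rV[R]_n.+1} | \dim U == 1%N}.

Definition represents (R : realType) (n : nat) (v : 'rV[R]_n.+1)
    (xi : proj_space R n) : Prop :=
  v != 0 /\ v \in val xi.

Definition zero_set (R : realType) (n : nat) (q : mpoly n.+1 R)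
    : set (proj_space R n) :=
  [set xi | forall v, represents v xi -> qeval q v = 0].

Definition Q_independent (R : realType) (n : nat) (v : 'rV[R]_n.+1) : Prop :=
  forall a : 'rV[rat]_n.+1, \sum_i ratr (a 0 i) * v 0 i = 0 -> a = 0.

Definition li_part (R : realType) (n : nat) (Z : set (proj_space R n))
    : set (proj_space R n) :=
  [set xi | Z xi /\ forall v, represents v xi -> Q_independent v].

(* The norm on matrices of the analysis library is the sup norm. *)
Definition eucl_norm (R : realType) (n : nat) (x : 'rV[R]_n.+1) : R :=
  Num.sqrt (\sum_i x 0 i ^+ 2).

(* x i * y j - x j * y i is the coordinate of the wedge product of x and y
   along e_i /\ e_j. *)
Definition wedge_norm (R : realType) (n : nat) (x y : 'rV[R]_n.+1) : R :=
  Num.sqrt (\sum_(i < n.+1) \sum_(j < n.+1 | (i < j)%N)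
              (x 0 i * y 0 j - x 0 j * y 0 i) ^+ 2).

(* vpick picks one representative; Dpt_rep shows that the value does not
   depend on it. *)
Definition Dpt (R : realType) (n : nat) (xi : proj_space R n)
    (x : 'rV[R]_n.+1) : R :=
  wedge_norm x (vpick (val xi)) / eucl_norm (vpick (val xi)).

Definition int_vec (R : realType) (n : nat) (z : 'rV[int]_n.+1)
    : 'rV[R]_n.+1 := map_mx intr z.

(* For X >= 1 the infimum is a minimum, see Dmin_attained. *)
Definition Dmin (R : realType) (n : nat) (xi : proj_space R n) (X : R) : R :=
  inf [set Dpt xi (int_vec R z) | z in
        [set z : 'rV[int]_n.+1 | z != 0 /\ eucl_norm (int_vec R z) <= X]].

Lemma represents_vpick (R : realType) (n : nat) (xi : proj_space R n) :
  represents (vpick (val xi)) xi.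
Proof.
split; last exact: memv_pick.
by rewrite vpick0 -dimv_eq0 (eqP (valP xi)).
Qed.

Lemma eucl_normZ (R : realType) (n : nat) (k : R) (x : 'rV[R]_n.+1) :
  eucl_norm (k *: x) = `|k| * eucl_norm x.
Proof.
rewrite /eucl_norm -sqrtr_sqr -sqrtrM ?sqr_ge0// mulr_sumr.
by congr Num.sqrt; apply: eq_bigr => i _; rewrite mxE exprMn.
Qed.

Lemma wedge_normZr (R : realType) (n : nat) (k : R) (x y : 'rV[R]_n.+1) :
  wedge_norm x (k *: y) = `|k| * wedge_norm x y.
Proof.
rewrite /wedge_norm -sqrtr_sqr -sqrtrM ?sqr_ge0// mulr_sumr.
congr Num.sqrt; apply: eq_bigr => i _; rewrite mulr_sumr.
by apply: eq_bigr => j _; rewrite !mxE; ring.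
Qed.

Lemma Dpt_rep (R : realType) (n : nat) (xi : proj_space R n)
    (v x : 'rV[R]_n.+1) :
  represents v xi -> Dpt xi x = wedge_norm x v / eucl_norm v.
Proof.
move=> [v0 vxi]; have [p0 pxi] := represents_vpick xi.
have lineE : (<[vpick (val xi)]>)%VS = val xi.
  apply/eqP; rewrite eqEdim -memvE memv_pick dim_vline p0.
  by rewrite (eqP (valP xi)).
move: vxi; rewrite -lineE => /vlineP[k vE].
have k0 : k != 0 by apply: contraNneq v0 => k0; rewrite vE k0 scale0r.
rewrite vE wedge_normZr eucl_normZ /Dpt -mulf_div divff ?mul1r//.
by rewrite normr_eq0.
Qed.

Lemma coord_le_eucl_norm (R : realType) (n : nat) (x : 'rV[R]_n.+1) i :
  `|x 0 i| <= eucl_norm x.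
Proof.
rewrite -sqrtr_sqr ler_wsqrtr// (bigD1 i)//= lerDl.
by apply: sumr_ge0 => j _; exact: sqr_ge0.
Qed.

Lemma finite_int_ball (R : realType) (n : nat) (X : R) :
  finite_set [set z : 'rV[int]_n.+1 | eucl_norm (int_vec R z) <= X].
Proof.
have [N XN] : exists N : nat, X < N%:R.
  exists (Num.bound `|X|); apply: le_lt_trans (ler_norm X) _.
  exact: archi_boundP.
pose f (t : {ffun 'I_n.+1 -> 'I_(N + N).+1}) : 'rV[int]_n.+1 :=
  \row_i ((t i)%:Z - N%:Z).
have := @finite_image _ _ _ f (@finite_finset _ setT).
apply: sub_finite_set => z /= zX.
have zN i : (absz (z 0%R i) < N)%N.
  rewrite -(ltr_nat R) natr_absz intr_norm.
  apply: le_lt_trans XN; apply: le_trans zX.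
  by have := coord_le_eucl_norm (int_vec R z) i; rewrite mxE.
exists [ffun i => inord (absz (z 0%R i + N%:Z)%R)] => //.
apply/rowP => i; rewrite mxE ffunE inordK; have := zN i; lia.
Qed.

Lemma seq_argmin (R : realType) (T : eqType) (f : T -> R) (s : seq T) (x : T) :
  x \in s -> exists2 z, z \in s & forall y, y \in s -> f z <= f y.
Proof.
elim: s x => // a s IHs x _; case: s IHs => [|b s] IHs.
  by exists a; rewrite ?mem_head// => y; rewrite inE => /eqP->.
have [z zs zmin] := IHs b (mem_head _ _).
have [le_az|/ltW le_za] := leP (f a) (f z).
  exists a => [|y]; first exact: mem_head.
  rewrite in_cons => /predU1P[->//|/zmin].
  exact: le_trans.
exists z => [|y]; first by rewrite in_cons zs orbT.
by rewrite in_cons => /predU1P[->//|/zmin].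
Qed.

Lemma Dmin_attained (R : realType) (n : nat) (xi : proj_space R n) (X : R) :
  1 <= X ->
  (exists2 z : 'rV[int]_n.+1, z != 0 /\ eucl_norm (int_vec R z) <= X &
     Dmin xi X = Dpt xi (int_vec R z)) /\
  (forall z : 'rV[int]_n.+1, z != 0 -> eucl_norm (int_vec R z) <= X ->
     Dmin xi X <= Dpt xi (int_vec R z)).
Proof.
move=> X1; pose A := [set z : 'rV[int]_n.+1 |
  z != 0 /\ eucl_norm (int_vec R z) <= X].
pose e : 'rV[int]_n.+1 := delta_mx 0 0.
have Ae : A e.
  split; first by apply/eqP => /rowP/(_ 0); rewrite !mxE !eqxx.
  apply: le_trans X1; rewrite /eucl_norm (bigD1 0)//= !mxE !eqxx big1 => [|i i0].
    by rewrite addr0 expr1n sqrtr1.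
  by rewrite !mxE (negPf i0) expr0n.
have /finite_seqP[s As] : finite_set A.
  by apply: sub_finite_set (@finite_int_ball R n X) => z [].
have AsP z : A z <-> z \in s by rewrite As.
have [z /AsP Az zmin] := seq_argmin (fun z => Dpt xi (int_vec R z))
  ((AsP e).1 Ae).
have lbA : lbound [set Dpt xi (int_vec R z) | z in A] (Dpt xi (int_vec R z)).
  by move=> _ [y /AsP ys <-]; exact: zmin.
have DE : Dmin xi X = Dpt xi (int_vec R z).
  apply/eqP; rewrite eq_le; apply/andP; split.
    by apply: ge_inf; [exists (Dpt xi (int_vec R z)) | exists z].
  by apply: lb_le_inf => //; exists (Dpt xi (int_vec R e)), e.
split; first by exists z.
by move=> y y0 yX; rewrite DE; apply: lbA; exists y.
Qed.

Lemma rho_exists_unique (R : realType) (n : nat) : (2 <= n)%N ->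
  exists2 rho : R, 1 < rho < 2 &
    forall x : R, 0 < x /\ root ('X^n - \sum_(i < n) 'X^i) x <-> x = rho.
Proof.
move=> n2; set p := 'X^n - _.
have pE (x : R) : p.[x] = x ^+ n - \sum_(i < n) x ^+ i.
  rewrite /p !hornerE horner_sum; congr (_ - _).
  by apply: eq_bigr => i _; rewrite hornerXn.
have p1 : p.[1] < 0.
  rewrite pE expr1n (eq_bigr (fun=> 1)) => [|i _]; last by rewrite expr1n.
  by rewrite sumr_const card_ord subr_lt0 ltr1n.
have p2 : p.[2] = 1.
  rewrite pE; have := subrX1 (2 : R) n.
  by rewrite [2 - 1](_ : _ = 1) ?mul1r; [lra|ring].
have rootE x : root p x -> x ^+ n = \sum_(i < n) x ^+ i.
  by move=> /rootP; rewrite pE => /eqP; rewrite subr_eq0 => /eqP.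
have lt_root x y : 0 < x -> x < y -> root p x -> root p y -> False.
  move=> x0 xy /rootE rx /rootE ry.
  have y0 : 0 < y by exact: lt_trans xy.
  have : \sum_(i < n) y ^+ i * x ^+ n < \sum_(i < n) x ^+ i * y ^+ n.
    apply: ltr_sum => [|i _].
      by apply/hasP; exists (Ordinal (ltnW n2)); rewrite ?mem_index_enum.
    have -> : x ^+ n = x ^+ i * x ^+ (n - i) by rewrite -exprD subnKC// ltnW.
    have -> : y ^+ n = y ^+ i * y ^+ (n - i) by rewrite -exprD subnKC// ltnW.
    rewrite !mulrA [y ^+ i * _]mulrC ltr_pM2l ?mulr_gt0 ?exprn_gt0//.
    by rewrite ltrXn2r ?nnegrE ?(ltW x0) ?(ltW y0)// subn_eq0 leqNgt ltn_ord.
  by rewrite -!mulr_suml -rx -ry mulrC ltxx.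
have [||r /andP[r1 r2] rr] := @poly_ivt R p 1 2.
- by lra.
- by rewrite p2 (ltW p1) ler01.
have r1' : 1 < r.
  rewrite lt_def r1 andbT; apply/eqP => r1E.
  by move: rr p1; rewrite r1E => /rootP->; rewrite ltxx.
exists r.
  rewrite r1' lt_def r2 andbT eq_sym; apply/eqP => r2E.
  by move: rr p2; rewrite r2E => /rootP-> /eqP; rewrite eq_sym oner_eq0.
have r0 : 0 < r by exact: lt_trans r1'.
move=> x; split=> [[x0 xr]|->//].
have [xltr|rltx|//] := ltgtP x r.
  by case: (lt_root _ _ x0 xltr xr rr).
by case: (lt_root _ _ r0 rltx rr xr).
Qed.

(* Main.v *)
(* Write q(x) = c x S x^T with S integral and b(x, y) = x S y^T, and put
   a = 1/rho, so that a + a^2 + ... + a^n = 1.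

   Lower bound. Suppose X^a D_xi(X) -> 0, let x_k be the successive best
   approximations to xi, h_k their heights and L_k their errors. If x_(k+1) is
   isotropic then the integer vector b(x_k, x_k) x_(k+1) - 2 b(x_k, x_(k+1)) x_k
   tends to 0, hence vanishes, so that x_k and x_(k+1) span a totally isotropic
   plane; as the Witt index is at most 1 this plane meets the kernel of q, and
   this cannot go on. So q(x_k) <> 0 eventually, which forces L_k >= c / h_k and
   h_(k+1)^a <= h_k. Among the x_k choose independent vectors x_(m_0), ...,
   x_(m_n), each m_i being minimal. Each x_(m_i) is then close to a multiple of
   its predecessor, and the determinant of the n + 1 vectors is smaller than
   h_(m_n)^(1 - a - ... - a^n) = 1, while it is a nonzero integer.

   Upper bound. Normalise B so that B(e0, e0) = 2 for a rational e0. Starting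
   from n + 1 suitable vectors with B(x, x) = 2, built on a Pell equation, put
   x_(i+n+1) = t_i x_(i+n) - x_i with t_i = B(x_(i+n), x_i): the new vector is
   up to sign the reflection of x_i in x_(i+n). The t_i are integers growing at
   least geometrically, so the x_i have a bounded denominator and converge in
   projective space, to an isotropic limit at distance O(1/L_i) from x_i, where
   L_i is the size of x_i. Moreover L_(i+n+1) L_i / L_(i+n)^2 tends to 1 very
   quickly, and this linear recurrence for log L_i, with characteristic root
   rho, gives L_(i+1) = O(L_i^rho). Rational reflections of the limit provide
   infinitely many points. *)

Require Import Defs.
From mathcomp Require Import all_boot all_order all_algebra.
From mathcomp Require Import all_classical all_reals all_analysis.
From mathcomp Require Import ring lra zify perm.
From mathcomp Require Import -(notations) mpoly.

Set Implicit Arguments.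
Unset Strict Implicit.
Unset Printing Implicit Defensive.

Import Order.TTheory GRing.Theory Num.Theory.
Import numFieldNormedType.Exports.

Local Open Scope classical_set_scope.
Local Open Scope ring_scope.

(** * Quadratic forms and their matrices *)

(** The bound on the Witt index enters through one consequence: two orthogonal isotropic rational
    vectors have a nontrivial combination in the kernel of b. For consecutive x_k this makes the
    linear forms x_k S proportional, so that all late x_k satisfy one fixed rational equation,
    against the independence of the coordinates of xi. For the upper bound the obstacle is
    cancellation in t_i x_(i+n) - x_i. It is excluded by an invariant of n + 1 consecutive vectors:
    B(x_n, x_0) dominates the other pairings and the values B(x_n, x_i), i < n, are at least 3
    apart. The starting vectors thus need integral pairings of widely different sizes. Pell's
    equation u^2 - d s^2 = 1 supplies them, in a rational plane on which the form is a (u^2 - d s^2)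
    with d not a square; a point of Z^li provides such a plane. Sizes are measured by the linear
    form B(., x_0), hence obey the recurrence of the vectors. Their logarithms nearly satisfy
    y_(i+n+1) = 2 y_(i+n) - y_i, with characteristic polynomial (x - 1) (x^n - x^(n-1) - ... - 1):
    this is where rho arises. *)

Definition bform (K : comNzRingType) m (S : 'M[K]_m) (x y : 'rV[K]_m) : K :=
  (x *m S *m y^T) 0 0.

Section BilinearForm.
Context (K : comNzRingType) (m : nat) (S : 'M[K]_m).
Implicit Types (x y z : 'rV[K]_m) (a : K).

Lemma bformE x y : bform S x y = \sum_i \sum_j x 0 i * S i j * y 0 j.
Proof.
rewrite /bform mxE exchange_big; apply: eq_bigr => j _ /=.
by rewrite mxE big_distrl; apply: eq_bigr => i _; rewrite !mxE.
Qed.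

Lemma bformDl x y z : bform S (x + y) z = bform S x z + bform S y z.
Proof. by rewrite /bform !mulmxDl mxE. Qed.

Lemma bformDr x y z : bform S x (y + z) = bform S x y + bform S x z.
Proof. by rewrite /bform linearD mulmxDr mxE. Qed.

Lemma bformZl a x y : bform S (a *: x) y = a * bform S x y.
Proof. by rewrite /bform -!scalemxAl mxE. Qed.

Lemma bformZr a x y : bform S x (a *: y) = a * bform S x y.
Proof. by rewrite /bform linearZ -scalemxAr mxE. Qed.

Lemma bformNl x y : bform S (- x) y = - bform S x y.
Proof. by rewrite -scaleN1r bformZl mulN1r. Qed.

Lemma bformNr x y : bform S x (- y) = - bform S x y.
Proof. by rewrite -scaleN1r bformZr mulN1r. Qed.

Lemma bform0l x : bform S 0 x = 0.
Proof. by rewrite -[0](scale0r 0) bformZl mul0r. Qed.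

Lemma bformC x y : S^T = S -> bform S x y = bform S y x.
Proof.
move=> symS; rewrite /bform; set M := _ *m _.
have -> : M 0 0 = M^T 0 0 by rewrite [RHS]mxE.
by rewrite /M !trmx_mul trmxK symS mulmxA.
Qed.

End BilinearForm.

Definition bformL := (bformDl, bformDr, bformZl, bformZr, bformNl, bformNr).

Lemma map_bform (K L : comNzRingType) (f : {rmorphism K -> L}) m
    (S : 'M[K]_m) x y :
  bform (map_mx f S) (map_mx f x) (map_mx f y) = f (bform S x y).
Proof. by rewrite /bform map_trmx -!map_mxM mxE. Qed.

Lemma map_intr_ratr (R : numFieldType) p r (A : 'M[int]_(p, r)) :
  map_mx intr A = map_mx ratr (map_mx intr A : 'M[rat]_(p, r)) :> 'M[R]_(p, r).
Proof. by rewrite -map_mx_comp; apply: eq_map_mx => k /=; rewrite ratr_int. Qed.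

Lemma mdeg2_split k (u : multinom k) :
  mdeg u = 2 -> exists i j, u = mnm_add (mnm1 i) (mnm1 j).
Proof.
move=> u2; have /existsP[i ui] : [exists i, u i != 0%N].
  apply: contra_eqT u2 => /existsPn u0; rewrite mdegE big1 // => i _.
  by apply/eqP; have := u0 i; rewrite negbK.
have le_iu : lem (mnm1 i) u by rewrite lep1mP.
have uE := submK le_iu; exists i.
have /mdeg1P[j /eqP uj] : mdeg (mnm_sub u (mnm1 i)) == 1%N.
  by have := congr1 (@mdeg k) uE; rewrite mdegD mdeg1 u2 addn1 => -[->].
by exists j; rewrite -uE uj addmC.
Qed.

Lemma ishomog2_matrix k (q : mpoly k rat) : q \is ishomog1 2 (@mdeg k) ->
  exists A : 'M[rat]_k,
    q = \sum_i \sum_j A i j *: (mpolyX rat (mnm1 i) * mpolyX rat (mnm1 j)).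
Proof.
move=> /dhomogP q2; pose P (p : mpoly k rat) := exists A : 'M[rat]_k,
    p = \sum_i \sum_j A i j *: (mpolyX rat (mnm1 i) * mpolyX rat (mnm1 j)).
suff: P q by []; rewrite (mpolyE q) big_seq; apply: (big_ind P).
- exists 0; rewrite big1 // => i _; rewrite big1 // => j _.
  by rewrite mxE scale0r.
- move=> _ _ [A ->] [B ->]; exists (A + B); rewrite -big_split.
  apply: eq_bigr => i _; rewrite -big_split; apply: eq_bigr => j _.
  by rewrite mxE scalerDl.
move=> u /q2 /mdeg2_split[i [j ->]]; set c := mcoeff _ _.
exists (c *: delta_mx i j); rewrite (bigD1 i) //= (bigD1 j) //=.
rewrite !mxE !eqxx mulr1 mpolyXD !big1 ?addr0 // => [l li|l lj].
  by rewrite big1 // => l' _; rewrite !mxE (negPf li) mulr0 scale0r.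
by rewrite !mxE (negPf lj) andbF mulr0 scale0r.
Qed.

Lemma common_denominator (I : finType) (r : I -> rat) :
  exists2 N : nat, (0 < N)%N & forall i, N%:R * r i \is a Num.int.
Proof.
exists (\prod_i `|denq (r i)|%N)%N.
  by rewrite prodn_gt0 // => i; rewrite absz_gt0 denq_eq0.
move=> i; rewrite (bigD1 i) //= mulnC natrM -mulrA rpredM ?natr_int //.
rewrite natr_absz ger0_norm ?denq_ge0 // -[X in _ * X]divq_num_den mulrC divfK.
  by rewrite intr_int.
by rewrite intr_eq0 denq_eq0.
Qed.

(** Adding the transpose makes the matrix symmetric and N clears denominators, so that S is integral
    on integral vectors. If N (A + A^T) were zero, A would be antisymmetric and q = - q. *)
Lemma quadratic_form_bform (R : realType) n (q : mpoly n.+1 rat) :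
    is_quadratic_form q ->
  exists (c : rat) (S : 'M[int]_n.+1), [/\ c != 0, S != 0, S^T = S,
    forall x : 'rV[rat]_n.+1, qeval q x = c * bform (map_mx intr S) x x &
    forall x : 'rV[R]_n.+1, qeval (map_mpoly ratr q) x =
      ratr c * bform (map_mx intr S) x x].
Proof.
move=> [q0 /ishomog2_matrix[A qA]].
have [N N0 NA] := common_denominator (fun ij : 'I_n.+1 * 'I_n.+1 => A ij.1 ij.2).
have qE (L : fieldType) (f : {rmorphism rat -> L}) (x : 'rV[L]_n.+1) :
    qeval (map_mpoly f q) x = bform (map_mx f A) x x.
  pose phi : {rmorphism mpoly n.+1 rat -> L} :=
    meval (fun i => x 0 i) \o map_mpoly f.
  rewrite bformE -[LHS]/(phi q) qA rmorph_sum; apply: eq_bigr => i _.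
  rewrite rmorph_sum; apply: eq_bigr => j _ /=.
  rewrite map_mpolyZ mevalZ rmorphM /= !map_mpolyX mevalM !mevalXU !mxE.
  by ring.
pose S := \matrix_(i, j) (numq (N%:R * A i j) + numq (N%:R * A j i)) : 'M[int]_n.+1.
have SE : map_mx intr S = N%:R *: (A + A^T).
  apply/matrixP => i j; rewrite !mxE rmorphD /= !numqK ?(NA (_, _)) //.
  by rewrite mulrDr.
have symS : S^T = S by apply/matrixP => i j; rewrite !mxE addrC.
have N0' : (2 * N%:R : rat) != 0 by rewrite mulf_neq0 // pnatr_eq0 -lt0n.
exists (2 * N%:R)^-1, S.
have bA (L : fieldType) (f : {rmorphism rat -> L}) (x : 'rV[L]_n.+1) :
    bform (map_mx intr S) x x = f (2 * N%:R) * bform (map_mx f A) x x.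
  have -> : map_mx intr S = map_mx f (N%:R *: (A + A^T)).
    rewrite -SE -map_mx_comp; apply: eq_map_mx => k /=.
    by rewrite rmorph_int.
  rewrite map_mxZ map_mxD /= !rmorphM /= /bform -scalemxAr -scalemxAl mxE.
  rewrite mulmxDr mulmxDl mxE.
  set M := _ *m map_mx f A^T *m _.
  have -> : M 0 0 = M^T 0 0 by rewrite [RHS]mxE.
  by rewrite /M !trmx_mul trmxK map_trmx trmxK mulmxA rmorphMn rmorph1; ring.
have c0 : (2 * N%:R)^-1 * (2 * N%:R) = 1 :> rat by rewrite mulVf.
split => // [|||x].
- by rewrite invr_eq0.
- apply: contraNneq q0 => S0; apply/eqP.
  have AN i j : A i j = - A j i.
    have /matrixP/(_ i j) := SE; rewrite S0 !mxE mulr0z => /esym/eqP.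
    rewrite mulf_eq0 pnatr_eq0 (gtn_eqF N0) /= addr_eq0 => /eqP->.
    by [].
  have : q = - q.
    rewrite {1}qA exchange_big qA -sumrN; apply: eq_bigr => i _ /=.
    rewrite -sumrN; apply: eq_bigr => j _; rewrite AN scaleNr.
    by rewrite [in RHS]mulrC.
  move/eqP; rewrite -addr_eq0 -mulr2n -scaler_nat scaler_eq0 pnatr_eq0 /=.
  by move/eqP.
- move=> x; rewrite (bA rat idfun) mulrA /= c0 mul1r.
  have <- : map_mpoly idfun q = q.
    by apply/mpolyP => u; rewrite mcoeff_map_mpoly.
  by rewrite (qE rat idfun).
- by rewrite (bA R (@ratr R)) mulrA -rmorphM /= c0 rmorph1 mul1r -qE.
Qed.

Lemma linear_relation2 (F : fieldType) (a b : F) :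
  exists s t : F, (s != 0) || (t != 0) /\ s * a + t * b = 0.
Proof.
have [->|a0] := eqVneq a 0.
  by exists 1, 0; rewrite oner_eq0 mulr0 mul0r addr0.
by exists b, (- a); split; [rewrite oppr_eq0 a0 orbT|ring].
Qed.

(** Write u and v along the kernel, a hyperbolic pair p, r and W. A combination z without
    p-component is isotropic, so its W-component vanishes by anisotropy and z = k + b r. If b r = 0,
    z is in the kernel. Otherwise orthogonality of z to u and v forces their p-components to vanish,
    and the combination killing the r-component is in the kernel. *)
Lemma Witt_le1_isotropic n (q : mpoly n.+1 rat) m (S : 'M[rat]_n.+1) c :
    has_Witt_index q m -> (m <= 1)%N -> c != 0 -> S^T = S ->
    (forall x, qeval q x = c * bform S x x) ->
  forall u v, bform S u u = 0 -> bform S v v = 0 -> bform S u v = 0 ->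
  exists s t : rat, (s != 0) || (t != 0) /\
    forall y, bform S (s *: u + t *: v) y = 0.
Proof.
move=> [K [H [W [[KE Hhyp Waniso] [[KH KW _ HW] [full _]]]]]] m1 c0 symS qE.
have bE x y : (bilin q x y == 0) = (bform S x y == 0).
  have -> : bilin q x y = 2 * c * bform S x y.
    by rewrite /bilin !qE !bformL (bformC y x symS); ring.
  by rewrite !mulf_eq0 (negPf c0).
have Kb k : k \in K -> forall y, bform S k y = 0.
  by move=> /KE kK y; apply/eqP; rewrite -bE kK.
have Kb' k : k \in K -> forall y, bform S y k = 0.
  by move=> kK y; rewrite bformC // Kb.
have Wb w : w \in W -> bform S w w = 0 -> w = 0.
  move=> wW w0; apply/eqP; apply: contraT => /(Waniso _ wW).
  by rewrite qE w0 mulr0 eqxx.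
(* For [m = 0] the missing hyperbolic plane is replaced by p = r = 0, which is why r = 0 is
   allowed. *)
have [p [r [pp rr pr pW [rW dec]]]] : exists p r, [/\ bform S p p = 0,
    bform S r r = 0, r = 0 \/ bform S p r != 0,
    forall w, w \in W -> bform S p w = 0 &
    (forall w, w \in W -> bform S r w = 0) /\
    (forall u, exists k w a b, [/\ k \in K, w \in W &
       u = k + a *: p + b *: r + w])].
  case: m m1 H Hhyp KH HW full => [|[|//]] _ H Hhyp KH HW full.
    exists 0, 0; split; rewrite ?bform0l //; try by move=> *; rewrite bform0l.
      by left.
    split=> [w _|u]; first by rewrite bform0l.
    have : u \in fullv by rewrite memvf.
    rewrite -full big_ord0 addv0 => /memv_addP[k kK [w wW ->]].
    by exists k, w, 0, 0; rewrite !scale0r !addr0.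
  have [p [r [/andP[/eqP spanH _] p0 r0 prn0]]] := Hhyp ord0.
  have inH a b : a *: p + b *: r \in H ord0.
    by rewrite -spanH rpredD // rpredZ // memv_span // !inE eqxx ?orbT.
  exists p, r; split.
  - by move/eqP: p0; rewrite qE mulf_eq0 (negPf c0) => /eqP.
  - by move/eqP: r0; rewrite qE mulf_eq0 (negPf c0) => /eqP.
  - by right; move: prn0; rewrite bE.
  - move=> w wW; apply/eqP; rewrite -bE; apply/eqP/(HW ord0 p w _ wW).
    by have := inH 1 0; rewrite scale1r scale0r addr0.
  split=> [w wW|u].
    apply/eqP; rewrite -bE; apply/eqP/(HW ord0 r w _ wW).
    by have := inH 0 1; rewrite scale1r scale0r add0r.
  have : u \in fullv by rewrite memvf.
  rewrite -full big_ord1 => /memv_addP[k' /memv_addP[k kK [h hH ->]] [w wW ->]].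
  move: hH; rewrite -spanH span_cons span_seq1.
  move=> /memv_addP[_ /vlineP[a ->] [_ /vlineP[b ->] ->]].
  by exists k, w, a, b; rewrite addrA.
move=> u v uu vv uv.
have [ku [wu [au [bu [kuK wuW uE]]]]] := dec u.
have [kv [wv [av [bv [kvK wvW vE]]]]] := dec v.
have comb s t : s *: u + t *: v = (s *: ku + t *: kv)
    + (s * au + t * av) *: p + (s * bu + t * bv) *: r + (s *: wu + t *: wv).
  by rewrite uE vE; apply/rowP => i; rewrite !mxE; ring.
have combK s t : s *: ku + t *: kv \in K by rewrite rpredD // rpredZ.
have combW s t : s *: wu + t *: wv \in W by rewrite rpredD // rpredZ.
have isoW s t b : s * au + t * av = 0 -> b = s * bu + t * bv ->
    s *: u + t *: v = (s *: ku + t *: kv) + b *: r.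
  move=> ea eb; rewrite comb ea scale0r addr0 eb.
  suff -> : s *: wu + t *: wv = 0 by rewrite addr0.
  apply: Wb => //; have := combW s t; set w := s *: wu + _ => wW.
  have : bform S (s *: u + t *: v) (s *: u + t *: v) = 0.
    by rewrite !bformL uu vv (bformC v u symS) uv !mulr0 !addr0.
  rewrite comb ea scale0r addr0 -/w; set k := s *: ku + _.
  have kK : k \in K by exact: combK.
  clearbody k w.
  rewrite !bformL !(Kb k) // !(Kb' k) // (bformC w r symS) (rW w wW).
  by rewrite rr !(mulr0, addr0, add0r).
have [s [t [st0 ea]]] := linear_relation2 au av.
have zE := isoW _ _ _ ea erefl.
have [|bn0] := eqVneq ((s * bu + t * bv) *: r) 0.
  by move=> br0; exists s, t; split=> // y; rewrite zE br0 addr0 Kb.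
have [r0|prn0] := pr; first by move: bn0; rewrite r0 scaler0 eqxx.
have [b0 r0] : s * bu + t * bv != 0 /\ r != 0.
  by move: bn0; rewrite scaler_eq0 negb_or => /andP.
(* Pairing with z = k + b r reads off the p-component, up to the nonzero factor b b(r, p). *)
have rb x kx ax bx wx : kx \in K -> wx \in W ->
    x = kx + ax *: p + bx *: r + wx ->
    bform S (s *: u + t *: v) x = 0 -> ax = 0.
  move=> kxK wxW ->; rewrite {}zE; move: (combK s t).
  set k := s *: ku + _ => kK; clearbody k.
  rewrite !bformL !(Kb _ kK) !(Kb' _ kxK).
  rewrite (rW wx wxW) rr (bformC r p symS) !(mulr0, addr0, add0r) => /eqP.
  by rewrite !mulf_eq0 (negPf b0) (negPf prn0) orbF => /eqP.
have au0 : au = 0.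
  by apply: rb kuK wuW uE _; rewrite !bformL uu (bformC v u symS) uv; ring.
have av0 : av = 0.
  by apply: rb kvK wvW vE _; rewrite !bformL vv uv; ring.
have [s' [t' [st0' eb]]] := linear_relation2 bu bv.
exists s', t'; split=> // y.
rewrite (isoW s' t' 0) ?scale0r ?addr0 ?Kb //.
by rewrite au0 av0; ring.
Qed.

(** * Determinants of approximating vectors *)

(** For this norm the best integral approximation is found coordinate by coordinate and the
    determinant bound follows from the Leibniz formula; the norms of the statement are compared with
    it only at the end of each bound. *)
Definition l1 (R : numDomainType) m (x : 'rV[R]_m) : R := \sum_i `|x 0 i|.

Section L1.
Context (R : numDomainType) (m : nat).
Implicit Types (x y : 'rV[R]_m) (A : 'M[R]_m).

Lemma l1_ge0 x : 0 <= l1 x.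
Proof. exact: sumr_ge0. Qed.

Lemma coord_le_l1 x i : `|x 0 i| <= l1 x.
Proof. by rewrite /l1 (bigD1 i) //= lerDl sumr_ge0. Qed.

Lemma l1D x y : l1 (x + y) <= l1 x + l1 y.
Proof. by rewrite -big_split; apply: ler_sum => i _; rewrite mxE ler_normD. Qed.

Lemma l1Z a x : l1 (a *: x) = `|a| * l1 x.
Proof. by rewrite /l1 mulr_sumr; apply: eq_bigr => i _; rewrite mxE normrM. Qed.

Lemma l1N x : l1 (- x) = l1 x.
Proof. by rewrite -scaleN1r l1Z normrN1 mul1r. Qed.

Lemma l1B x y : l1 (x - y) <= l1 x + l1 y.
Proof. by rewrite -[l1 y]l1N l1D. Qed.

Lemma sum_mul_le_l1 (a : 'I_m -> R) x :
  `|\sum_i a i * x 0 i| <= (\sum_i `|a i|) * l1 x.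
Proof.
apply: le_trans (ler_norm_sum _ _ _) _; rewrite mulr_suml.
by apply: ler_sum => i _; rewrite normrM ler_wpM2l // coord_le_l1.
Qed.

Lemma det_le_l1 A : `|\det A| <= m`!%:R * \prod_i l1 (row i A).
Proof.
rewrite /determinant; apply: le_trans (ler_norm_sum _ _ _) _.
apply: (@le_trans _ _ (\sum_(s : 'S_m) \prod_i l1 (row i A))).
  apply: ler_sum => s _; rewrite normrM normrX normrN1 expr1n mul1r normr_prod.
  apply: ler_prod => i _; rewrite normr_ge0 /=.
  by have := coord_le_l1 (row i A) (s i); rewrite mxE.
by rewrite sumr_const card_Sn mulr_natl.
Qed.

End L1.

Lemma bform_bound (R : realDomainType) m (S : 'M[R]_m) :
  exists2 C : R, 0 <= C & forall x y, `|bform S x y| <= C * l1 x * l1 y.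
Proof.
exists (\sum_i \sum_j `|S i j|) => [|x y]; first by do 2!apply: sumr_ge0 => ? _.
rewrite bformE; apply: le_trans (ler_norm_sum _ _ _) _.
rewrite !mulr_suml; apply: ler_sum => i _.
apply: le_trans (ler_norm_sum _ _ _) _; rewrite !mulr_suml.
apply: ler_sum => j _; rewrite !normrM [`|x _ _| * _]mulrC.
by rewrite ler_pM ?mulr_ge0 // ?ler_wpM2l // ?coord_le_l1.
Qed.

(* Each new index is minimal, so that its predecessor stays in the span of the
   vectors already chosen. *)
Lemma greedy_basis n (x : nat -> 'rV[rat]_n.+1) (i0 : nat) :
    x i0 != 0 -> (forall (a : 'cV[rat]_n.+1) k, a != 0 ->
       exists j, (k < j)%N /\ x j *m a != 0) ->
  exists m : nat -> nat, [/\ m 0 = i0, forall k, (m k < m k.+1)%N,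
    \matrix_(i < n.+1) x (m i) \in unitmx &
    forall k, (k < n)%N -> exists c : nat -> rat,
      x (m k.+1).-1 = \sum_(l < k.+1) c l *: x (m l)].
Proof.
move=> x0 xspan.
(* The pair holds the last index chosen and the span so far. Once the span is everything any later
   index is accepted, so that the recursion is defined for all k. *)
pose nextP (p : nat * 'M[rat]_n.+1) (j : nat) := (p.1 < j)%N /\
  (~~ row_full p.2 -> ~~ (x j <= p.2)%MS /\
     forall i, (p.1 < i < j)%N -> (x i <= p.2)%MS).
have /choice[nx nxP] : forall p, exists j, nextP p j.
  move=> [k V]; rewrite /nextP /=.
  have [|Vn] := boolP (row_full V); first by exists k.+1.
  have ex : exists j, (k < j)%N && ~~ (x j <= V)%MS.
    have [a aE] : exists a : 'cV[rat]_n.+1, a != 0 /\ V *m a = 0.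
      have Vt : \det V^T = 0.
        apply/eqP; rewrite det_tr; apply: contraNT Vn.
        by rewrite row_full_unit unitmxE unitfE.
      have /eqP/det0P[a a0 aV] := Vt; exists a^T; split.
        by apply: contraNneq a0 => aT0; rewrite -[a]trmxK aT0 trmx0.
      by rewrite -[V]trmxK -trmx_mul aV trmx0.
    have [j [kj xj]] := xspan a k aE.1; exists j; rewrite kj /=.
    by apply: contraNN xj => /submxP[D ->]; rewrite -mulmxA aE.2 mulmx0.
  case: (ex_minnP ex) => j /andP[kj xj] jmin; exists j; split=> // _; split=> //.
  move=> i /andP[ki ij]; apply: contraTT ij => xi.
  by rewrite -leqNgt jmin // ki.
pose st := fix st k := if k is k'.+1 then
  (nx (st k'), (st k').2 + <<x (nx (st k'))>>)%MS else (i0, <<x i0>>%MS).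
pose m k := (st k).1; pose V k := (st k).2.
have V0 : V 0%N = <<x (m 0%N)>>%MS by [].
have VS k : V k.+1 = (V k + <<x (m k.+1)>>)%MS by [].
exists m; split=> //.
- by move=> k; have [] := nxP (st k).
- rewrite -row_full_unit /row_full eqn_leq rank_leq_row /=.
  have VM k : (k < n.+1)%N -> (V k <= \matrix_(i < n.+1) x (m i))%MS.
    elim: k => [|k IH] kn.
      rewrite V0 genmxE; have := row_sub (Ordinal kn) (\matrix_(i < n.+1) x (m i)).
      by rewrite rowK.
    rewrite VS addsmx_sub IH ?(ltnW kn) //= genmxE.
    have := row_sub (Ordinal kn) (\matrix_(i < n.+1) x (m i)).
    by rewrite rowK.
  apply: leq_trans (mxrankS (VM n (ltnSn n))).
  suff rk k : (k <= n)%N -> (k < \rank (V k))%N by exact: rk.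
  elim: k => [_|k IH kn].
    by rewrite V0 lt0n mxrank_eq0 -submx0 genmxE submx0.
  have Vle : (V k <= V k.+1)%MS by rewrite VS addsmxSl.
  have [Vfull|/(nxP (st k)).2[xV _]] := boolP (row_full (V k)).
    by apply: leq_trans (mxrankS Vle); rewrite (eqP Vfull).
  apply: leq_ltn_trans (IH (ltnW kn)) _; apply: rank_ltmx.
  rewrite ltmxE Vle VS addsmx_sub negb_and submx_refl /= genmxE.
  exact: xV.
move=> k kn; have span u : (u <= V k)%MS ->
    exists c : nat -> rat, u = \sum_(l < k.+1) c l *: x (m l).
  elim: k u {kn} => [|k IH] u.
    rewrite V0 genmxE => /sub_rVP[a ->].
    by exists (fun=> a); rewrite big_ord1.
  rewrite VS => /sub_addsmxP[[a b] /= ->].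
  have [c cE] := IH (a *m V k) (submxMl _ _).
  have : (b *m <<x (m k.+1)>> <= x (m k.+1))%MS.
    by apply: submx_trans (submxMl _ _) _; rewrite genmxE.
  move=> /sub_rVP[d dE]; exists (fun l => if l == k.+1 then d else c l).
  rewrite big_ord_recr /= eqxx cE dE; congr (_ + _).
  by apply: eq_bigr => l _; rewrite ltn_eqF // ltnS ltnW.
apply: span; have [Vfull|nVfull] := boolP (row_full (V k)).
  exact: submx_full.
have [_ xV] := (nxP (st k)).2 nVfull.
have mk : (m k < m k.+1)%N by have [] := nxP (st k).
have [->|ne] := eqVneq (m k.+1).-1 (m k).
  case: k {kn nVfull xV mk} => [|k]; first by rewrite V0 genmxE.
  by apply: submx_trans (addsmxSr _ _); rewrite genmxE.
apply: xV; change (m k < (m k.+1).-1 < m k.+1)%N.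
by move/eqP: ne; lia.
Qed.

Lemma map_intr_eq0 (K : numDomainType) p r (z : 'M[int]_(p, r)) :
  (map_mx intr z == 0 :> 'M[K]_(p, r)) = (z == 0).
Proof.
apply/eqP/eqP => [/matrixP z0|->]; last by rewrite map_mx0.
apply/matrixP => i j; apply/eqP; have := z0 i j; rewrite !mxE => /eqP.
by rewrite intr_eq0.
Qed.

Lemma int_det_ge1 (R : realType) n (M : 'M[int]_n) :
  (map_mx intr M : 'M[rat]_n) \in unitmx ->
  1 <= `|\det (map_mx intr M : 'M[R]_n)|.
Proof.
rewrite unitmxE unitfE !det_map_mx intr_eq0 -intr_norm => M0.
by rewrite -[1]/(1%:~R) ler_int -gtz0_ge1 normr_gt0.
Qed.

(* If [x_(m-1)] lies in a subspace, then [x_m] is at distance at most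
   [2 h_m L_(m-1) / h_(m-1)] from it; these distances bound a nonzero integral
   determinant. The exponents satisfy [e_(k+1) = 1 - a + a * (e_k - 1)]. *)
Lemma determinant_bound (R : realType) n (v : 'rV[R]_n.+1) (alpha : R)
    (x : nat -> 'rV[int]_n.+1) (L y : nat -> R) :
    (0 < n)%N -> 0 < alpha <= 1 -> \sum_(l < n) alpha ^+ l.+1 = 1 ->
    (forall k, 0 <= y k <= y k.+1) ->
    (forall k, L k = l1 (int_vec R (x k) - expR (y k) *: v)) ->
    (forall k, L k.+1 <= L k) ->
    (forall eps, 0 < eps -> exists k0, forall k, (k0 <= k)%N ->
       L k <= eps * expR (- (alpha * y k.+1))) ->
    (exists k0, forall k, (k0 <= k)%N -> alpha * y k.+1 <= y k) ->
    (forall a : 'cV[rat]_n.+1, a != 0 ->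
       exists k0, forall k, (k0 <= k)%N -> map_mx intr (x k) *m a != 0) ->
  False.
Proof.
move=> n0 /andP[a0 a1] suma ymono LE Lmono Lsmall [k1 yk1] span.
have y0 k : 0 <= y k by have /andP[] := ymono k.
have yS k : y k <= y k.+1 by have /andP[] := ymono k.
have yle : {homo y : i j / (i <= j)%N >-> i <= j} by exact/nondecreasing_seqP.
have L0 k : 0 <= L k by rewrite LE l1_ge0.
(* Exponent of the last height in the bound for the product of the first k + 1 rows; it reaches 0 at
   k = n. *)
pose e k : R := 1 - \sum_(l < k) alpha ^+ l.+1.
have eS k : e k.+1 = 1 - alpha + alpha * (e k - 1).
  have -> : e k.+1 = 1 - (alpha + alpha * \sum_(l < k) alpha ^+ l.+1).
    rewrite /e big_ord_recl mulr_sumr /= expr1.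
    by under eq_bigr do rewrite /bump leq0n add1n exprS.
  by rewrite /e; ring.
have en : e n = 0 by rewrite /e suma subrr.
have e_anti : {homo e : i j / (i <= j)%N >-> j <= i}.
  apply/nonincreasing_seqP => k.
  by rewrite /e big_ord_recr /= lerD2l lerN2 lerDl exprn_ge0 // ltW.
have e_le1 k : e k <= 1.
  by rewrite /e gerBl sumr_ge0 // => l _; rewrite exprn_ge0 // ltW.
have e_ge0 k : (k <= n)%N -> 0 <= e k by rewrite -en; exact: e_anti.
pose K := l1 v + 1; have K1 : 1 <= K by rewrite lerDr l1_ge0.
pose F := (n.+1)`!%:R * K : R.
have F1 : 1 <= F by rewrite -[1]mulr1 ler_pM // ler1n fact_gt0.
(* The final bound F (2 eps)^n is then at most 2 eps F = 1 / 2. *)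
pose eps := (4 * F)^-1; have F0 : 0 < F by lra.
have eps0 : 0 < eps by rewrite invr_gt0; lra.
have epsF : eps * F = 1 / 4 by rewrite /eps; field; rewrite lt0r_neq0.
have eps1 : 2 * eps <= 1 by nra.
have [k2 Lk2] := Lsmall eps eps0.
have [k3 xk3] : exists k3, forall k, (k3 <= k)%N -> x k != 0.
  have [|k3 k3P] := span (const_mx 1).
    by apply/eqP => /colP/(_ ord0)/eqP; rewrite !mxE oner_eq0.
  exists k3 => k /k3P; apply: contra_neq => ->.
  by rewrite map_mx0 mul0mx.
pose i0 := maxn k1 (maxn k2.+1 k3).
have [||m [m0 mS Munit msp]] :=
    @greedy_basis n (fun k => map_mx intr (x k)) i0.
- by rewrite map_intr_eq0; apply: xk3; rewrite !leq_max leqnn !orbT.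
- move=> a k /span[k' k'P]; exists (maxn k.+1 k'); split.
    by rewrite leq_max ltnSn.
  by apply: k'P; rewrite leq_max leqnn orbT.
have mi0 k : (i0 <= m k)%N.
  by elim: k => [|k IH]; [rewrite m0|apply: leq_trans IH (ltnW (mS k))].
have mk1 k : (k1 <= (m k.+1).-1)%N /\ (k2 <= (m k.+1).-1)%N.
  by have := mi0 k; have := mS k; rewrite /i0; lia.
have [c cE] : exists c : nat -> nat -> rat, forall k, (k < n)%N ->
    map_mx intr (x (m k.+1).-1) = \sum_(l < k.+1) c k l *: map_mx intr (x (m l)).
  have /choice[c cP] : forall k, exists c : nat -> rat, (k < n)%N ->
      map_mx intr (x (m k.+1).-1) = \sum_(l < k.+1) c l *: map_mx intr (x (m l)).
    move=> k; case: (ltnP k n) => [/msp[c cE]|_]; first by exists c.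
    by exists (fun=> 0).
  by exists c.
pose xR k := int_vec R (x k).
have xcE k : (k < n)%N ->
    xR (m k.+1).-1 = \sum_(l < k.+1) ratr (c k l) *: xR (m l).
  move=> /cE /(congr1 (map_mx (@ratr R))).
  have intE (z : 'rV[int]_n.+1) :
      map_mx (@ratr R) (map_mx intr z) = int_vec R z.
    by rewrite -map_mx_comp; apply: eq_map_mx => ? /=; rewrite ratr_int.
  rewrite intE raddf_sum /xR => ->; apply: eq_bigr => l _ /=.
  by rewrite map_mxZ intE.
pose t k := expR (y (m k) - y (m k).-1).
pose w k := if k is k'.+1 then xR (m k) - t k *: xR (m k).-1 else xR (m 0%N).
(* Row i subtracts t_i x_(m_i - 1), expanded in the earlier x_(m_l). The matrix is unitriangular, so
   the determinant does not change. *)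
pose U : 'M[R]_n.+1 := \matrix_(i, l) ((l == i)%:R -
  (if (l < i)%N then t i * ratr (c i.-1 l) else 0)).
pose M : 'M[int]_n.+1 := \matrix_(i < n.+1) x (m i).
have WE : \matrix_(i < n.+1) w i = U *m map_mx intr M.
  apply/row_matrixP => i; rewrite rowK row_mul mulmx_sum_row.
  have -> : \sum_l row i U 0 l *: row l (map_mx intr M) =
      xR (m i) - \sum_(l < n.+1) (if (l < i)%N then t i * ratr (c i.-1 l) else 0)
                   *: xR (m l).
    rewrite (eq_bigr (fun l : 'I_n.+1 => (l == i)%:R *: xR (m l) -
      (if (l < i)%N then t i * ratr (c i.-1 l) else 0) *: xR (m l))); last first.
      by move=> l _; rewrite -scalerBl !mxE -map_row rowK.
    rewrite sumrB (bigD1 i) //= eqxx scale1r big1 ?addr0 // => l /negPf->.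
    by rewrite scale0r.
  case: i => [[|k] kn] /=.
    by rewrite big1 ?subr0 // => l _; rewrite scale0r.
  rewrite (xcE k kn) scaler_sumr; congr (_ - _).
  rewrite (big_ord_widen n.+1 (fun l => t k.+1 *: (ratr (c k l) *: xR (m l)))).
    rewrite big_mkcond; apply: eq_bigr => l _; rewrite scalerA.
    by case: ifP => // _; rewrite scale0r.
  exact: ltnW.
have detU : \det U = 1.
  rewrite det_trig.
    by rewrite big1 // => i _; rewrite mxE eqxx ltnn subr0.
  apply/is_trig_mxP => i l il; rewrite mxE ltnNge (ltnW il) /=.
  by rewrite -val_eqE /= gtn_eqF // subr0.
have w0 : l1 (w 0%N) <= K * expR (y (m 0%N)).
  have L1 : L (m 0%N) <= 1.
    have := Lk2 (m 0%N); rewrite m0 => /(_ _)/le_trans; apply.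
      by rewrite /i0; lia.
    have : expR (- (alpha * y i0.+1)) <= 1.
      by rewrite -expR0 ler_expR oppr_le0 mulr_ge0 // ltW.
    by nra.
  rewrite /w -[xR _](subrK (expR (y (m 0%N)) *: v)).
  apply: le_trans (l1D _ _) _; rewrite -LE l1Z gtr0_norm ?expR_gt0 //.
  have : 1 <= expR (y (m 0%N)) by rewrite -expR0 ler_expR.
  by have := l1_ge0 v; rewrite /K; nra.
(* As [t k.+1] is the quotient of the two heights, the multiples of v cancel; what remains is at
   most L_m + t L_(m-1) <= 2 t L_(m-1). *)
have wS k : l1 (w k.+1) <=
    2 * eps * expR ((1 - alpha) * y (m k.+1) - y (m k.+1).-1).
  rewrite /w; set j := (m k.+1).-1.
  have mj : m k.+1 = j.+1 by rewrite /j prednK // (leq_ltn_trans (leq0n _) (mS k)).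
  have -> : xR (m k.+1) - t k.+1 *: xR j =
      (xR (m k.+1) - expR (y (m k.+1)) *: v) - t k.+1 *: (xR j - expR (y j) *: v).
    rewrite scalerBr scalerA -expRD -/j subrK.
    by rewrite opprB addrA subrK.
  apply: le_trans (l1B _ _) _; rewrite l1Z -!LE gtr0_norm ?expR_gt0 //.
  have Lj := Lk2 j (mk1 k).2; have := Lmono j; rewrite -mj => Lj'.
  have t1 : 1 <= t k.+1.
    by rewrite -expR0 ler_expR subr_ge0 -/j mj.
  apply: (@le_trans _ _ (2 * (t k.+1 * L j))).
    by have := L0 j; nra.
  rewrite -mulrA ler_pM2l //; rewrite -mj in Lj.
  apply: (@le_trans _ _ (t k.+1 * (eps * expR (- (alpha * y (m k.+1)))))).
    by rewrite ler_pM2l // expR_gt0.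
  rewrite mulrCA -expRD -/j ler_pM2l // ler_expR.
  by lra.
have prodw k : (k <= n)%N -> \prod_(i < k.+1) l1 (w i) <=
    K * (2 * eps) ^+ k * expR (e k * y (m k)).
  elim: k => [_|k IH kn].
    by rewrite big_ord1 expr0 mulr1 /e big_ord0 subr0 mul1r.
  rewrite big_ord_recr /=.
  apply: le_trans (ler_pM _ _ (IH (ltnW kn)) (wS k)) _.
  - by rewrite prodr_ge0 // => i _; apply: l1_ge0.
  - exact: l1_ge0.
  set j := (m k.+1).-1.
  have mj : m k.+1 = j.+1 by rewrite /j prednK // (leq_ltn_trans (leq0n _) (mS k)).
  rewrite exprS.
  have -> : K * (2 * eps) ^+ k * expR (e k * y (m k)) *
      (2 * eps * expR ((1 - alpha) * y (m k.+1) - y j)) =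
      K * ((2 * eps) * (2 * eps) ^+ k) *
      expR (e k * y (m k) + ((1 - alpha) * y (m k.+1) - y j)).
    by rewrite [X in _ = _ * X]expRD; ring.
  rewrite ler_pM2l; last by rewrite !mulr_gt0 ?exprn_gt0 //; lra.
  (* Since 0 <= e_k <= 1: e_k y_(m_k) - y_j <= (e_k - 1) y_j <= (e_k - 1) alpha y_(m_(k+1)). *)
  rewrite ler_expR.
  have yj : y (m k) <= y j by apply: yle; rewrite -ltnS -mj; apply: mS.
  have yj' : alpha * y (m k.+1) <= y j by rewrite mj; apply: yk1; exact: (mk1 k).1.
  rewrite eS; have := e_ge0 k (ltnW kn); have := e_le1 k.
  by nra.
have := int_det_ge1 R (M := M); rewrite leNgt => /(_ _)/negP; apply.
  suff -> : map_mx intr M = \matrix_(i < n.+1) map_mx intr (x (m i)) :> 'M[rat]_n.+1.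
    exact: Munit.
  by apply/row_matrixP => i; rewrite -map_row !rowK.
have -> : \det (map_mx intr M) = \det (\matrix_(i < n.+1) w i).
  by rewrite WE det_mulmx detU mul1r.
apply: le_lt_trans (det_le_l1 _) _.
under eq_bigr do rewrite rowK.
apply: (@le_lt_trans _ _ (n.+1`!%:R * (K * (2 * eps) ^+ n * expR (e n * y (m n))))).
  by rewrite ler_pM2l ?prodw // ltr0n fact_gt0.
rewrite en mul0r expR0 mulr1 mulrA -/F.
have : (2 * eps) ^+ n <= 2 * eps.
  rewrite -(prednK n0) exprS -[leRHS]mulr1 ler_wpM2l //; first lra.
  by apply: exprn_ile1 => //; lra.
by nra.
Qed.

(** * Best approximations to an isotropic vector *)

Lemma int_vec_lt1 (R : realType) n (z : 'rV[int]_n.+1) :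
  l1 (int_vec R z) < 1 -> z = 0.
Proof.
move=> z1; apply/rowP => i; apply/eqP; rewrite mxE.
have := le_lt_trans (coord_le_l1 (int_vec R z) i) z1.
rewrite mxE -intr_norm -[1]/(1%:~R) ltr_int.
by rewrite -normr_eq0; have := normr_ge0 (z 0 i); lia.
Qed.

Section NearZero.
Context (R : realType) (n : nat) (S : 'M[int]_n.+1) (v : 'rV[R]_n.+1).
Hypothesis symS : S^T = S.
Hypothesis v_iso : bform (map_mx intr S) v v = 0.

Let SR : 'M[R]_n.+1 := map_mx intr S.

Let symSR : SR^T = SR. Proof. by rewrite /SR map_trmx symS. Qed.

Let bformR x y : (bform S x y)%:~R = bform SR (int_vec R x) (int_vec R y).
Proof. by rewrite map_bform. Qed.

(** For x = h v + d the term in h^2 vanishes because v is isotropic, which leaves 2 h b(v, d) + b(d,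
    d). *)
Lemma near_zero_bound : exists2 C : R, 0 < C &
  forall (x : 'rV[int]_n.+1) (h : R), 1 <= h ->
    l1 (int_vec R x - h *: v) <= 1 ->
    `|bform S x x|%:~R <= C * (h * l1 (int_vec R x - h *: v)).
Proof.
have [C C0 bC] := bform_bound SR.
exists (1 + C * (2 * l1 v + 1)) => [|x h h1].
  by rewrite ltr_wpDr // mulr_ge0 // addr_ge0 // mulr_ge0 // l1_ge0.
set d := int_vec R x - _ => d1.
have xE : int_vec R x = h *: v + d by rewrite addrC subrK.
clearbody d; rewrite intr_norm bformR xE !bformL v_iso (bformC d v symSR).
have := bC v d; have := bC d d; have := l1_ge0 v; have := l1_ge0 d.
rewrite !ler_norml; move: (bform SR v d) (bform SR d d) (l1 v) (l1 d) d1.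
move=> a b V D D1 D0 V0 /andP[b1 b2] /andP[a1 a2].
have h0 : 0 < h by lra.
have CD : C * D * D <= C * (h * D).
  by rewrite -mulrA ler_wpM2l // ler_wpM2r //; lra.
have a1' : - (h * (C * V * D)) <= h * a by rewrite -mulrN ler_pM2l.
have a2' : h * a <= h * (C * V * D) by rewrite ler_pM2l.
have hD : 0 <= h * D by rewrite mulr_ge0 // ltW.
by apply/andP; split; lra.
Qed.

(* The vector [b(x,x) y - 2 b(x,y) x] is fixed up to sign when [x] is; near
   the real zero [v] its size is controlled by the error of [x] only. *)
Lemma isotropic_pair_small : exists2 C : R, 0 < C &
  forall (x y : 'rV[int]_n.+1) (h k : R), 1 <= h -> h <= k ->
    l1 (int_vec R y - k *: v) <= l1 (int_vec R x - h *: v) ->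
    l1 (int_vec R x - h *: v) <= 1 ->
    bform S y y = 0 ->
    C * (k * l1 (int_vec R x - h *: v) ^+ 2) < 1 ->
  bform S x x *: y = (2 * bform S x y) *: x.
Proof.
have [C C0 bC] := bform_bound SR.
pose B := C * (l1 v + 1); have B0 : 0 <= B by rewrite mulr_ge0 // addr_ge0 // l1_ge0.
exists (1 + B * (4 * l1 v + 9)) => [|x y h k h1 hk].
  by rewrite ltr_wpDr // mulr_ge0 // addr_ge0 // mulr_ge0 // l1_ge0.
set d := int_vec R x - _; set f := int_vec R y - _ => fd d1 yy small.
have xE : int_vec R x = h *: v + d by rewrite addrC subrK.
have yE : int_vec R y = k *: v + f by rewrite addrC subrK.
clearbody d f.
apply/eqP; rewrite -subr_eq0; apply/eqP/(@int_vec_lt1 R).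
pose P := bform SR v d; pose Q := bform SR v f.
pose dd := bform SR d d; pose df := bform SR d f; pose ff := bform SR f f.
have xxE : (bform S x x)%:~R = 2 * h * P + dd.
  by rewrite bformR xE !bformL v_iso (bformC d v symSR) -/P -/dd; ring.
have xyE : (bform S x y)%:~R = h * Q + k * P + df.
  rewrite bformR xE yE !bformL v_iso (bformC d v symSR) -/P -/Q -/df; ring.
have yyE : 2 * k * Q + ff = 0.
  have /(congr1 (intr : int -> R)) := yy.
  by rewrite bformR yE !bformL v_iso (bformC f v symSR) -/Q -/ff mulr0z => <-; ring.
(* Coefficient of v in the vector: the terms h k P cancel, and b(y, y) = 0 gives Q = - ff / (2 k),
   so that only quadratic expressions in the errors remain. *)
pose r := k * dd + h * (ff / k) * h - 2 * h * df.
have k0 : 0 < k by lra.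
have kn0 : k != 0 by rewrite lt0r_neq0.
have QE : Q = - (ff / k) / 2.
  have -> : ff = - (2 * k * Q) by lra.
  by field.
have -> : int_vec R (bform S x x *: y - (2 * bform S x y) *: x) =
    r *: v + ((2 * h * P + dd) *: f - (2 * (h * Q + k * P + df)) *: d).
  rewrite /int_vec map_mxB !map_mxZ /= rmorphM /= xxE xyE.
  rewrite -/(int_vec R x) -/(int_vec R y) xE yE.
  by apply/rowP => i; rewrite !mxE /r QE; field.
have V0 := l1_ge0 v; have D0 := l1_ge0 d; have F0 := l1_ge0 f.
move: fd d1 small; set D := l1 d; set F := l1 f; set V := l1 v => FD D1 small.
have C0V : C <= B by rewrite /B; nra.
have E0 : 0 <= k * D ^+ 2 by rewrite mulr_ge0 ?sqr_ge0 // ltW.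
have kD : 0 <= k * D by rewrite mulr_ge0 // ltW.
have bnd (a c1 c2 : R) : `|a| <= C * c1 * c2 -> 0 <= c1 -> 0 <= c2 ->
    c1 <= D -> c2 <= D -> `|a| <= B * D ^+ 2.
  move=> /le_trans ac c10 c20 c1D c2D; apply: ac.
  by rewrite expr2 -mulrA ler_pM // ?mulr_ge0 // ler_pM.
have rv : `|r| <= 4 * (B * (k * D ^+ 2)).
  have u01 : 0 <= h / k <= 1.
    by rewrite divr_ge0 ?ler_pdivrMr ?mul1r //; lra.
  have -> : r = k * dd + (h / k) * (h * ff) - 2 * (h * df).
    by rewrite /r; field.
  have b1 : `|dd| <= B * D ^+ 2 by apply: bnd (bC d d) _ _ _ _.
  have b2 : `|ff| <= B * D ^+ 2 by apply: bnd (bC f f) _ _ _ _.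
  have b3 : `|df| <= B * D ^+ 2 by apply: bnd (bC d f) _ _ _ _.
  have hB (a : R) : `|a| <= B * D ^+ 2 -> `|h * a| <= B * (k * D ^+ 2).
    move=> aB; rewrite normrM gtr0_norm; last lra.
    by rewrite [leRHS]mulrCA ler_pM //; lra.
  have b1' : `|k * dd| <= B * (k * D ^+ 2).
    by rewrite normrM gtr0_norm // mulrCA ler_pM2l.
  have b2' : `|(h / k) * (h * ff)| <= B * (k * D ^+ 2).
    have [/andP[u0 u1]] := u01; rewrite normrM ger0_norm //.
    by rewrite -[leRHS]mul1r ler_pM // hB.
  have b3' : `|2 * (h * df)| <= 2 * (B * (k * D ^+ 2)).
    by rewrite normrM gtr0_norm // ler_pM2l // hB.
  apply: le_trans (ler_normB _ _) _.
  by have := ler_normD (k * dd) ((h / k) * (h * ff)); lra.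
have PB : `|P| <= C * V * D by exact: bC.
have QB : `|Q| <= C * V * D.
  by apply: le_trans (bC v f) _; rewrite ler_wpM2l // mulr_ge0.
have dB : `|dd| <= C * (k * D).
  by apply: le_trans (bC d d) _; rewrite -mulrA -/D -/F ler_wpM2l // ler_pM //; lra.
have fB : `|df| <= C * (k * D).
  by apply: le_trans (bC d f) _; rewrite -mulrA -/D -/F ler_wpM2l // ler_pM //; lra.
have xxB : `|2 * h * P + dd| <= 2 * B * (k * D).
  apply: le_trans (ler_normD _ _) _; rewrite normrM gtr0_norm; last lra.
  have : 2 * h * `|P| <= 2 * k * (C * V * D) by rewrite ler_pM //; lra.
  by rewrite /B -/V; have := mulr_ge0 C0 kD; lra.
have xyB : `|2 * (h * Q + k * P + df)| <= 4 * B * (k * D).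
  rewrite normrM gtr0_norm //.
  have n1 := ler_normD (h * Q + k * P) df; have n2 := ler_normD (h * Q) (k * P).
  have : `|h * Q| <= k * (C * V * D).
    by rewrite normrM gtr0_norm; [rewrite ler_pM //; lra|lra].
  have : `|k * P| <= k * (C * V * D) by rewrite normrM gtr0_norm // ler_pM2l.
  by rewrite /B -/V; have := mulr_ge0 C0 kD; lra.
apply: le_lt_trans small; apply: le_trans (l1D _ _) _.
apply: le_trans (lerD (lexx _) (l1B _ _)) _; rewrite !l1Z -/V -/D -/F.
have t1 : `|r| * V <= 4 * (B * (k * D ^+ 2)) * V by rewrite ler_wpM2r.
have t2 : `|2 * h * P + dd| * F <= 2 * B * (k * D) * D by rewrite ler_pM.
have t3 : `|2 * (h * Q + k * P + df)| * D <= 4 * B * (k * D) * D.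
  by rewrite ler_wpM2r.
have t4 := mulr_ge0 B0 E0.
by lra.
Qed.
End NearZero.

(** H (k + 1) is the first index where f drops below f (H k); it exists because the infimum 0 of f
    is not attained. *)
Lemma record_sequence (R : realType) (f : nat -> R) :
    (forall k, 0 < f k) -> (forall e, 0 < e -> exists k, f k < e) ->
  exists H : nat -> nat, [/\ forall k, (H k < H k.+1)%N,
    forall k, f (H k.+1) < f (H k) &
    forall k j, (j < H k.+1)%N -> f (H k) <= f j].
Proof.
move=> f0 finf; have ex a : exists k, f k < f a by apply: finf.
pose H := fix H k := if k is k'.+1 then ex_minn (ex (H k')) else 0%N.
have HS k : f (H k.+1) < f (H k) by rewrite /=; case: ex_minnP.
have Hmin k j : (j < H k.+1)%N -> f (H k) <= f j.
  rewrite /=; case: ex_minnP => i _ imin ji.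
  by rewrite leNgt; apply/negP => /imin; rewrite leqNgt ji.
exists H; split=> // k; rewrite ltnNge; apply/negP => le_H.
case: k le_H (HS k) => [|k] le_H; first by move: le_H; rewrite leqn0 => /eqP->; rewrite ltxx.
have := HS k.+1; move: le_H; rewrite leq_eqVlt => /orP[/eqP->|lt_H].
  by rewrite ltxx.
by move=> h1 h2; have := Hmin k _ lt_H; have := HS k; lra.
Qed.

Definition nearest (R : realType) (r : R) : int := Num.floor (r + 2^-1).

Lemma nearestP (R : realType) (r : R) (z : int) :
  `|(nearest r)%:~R - r| <= `|z%:~R - r|.
Proof.
rewrite /nearest; set k := Num.floor _.
have /andP[k1 k2] : k%:~R <= r + 2^-1 < (k + 1)%:~R by apply: floor_itv.
have kd : `|k%:~R - r| <= 2^-1.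
  by rewrite ler_norml; move: k2; rewrite intrD; lra.
have [->//|zk] := eqVneq z k; apply: (le_trans kd).
have : (z <= k - 1) || (k + 1 <= z) by lia.
move=> /orP[]; rewrite -(ler_int R) ?intrD ?intrB => h.
  by rewrite -normrN ger0_norm; lra.
rewrite intrD in k2; by rewrite ger0_norm; lra.
Qed.

Section BestApproximations.
Context (R : realType) (n : nat) (v : 'rV[R]_n.+1).
Hypotheses (v0 : v 0 0 = 1) (vQ : Q_independent v).

(** Rounding every coordinate minimises the [l1] distance to h v. Since v_0 = 1, the first
    coordinate is h itself, and heights are first coordinates. *)
Definition best (h : nat) : 'rV[int]_n.+1 := \row_i nearest (h%:R * v 0 i).

Definition best_err (h : nat) : R := l1 (int_vec R (best h) - h%:R *: v).

Lemma best0 h : best h 0 0 = h%:Z.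
Proof.
rewrite mxE v0 mulr1; apply/eqP; rewrite -(eqr_int R) -subr_eq0 -normr_le0.
by apply: le_trans (nearestP _ h%:Z) _; rewrite pmulrn subrr normr0.
Qed.

Lemma best_err_min h (x : 'rV[int]_n.+1) :
  best_err h <= l1 (int_vec R x - h%:R *: v).
Proof. by apply: ler_sum => i _; rewrite !mxE nearestP. Qed.

Lemma dot_neq0 (a : 'cV[rat]_n.+1) : a != 0 -> \sum_i ratr (a i 0) * v 0 i != 0.
Proof.
apply: contra_neq => av; rewrite -[a]trmxK (vQ (a := a^T)) ?trmx0 //.
by rewrite -[RHS]av; apply: eq_bigr => i _; rewrite mxE.
Qed.

(** A zero error would make h v_1 an integer, hence a rational relation between v_0 = 1 and v_1. *)
Lemma best_err_gt0 h : (0 < n)%N -> (0 < h)%N -> 0 < best_err h.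
Proof.
move=> n0 h0; rewrite lt_def l1_ge0 andbT; apply/eqP => e0.
pose i1 : 'I_n.+1 := Ordinal (n0 : (1 < n.+1)%N).
pose a : 'cV[rat]_n.+1 :=
  \col_i (if i == i1 then h%:R else if i == 0 then - (best h 0 i1)%:~R else 0).
have /dot_neq0/eqP : a != 0.
  apply/eqP => /colP/(_ i1)/eqP; rewrite !mxE eqxx pnatr_eq0.
  by rewrite gtn_eqF.
apply; rewrite (bigD1 i1) //= (bigD1 0) //= big1 => [|i /andP[i0 i1']].
  rewrite !mxE eqxx /= v0 rmorphN /= ratr_int ratr_nat mulr1 addr0.
  have : `|(int_vec R (best h) - h%:R *: v) 0 i1| <= 0 by rewrite -e0 coord_le_l1.
  by rewrite normr_le0 !mxE => /eqP; lra.
by rewrite mxE (negPf i0) (negPf i1') rmorph0 mul0r.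
Qed.

End BestApproximations.

(** The lower bound in terms of [l1] and first coordinates. The condition alpha >= 1 / 2 gives
    h_(k+1) L_k^2 <= eps^2 h_(k+1)^(1 - 2 alpha) <= eps^2, the smallness that [isotropic_pair_small]
    asks for. *)
Lemma uniform_exponent_bound (R : realType) n (S : 'M[int]_n.+1)
    (v : 'rV[R]_n.+1) (alpha : R) :
    (0 < n)%N -> 1 / 2 <= alpha <= 1 -> \sum_(l < n) alpha ^+ l.+1 = 1 ->
    S != 0 -> S^T = S ->
    (forall u w : 'rV[rat]_n.+1, bform (map_mx intr S) u u = 0 ->
       bform (map_mx intr S) w w = 0 -> bform (map_mx intr S) u w = 0 ->
       exists s t : rat, (s != 0) || (t != 0) /\
         forall z, bform (map_mx intr S) (s *: u + t *: w) z = 0) ->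
    v 0 0 = 1 -> Q_independent v -> bform (map_mx intr S) v v = 0 ->
    (forall eps, 0 < eps -> exists2 X0, 1 <= X0 & forall X, X0 <= X ->
       exists x : 'rV[int]_n.+1, [/\ x != 0, `|x 0 0|%:~R <= X &
         l1 (int_vec R x - (x 0 0)%:~R *: v) <= eps * expR (- (alpha * ln X))]) ->
  False.
Proof.
move=> n0 /andP[a_half a1] suma S0 symS witt v0 vQ v_iso small.
have a0 : 0 < alpha by lra.
(* The shift excludes height 0, where the error is 0. *)
pose f k := best_err v k.+1.
have f0 k : 0 < f k by exact: best_err_gt0.
have small' eps : 0 < eps -> eps < 1 -> exists2 X0, 1 <= X0 & forall X, X0 <= X ->
    exists2 h : nat, (0 < h)%N /\ h%:R <= X &
      best_err v h <= eps * expR (- (alpha * ln X)).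
  move=> e0 e1; have [X0 X01 HX] := small eps e0; exists X0 => // X XX0.
  have [x [xn0 xX xe]] := HX X XX0.
  have le1 : expR (- (alpha * ln X)) <= 1.
    rewrite -expR0 ler_expR oppr_le0 mulr_ge0 ?(ltW a0) // ln_ge0 //.
    exact: le_trans XX0.
  have x00 : x 0 0 != 0.
    apply: contra_neq xn0 => x00; apply: (@int_vec_lt1 R).
    by move: xe; rewrite x00 scale0r subr0; nra.
  exists (absz (x 0 0)).
    by rewrite absz_gt0 x00 natr_absz.
  apply: le_trans xe.
  have [x0|x0] := leP 0 (x 0 0).
    by have := best_err_min v (absz (x 0 0)) x; rewrite natr_absz ger0_norm.
  have := best_err_min v (absz (x 0 0)) (- x); rewrite natr_absz ltr0_norm //.
  by rewrite /int_vec map_mxN rmorphN /= scaleNr -opprD l1N.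
have finf e : 0 < e -> exists k, f k < e.
  move=> e0; pose e' := Num.min (e / 2) (1 / 2).
  have e'0 : 0 < e' by rewrite lt_min; apply/andP; split; lra.
  have e'1 : e' <= 1 / 2 by rewrite ge_min lexx orbT.
  have e'e : e' <= e / 2 by rewrite ge_min lexx.
  have [|X0 X01 /(_ X0 (lexx _))[h [h0 _]]] := small' e' e'0; first lra.
  have : expR (- (alpha * ln X0)) <= 1.
    by rewrite -expR0 ler_expR oppr_le0 mulr_ge0 ?(ltW a0) // ln_ge0.
  by move=> l1; exists h.-1; rewrite /f prednK //; nra.
have [H [Hmono Hdec Hmin]] := record_sequence f0 finf.
pose h k : R := (H k).+1%:R; pose y k := ln (h k).
pose x k := best v (H k).+1; pose L k := f (H k).
have h_gt0 k : 0 < h k by rewrite ltr0n.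
have hE k : expR (y k) = h k by rewrite /y lnK // posrE.
have x0E k : x k 0 0 = (H k).+1%:Z by rewrite /x best0.
have h_ge k : k.+1%:R <= h k.
  rewrite ler_nat ltnS; elim: k => // k IH; exact: leq_ltn_trans IH (Hmono k).
have hS k : h k < h k.+1 by rewrite ltr_nat ltnS Hmono.
have y0 k : 0 <= y k <= y k.+1.
  rewrite ln_ge0 ?ler_ln ?posrE ?(ltW (hS k)) ?h_gt0 //.
  by apply: le_trans (h_ge k); rewrite ler1n.
have L0 k : 0 < L k by exact: f0.
have LE k : L k = l1 (int_vec R (x k) - h k *: v) by [].
have LS k : L k.+1 < L k by exact: Hdec.
have Lanti : {homo L : i j / (i <= j)%N >-> j <= i}.
  by apply/nonincreasing_seqP => k; apply: ltW.
have large (B : R) : exists k0, forall k, (k0 <= k)%N -> B <= h k.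
  exists (Num.bound `|B|) => k kB; apply: le_trans (h_ge k).
  apply: le_trans (ler_norm B) _; apply: le_trans (ltW (archi_boundP _)) _ => //.
  by rewrite ler_nat ltnW // ltnS.
(* If a vanished on x_k, then h_k |c| <= A L_k <= A L_0, which fails for large h_k. *)
have span (a : 'cV[rat]_n.+1) : a != 0 ->
    exists k0, forall k, (k0 <= k)%N -> map_mx intr (x k) *m a != 0.
  move=> an0; set c := \sum_i ratr (a i 0) * v 0 i.
  have c0 : 0 < `|c| by rewrite normr_gt0 dot_neq0.
  pose A := \sum_i `|ratr (a i 0) : R|.
  have [k0 k0P] := large ((A * L 0%N + 1) / `|c|).
  exists k0 => k /k0P; rewrite ler_pdivrMr // => hk; apply/eqP => xa.
  have /(congr1 (fun M : 'M[rat]_1 => ratr (M 0 0) : R)) := xa.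
  rewrite !mxE rmorph_sum rmorph0 /= => xa0.
  have : h k * c = - \sum_i ratr (a i 0) * (int_vec R (x k) - h k *: v) 0 i.
    rewrite -[LHS]subr0 -[X in _ - X]xa0 mulr_sumr -sumrB -sumrN.
    by apply: eq_bigr => i _; rewrite !mxE rmorphM /= ratr_int; ring.
  move=> /(congr1 Num.norm); rewrite normrN normrM gtr0_norm // => hc.
  have := sum_mul_le_l1 (fun i => ratr (a i 0)) (int_vec R (x k) - h k *: v).
  rewrite -hc -/A -LE => le1.
  have : A * L k <= A * L 0%N by rewrite ler_wpM2l ?Lanti // sumr_ge0.
  by lra.
have Lsmall eps : 0 < eps -> exists k0, forall k, (k0 <= k)%N ->
    L k <= eps * expR (- (alpha * y k.+1)).
  (* The hypothesis is applied at X = h_(k+1) / 2, strictly below the next record. This costs a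
     factor 2^alpha <= 2, absorbed by eps / 2; the bound 1 / 2 is there because [small'] wants a
     constant below 1. *)
  move=> e0; pose e' := Num.min (eps / 2) (1 / 2).
  have e'0 : 0 < e' by rewrite lt_min; apply/andP; split; lra.
  have e'1 : e' <= 1 / 2 by rewrite ge_min lexx orbT.
  have e'e : e' <= eps / 2 by rewrite ge_min lexx.
  have [|X0 X01 HX] := small' e' e'0; first lra.
  have [k0 k0P] := large (2 * X0); exists k0 => k kk0.
  have X0h : X0 <= h k.+1 / 2.
    by have := k0P k kk0; have := hS k; lra.
  have [j [j0 jh] jerr] := HX _ X0h.
  have jH : (j.-1 < H k.+1)%N.
    rewrite -ltnS prednK // -(ltr_nat R); apply: le_lt_trans jh _.
    by have := h_gt0 k.+1; rewrite -/(h k.+1); lra.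
  apply: le_trans (Hmin _ _ jH) _; rewrite /f prednK //.
  apply: le_trans jerr _; rewrite ln_div ?posrE // -/(y k.+1).
  have -> : - (alpha * (y k.+1 - ln 2)) = alpha * ln 2 + - (alpha * y k.+1) by ring.
  rewrite expRD mulrA ler_wpM2r ?expR_ge0 //.
  have : expR (alpha * ln 2) <= 2.
    rewrite -[leRHS](lnK (x := 2)) ?posrE // ler_expR.
    by rewrite ger_pMl // ln_gt0 // ltr1n.
  by have := expR_gt0 (alpha * ln 2); nra.
(* Heights increase and errors decrease along the records: for a nonzero a the heights give |a| <
   |b|, whereas |a| L_(k+1) = |b| L_k would then fail. *)
have indep k a b : a *: x k.+1 = b *: x k -> a = 0 /\ b = 0.
  move=> abE.
  have abh : a%:~R * h k.+1 = b%:~R * h k.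
    have /(congr1 (fun M : 'rV[int]_n.+1 => M 0 0)) := abE.
    rewrite [LHS]mxE [RHS]mxE !x0E => /(congr1 (intr : int -> R)).
    by rewrite !rmorphM.
  have abL : `|a%:~R| * L k.+1 = `|b%:~R| * L k.
    rewrite !LE -!l1Z !scalerBr !scalerA abh.
    congr (l1 (_ - _)); have := congr1 (fun z => int_vec R z) abE.
    by rewrite /int_vec !map_mxZ.
  have a00 : a%:~R = 0 :> R.
    apply/eqP; apply: contraT => an0.
    have A0 : 0 < `|a%:~R : R| by rewrite normr_gt0.
    have /(congr1 Num.norm) := abh; rewrite !normrM !(gtr0_norm (h_gt0 _)) => abh'.
    have AB : `|a%:~R : R| < `|b%:~R|.
      by rewrite -(ltr_pM2r (h_gt0 k)) -abh' ltr_pM2l.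
    have : `|a%:~R| * L k.+1 < `|b%:~R| * L k by rewrite ltr_pM // ltW.
    by rewrite abL ltxx.
  split; first by apply/eqP; rewrite -(intr_eq0 R) a00.
  move: abh; rewrite a00 mul0r => /esym/eqP; rewrite mulf_eq0.
  by rewrite (gt_eqF (h_gt0 k)) orbF intr_eq0 => /eqP.
have [C C0 bC] := isotropic_pair_small symS v_iso.
have [C' C'0 bC'] := near_zero_bound symS v_iso.
have [k1 k1P] : exists k1, forall k, (k1 <= k)%N ->
    L k <= 1 /\ C * (h k.+1 * L k ^+ 2) < 1.
  pose e := (1 + C)^-1; have e0 : 0 < e by rewrite invr_gt0; lra.
  have eC : e * (1 + C) = 1 by rewrite mulVf //; lra.
  have [k1 k1P] := Lsmall e e0; exists k1 => k /k1P Lk.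
  have y1 := andP (y0 k.+1); have yk : 0 <= y k.+1 by case: y1.
  pose E := expR (- (alpha * y k.+1)); have E0 : 0 < E by apply: expR_gt0.
  have E1 : E <= 1.
    by rewrite -expR0 ler_expR oppr_le0 mulr_ge0 // ltW.
  have hE2 : h k.+1 * E ^+ 2 <= 1.
    rewrite -hE -expRM_natl -expRD -[leRHS]expR0 ler_expR.
    by nra.
  split; first by rewrite -/E in Lk; nra.
  have L2 : L k ^+ 2 <= e ^+ 2 * E ^+ 2.
    by rewrite -exprMn ler_pXn2r // nnegrE ?mulr_ge0 // ltW.
  have : h k.+1 * L k ^+ 2 <= e ^+ 2.
    apply: (@le_trans _ _ (h k.+1 * (e ^+ 2 * E ^+ 2))); first by rewrite ler_pM2l.
    by rewrite mulrCA ler_piMr // sqr_ge0.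
  by nra.
have zero_step k : (k1 <= k)%N -> bform S (x k.+1) (x k.+1) = 0 ->
    bform S (x k) (x k) = 0 /\ bform S (x k) (x k.+1) = 0.
  move=> /k1P[L1 CL] z.
  have h1 : 1 <= h k by apply: le_trans (h_ge k); rewrite ler1n.
  have := bC (x k) (x k.+1) (h k) (h k.+1) h1 (ltW (hS k)).
  rewrite -!LE => /(_ (ltW (LS k)) L1 z CL) /indep[-> /eqP].
  by rewrite mulf_eq0 => /eqP.
have [[k2 nz]|inf] := pselect (exists k2, forall k, (k2 <= k)%N ->
    bform S (x k) (x k) != 0).
  apply: (@determinant_bound R n v alpha x L y) => //.
  - by rewrite a0.
  - by move=> k; rewrite hE.
  - by move=> k; apply: ltW.
  (* With the constant 1 / C', the inequality 1 <= C' h_k L_k becomes h_(k+1)^alpha <= h_k. *)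
  have [k3 k3P] := Lsmall (C'^-1) (ltac:(by rewrite invr_gt0)).
  exists (maxn k1 (maxn k2 k3)) => k; rewrite !geq_max => /and3P[kk1 kk2 kk3].
  have h1 : 1 <= h k by apply: le_trans (h_ge k); rewrite ler1n.
  have := bC' (x k) (h k) h1; rewrite -LE => /(_ (k1P k kk1).1) b1.
  have : 1 <= `|bform S (x k) (x k)|%:~R :> R.
    by rewrite -[1]/(1%:~R) ler_int -gtz0_ge1 normr_gt0 nz.
  move=> /le_trans /(_ b1) b2; have b3 := k3P k kk3.
  have : 1 <= h k * expR (- (alpha * y k.+1)).
    apply: (le_trans b2); rewrite mulrCA ler_pM2l //.
    by rewrite mulrC -ler_pdivlMr // mulrC.
  by rewrite -hE -expRD -[leLHS]expR0 ler_expR subr_ge0.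
(* Isotropy passes from x_(k+1) down to x_k, so arbitrarily late isotropic vectors make all x_k
   isotropic from k1 on. *)
have zero k : (k1 <= k)%N -> bform S (x k) (x k) = 0 /\ bform S (x k) (x k.+1) = 0.
  have z i : (k1 <= i)%N -> bform S (x i) (x i) = 0.
    move=> ki; have [j [ij zj]] : exists j, (i <= j)%N /\ bform S (x j) (x j) = 0.
      apply: contrapT => nj; apply: inf; exists i => j ij.
      by apply/eqP => zj; apply: nj; exists j.
    elim: j ij zj => [|j IH]; first by rewrite leqn0 => /eqP<-.
    rewrite leq_eqVlt => /orP[/eqP->//|]; rewrite ltnS => ij zj.
    by apply: (IH ij); apply: (zero_step _ _ zj).1; apply: leq_trans ij.
  by move=> kk; split; [apply: z|apply: (zero_step _ kk _).2; apply/z/leqW].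
pose SQ : 'M[rat]_n.+1 := map_mx intr S.
have symSQ : SQ^T = SQ by rewrite /SQ map_trmx symS.
have SQ0 : SQ != 0 by rewrite map_intr_eq0.
pose xq k : 'rV[rat]_n.+1 := map_mx intr (x k).
(* A combination s x_k + t x_(k+1) in the kernel is a relation between the forms G_k and G_(k+1).
   All late G_k are therefore multiples of G_(k3), so b(x_k, x_(k3)) is a multiple of b(x_(k3),
   x_(k3)) = 0 and G_(k3) vanishes on every late x_k, against [span]. *)
pose G k := xq k *m SQ.
have bG k (z : 'rV[rat]_n.+1) : bform SQ (xq k) z = (G k *m z^T) 0 0 by [].
have bxq i j : bform SQ (xq i) (xq j) = (bform S (x i) (x j))%:~R.
  by rewrite map_bform.
have [k2 Gk2] : exists k2, forall k, (k2 <= k)%N -> G k != 0.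
  have [j cj] : exists j, col j SQ != 0.
    apply: contrapT => nj; move/eqP: SQ0; apply; apply/matrixP => i j.
    have /eqP/colP/(_ i) : col j SQ == 0.
      by apply: contraT => cj; case: nj; exists j.
    by rewrite !mxE.
  have [k2 k2P] := span _ cj; exists k2 => k /k2P; apply: contra_neq => Gk.
  by rewrite colE mulmxA -/(xq k) -/(G k) Gk mul0mx.
pose k3 := maxn k1 k2.
have GS k : (k3 <= k)%N -> exists c, G k.+1 = c *: G k.
  rewrite geq_max => /andP[kk1 kk2]; have [z1 z2] := zero k kk1.
  have [z3 _] := zero k.+1 (leqW kk1).
  have [||| s [t [st0 st]]] := witt (xq k) (xq k.+1).
  - by rewrite bxq z1.
  - by rewrite bxq z3.
  - by rewrite bxq z2.
  have stG : s *: G k + t *: G k.+1 = 0.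
    apply/rowP => i; have := st (delta_mx 0 i).
    rewrite /bform !mulmxDl -!scalemxAl trmx_delta -!colE => stz.
    by rewrite [RHS]mxE -[RHS]stz !mxE.
  have t0 : t != 0.
    apply: contraTneq st0 => t0; rewrite t0 eqxx orbF negbK.
    move: stG; rewrite t0 scale0r addr0 => /eqP.
    by rewrite scaler_eq0 (negPf (Gk2 k kk2)) orbF.
  exists (- (s / t)); apply: (scalerI t0).
  move/eqP: stG; rewrite addrC addr_eq0 => /eqP->.
  by rewrite scalerA -scaleNr; congr (_ *: _); field.
have Gprop k : (k3 <= k)%N -> exists c, G k = c *: G k3.
  elim: k => [|k IH]; first by rewrite leqn0 => /eqP->; exists 1; rewrite scale1r.
  rewrite leq_eqVlt => /orP[/eqP<-|]; first by exists 1; rewrite scale1r.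
  rewrite ltnS => kk; have [c cE] := IH kk; have [d ->] := GS k kk.
  by exists (d * c); rewrite cE scalerA.
have k31 : (k1 <= k3)%N by rewrite leq_maxl.
have [|k4 k4P] := span (G k3)^T.
  by apply: contra_neq (Gk2 k3 (leq_maxr _ _)) => /(congr1 trmx); rewrite trmxK trmx0.
have kk := leq_maxl k3 k4; have := k4P _ (leq_maxr k3 k4).
rewrite -/(xq _); set k := maxn k3 k4; move/eqP; apply.
have [c cE] := Gprop k kk.
have : bform SQ (xq k) (xq k3) = 0.
  rewrite bG cE -scalemxAl mxE -[X in _ * X](bG k3) bxq (zero k3 k31).1.
  by rewrite mulr0.
rewrite (bformC _ _ symSQ) bG => h0; apply/matrixP => i j.
rewrite !ord1 [RHS]mxE -{}h0.
have -> : xq k *m (G k3)^T = (G k3 *m (xq k)^T)^T by rewrite [RHS]trmx_mul trmxK.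
by rewrite mxE.
Qed.

(** * The lower bound *)

Section WedgeNorm.
Context (R : realType) (n : nat).
Implicit Types x y v : 'rV[R]_n.+1.

Lemma coord_le_wedge_norm x y i j :
  `|x 0 i * y 0 j - x 0 j * y 0 i| <= wedge_norm x y.
Proof.
wlog ij : i j / (i < j)%N.
  move=> wl; case: (ltngtP i j) => [/wl//|/wl|/val_inj->].
    by rewrite distrC.
  by rewrite subrr normr0 sqrtr_ge0.
rewrite -sqrtr_sqr ler_wsqrtr // (bigD1 i) //= (bigD1 j) //= -addrA lerDl.
rewrite addr_ge0 // ?sumr_ge0 // => *; rewrite ?sumr_ge0 // => *.
all: exact: sqr_ge0.
Qed.

(** Subtracting h v from x does not change its wedge product with v. *)
Lemma wedge_norm_le x v h :
  wedge_norm x v <= (n.+1 * n.+1)%:R * (2 * l1 v * l1 (x - h *: v)).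
Proof.
pose d := x - h *: v; pose c := 2 * l1 v * l1 d.
have V0 := l1_ge0 v; have D0 := l1_ge0 d.
have c0 : 0 <= c by rewrite !mulr_ge0.
have cij i j : (x 0 i * v 0 j - x 0 j * v 0 i) ^+ 2 <= c ^+ 2.
  rewrite -[leLHS]real_normK ?num_real //.
  rewrite ler_pXn2r ?nnegrE //.
  have -> : x 0 i * v 0 j - x 0 j * v 0 i = d 0 i * v 0 j - d 0 j * v 0 i.
    by rewrite !mxE; ring.
  apply: le_trans (ler_normB _ _) _; rewrite !normrM.
  have -> : c = l1 d * l1 v + l1 d * l1 v by rewrite /c; ring.
  by rewrite lerD // ler_pM // coord_le_l1.
rewrite -[leRHS]ger0_norm ?mulr_ge0 // -sqrtr_sqr ler_wsqrtr // -/d -/c.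
apply: (@le_trans _ _ (\sum_(i < n.+1) \sum_(j < n.+1) c ^+ 2)).
  apply: ler_sum => i _; rewrite [leRHS](bigID (fun j : 'I_n.+1 => (i < j)%N)) /=.
  rewrite -[leLHS]addr0 lerD ?sumr_ge0 // => [|*]; last exact: sqr_ge0.
  by apply: ler_sum => j _.
rewrite !sumr_const !card_ord -mulrnA -[leLHS]mulr_natl [leRHS]exprMn ler_wpM2r ?sqr_ge0 //.
by rewrite expr2 -natrM ler_nat leq_pmull // muln_gt0.
Qed.

Lemma eucl_norm_gt0 v : v != 0 -> 0 < eucl_norm v.
Proof.
move=> v0; rewrite lt_def sqrtr_ge0 andbT; apply: contra_neq v0 => e0.
apply/rowP => i; apply/eqP; rewrite mxE -normr_le0 -e0.
exact: coord_le_eucl_norm.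
Qed.

Lemma eucl_norm_le_l1 v : eucl_norm v <= n.+1%:R * l1 v.
Proof.
rewrite -[leRHS]ger0_norm ?mulr_ge0 ?l1_ge0 // -sqrtr_sqr ler_wsqrtr //.
apply: (@le_trans _ _ (\sum_(i < n.+1) l1 v ^+ 2)).
  apply: ler_sum => i _; rewrite -[leLHS]real_normK ?num_real //.
  by rewrite ler_pXn2r ?nnegrE ?l1_ge0 // coord_le_l1.
rewrite sumr_const card_ord -[leLHS]mulr_natl [leRHS]exprMn ler_wpM2r ?sqr_ge0 //.
by rewrite expr2 -natrM ler_nat leq_pmull.
Qed.

End WedgeNorm.

Section Limsup.
Context (R : realType) (f : R -> R).

Lemma limf_esup_le0_near : (limf_esup (fun X => (f X)%:E) (pinfty_nbhs R) <= 0)%E ->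
  forall eps, 0 < eps -> exists M, forall X, M < X -> f X < eps.
Proof.
move=> le0 eps e0.
have : (limf_esup (fun X => (f X)%:E) (pinfty_nbhs R) < eps%:E)%E.
  by apply: le_lt_trans le0 _; rewrite lte_fin.
move=> /ereal_inf_lt[_ [V [M [Mreal VM]] <-]] supV; exists M => X MX.
rewrite -lte_fin; apply: le_lt_trans supV.
by apply: ereal_sup_ubound; exists X => //; apply: VM.
Qed.

Lemma limf_esup_lty C M : (forall X, M < X -> f X <= C) ->
  (limf_esup (fun X => (f X)%:E) (pinfty_nbhs R) < +oo)%E.
Proof.
move=> fC; apply: (@le_lt_trans _ _ C%:E); last exact: ltry.
apply: ge_ereal_inf; exists (ereal_sup ((fun X => (f X)%:E) @` [set X | M < X])).
  by exists [set X | M < X] => //; exists M; split=> //; exact: num_real.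
by apply/ereal_supP => _ [X MX <-]; rewrite lee_fin fC.
Qed.

End Limsup.

(** Dividing the equation of rho by rho^n and reversing the sum turns it into the condition on 1 /
    rho. *)
Lemma root_sum_inv (R : realType) n (rho : R) : (2 <= n)%N -> 0 < rho ->
    root ('X^n - \sum_(i < n) 'X^i) rho ->
  [/\ 1 < rho, rho < 2, rho ^+ n = \sum_(i < n) rho ^+ i &
      \sum_(l < n) (1 / rho) ^+ l.+1 = 1].
Proof.
move=> n2 r0 rr.
have [r /andP[r1 r2] rP] := rho_exists_unique R n2.
have rhoE : rho = r by apply/rP.
have rn : rho ^+ n = \sum_(i < n) rho ^+ i.
  move/rootP: rr; rewrite !hornerE horner_sum => /eqP; rewrite subr_eq0 => /eqP->.
  by apply: eq_bigr => i _; rewrite hornerXn.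
split=> //; [by rewrite rhoE|by rewrite rhoE|].
have rn0 : rho ^+ n != 0 by rewrite expf_neq0 // lt0r_neq0.
apply: (mulfI rn0); rewrite mulr1 mulr_sumr [RHS]rn (reindex_inj rev_ord_inj) /=.
apply: eq_bigr => i _; rewrite div1r exprVn.
have -> : rho ^+ n = rho ^+ i * rho ^+ (n - i) by rewrite -exprD subnKC // ltnW.
by rewrite subnSK // mulfK // expf_neq0 // lt0r_neq0.
Qed.

Section LowerBound.
Context (R : realType) (n : nat) (q : mpoly n.+1 rat) (m : nat) (rho : R).
Hypotheses (n_ge2 : (2 <= n)%N) (q_form : is_quadratic_form q).
Hypotheses (q_witt : has_Witt_index q m) (m_le1 : (m <= 1)%N).
Hypotheses (rho_gt0 : 0 < rho) (rho_root : root ('X^n - \sum_(i < n) 'X^i) rho).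

Lemma limsup_gt0 (xi : proj_space R n) :
    li_part (zero_set (map_mpoly ratr q)) xi ->
  (0 < limf_esup (fun X : R => (X `^ (1 / rho) * Dmin xi X)%:E) (pinfty_nbhs R))%E.
Proof.
move=> [xiZ xili]; rewrite ltNge; apply/negP => /limf_esup_le0_near small.
have [r1 r2 _ rsum] := root_sum_inv n_ge2 rho_gt0 rho_root.
have [c [S [c0 S0 symS qE qRE]]] := quadratic_form_bform R q_form.
pose p := vpick (val xi); have prep := represents_vpick xi.
have pQ := xili p prep; have p0 : p 0 0 != 0.
  apply/eqP => p00; pose e : 'rV[rat]_n.+1 := delta_mx 0 0.
  have /pQ /rowP/(_ 0)/eqP : \sum_i ratr (e 0 i) * p 0 i = 0.
    rewrite (bigD1 0) //= p00 mulr0 add0r big1 // => i i0.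
    by rewrite mxE (negPf i0) rmorph0 mul0r.
  by rewrite !mxE !eqxx oner_eq0.
pose v := (p 0 0)^-1 *: p.
have vrep : represents v xi.
  split; last by rewrite rpredZ // prep.2.
  by rewrite scaler_eq0 invr_eq0 (negPf p0) (negPf prep.1).
have v00 : v 0 0 = 1 by rewrite mxE mulVf.
have E0 : 0 < eucl_norm v by apply: eucl_norm_gt0; exact: vrep.1.
apply: (@uniform_exponent_bound R n S v (1 / rho)) => //.
- exact: ltn_trans n_ge2.
- rewrite ler_pdivlMr // ler_pdivrMr //; apply/andP; split; lra.
- apply: (Witt_le1_isotropic q_witt m_le1 c0 _ qE).
  by rewrite map_trmx symS.
- exact: xili.
- have := xiZ v vrep; rewrite qRE => /eqP; rewrite mulf_eq0 fmorph_eq0.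
  by rewrite (negPf c0) => /eqP.
(* As v_0 = 1, the coordinates of x - x_0 v are coordinates of the wedge product of x and v, whence
   the factor n + 1; the norm of v undoes the normalisation in [Dpt]. *)
move=> eps e0; pose N := (n.+1)%:R * eucl_norm v.
have N0 : 0 < N by rewrite mulr_gt0.
have [M MP] := small (eps / N) (divr_gt0 e0 N0).
exists (Num.max 1 (M + 1)); first by rewrite le_max lexx.
move=> X; rewrite ge_max => /andP[X1 XM].
have [[z [z0 zX] DE] _] := Dmin_attained xi X1.
exists z; split=> //.
  apply: le_trans zX; have := coord_le_eucl_norm (int_vec R z) 0.
  by rewrite mxE intr_norm.
have X0 : 0 < X by lra.
have := MP X (ltac:(lra)).
rewrite DE (Dpt_rep _ vrep) /powR gt_eqF //.
set L := l1 _; set W := wedge_norm _ _; set Y := expR _ => WY.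
have LW : L <= n.+1%:R * W.
  apply: (@le_trans _ _ (\sum_(i < n.+1) W)).
    apply: ler_sum => i _; have := coord_le_wedge_norm (int_vec R z) v i 0.
    by rewrite v00 mulr1 !mxE.
  by rewrite sumr_const card_ord mulr_natl.
have YE : expR (- (1 / rho * ln X)) = Y^-1 by rewrite expRN.
rewrite YE ler_pdivlMr ?expR_gt0 //.
move: WY; rewrite ltr_pdivlMr // /N => WY.
apply: ltW; apply: le_lt_trans WY.
have -> : Y * (W / eucl_norm v) * (n.+1%:R * eucl_norm v) = n.+1%:R * W * Y.
  by field; rewrite lt0r_neq0.
by rewrite ler_wpM2r // expR_ge0.
Qed.

End LowerBound.

(** * Pell's equation *)

Lemma ord_collision (F : finType) (k : nat) (f : 'I_k -> F) : (#|F| < k)%N ->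
  exists i j : 'I_k, (i < j)%N /\ f i = f j.
Proof.
move=> Fk; have [/injectiveP inj|] := boolP (injectiveb f).
  by have := leq_card f inj; rewrite card_ord leqNgt Fk.
move=> /injectivePn[i [j ij fij]].
have [lt_ij|lt_ji|/val_inj e] := ltngtP i j; first by exists i, j.
  by exists j, i.
by rewrite e eqxx in ij.
Qed.

Lemma dirichlet_approximation (R : realType) (r : R) (Q : nat) : (0 < Q)%N ->
  exists (a : int) (b : nat), (0 < b <= Q)%N /\ `|a%:~R - b%:R * r| < Q%:R^-1.
Proof.
move=> Q0; have Qr0 : 0 < Q%:R :> R by rewrite ltr0n.
pose fr (i : nat) : R := i%:R * r - (Num.floor (i%:R * r))%:~R.
have fr01 i : 0 <= fr i < 1.
  have /andP[h1 h2] : (Num.floor (i%:R * r))%:~R <= i%:R * r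
      < (Num.floor (i%:R * r) + 1)%:~R by apply: floor_itv.
  by rewrite /fr; rewrite intrD in h2; apply/andP; split; lra.
pose g (i : nat) : int := Num.floor (Q%:R * fr i).
have gitv i : (g i)%:~R <= Q%:R * fr i < (g i)%:~R + 1.
  by have := floor_itv (Q%:R * fr i); rewrite intrD.
have g0 i : 0 <= g i by rewrite floor_ge0 mulr_ge0 //; case/andP: (fr01 i).
have gQ i : g i < Q%:Z.
  rewrite -(ltr_int R); have /andP[h1 _] := gitv i; apply: le_lt_trans h1 _.
  by rewrite -pmulrn gtr_pMr //; case/andP: (fr01 i).
have gQ' i : (absz (g i) < Q)%N by have := g0 i; have := gQ i; lia.
have [|i [j [lt_ij /(congr1 val) /= gij]]] :=
    @ord_collision _ Q.+1 (fun i => Ordinal (gQ' i)).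
  by rewrite card_ord.
have {}gij : g i = g j by have := g0 i; have := g0 j; lia.
exists (Num.floor (j%:R * r) - Num.floor (i%:R * r)), (j - i)%N; split.
  by rewrite subn_gt0 lt_ij /=; have := ltn_ord j; lia.
rewrite intrB natrB ?(ltnW lt_ij) //.
have -> : (Num.floor (j%:R * r))%:~R - (Num.floor (i%:R * r))%:~R -
  (j%:R - i%:R) * r = fr i - fr j by rewrite /fr; ring.
rewrite -(ltr_pM2l Qr0) mulfV ?lt0r_neq0 //.
rewrite -[X in X * _](gtr0_norm Qr0) -normrM ltr_norml.
have /andP[] := gitv i; have /andP[] := gitv j; rewrite gij.
by move=> *; apply/andP; split; lra.
Qed.

Section Pell.
Context (R : realType) (N : nat) (N_nonsquare : forall k : nat, (k ^ 2)%N != N).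

Lemma pell_form_neq0 (a b : int) : b != 0 -> a ^+ 2 - N%:Z * b ^+ 2 != 0.
Proof.
move=> b0; apply/eqP => /eqP; rewrite subr_eq0 => /eqP ab.
have abN : (absz a ^ 2 = N * absz b ^ 2)%N.
  by have /(congr1 absz) := ab; rewrite abszM !abszX.
have : (absz b ^ 2 %| absz a ^ 2)%N by rewrite abN dvdn_mull.
rewrite dvdn_pexp2r // => /dvdnP[k kE].
have /eqP := N_nonsquare k; apply.
move: abN; rewrite kE expnMn => /eqP; rewrite eqn_pmul2r; first by move/eqP.
by rewrite expn_gt0 absz_gt0 b0.
Qed.

Let err (p : int * int) : R := `|p.1%:~R - p.2%:~R * Num.sqrt N%:R|.
Let nrm (p : int * int) : int := p.1 ^+ 2 - N%:Z * p.2 ^+ 2.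

Let N0 : (0 < N)%N.
Proof. by rewrite lt0n eq_sym; exact: (N_nonsquare 0). Qed.

Let nrmE p : (nrm p)%:~R = (p.1%:~R - p.2%:~R * Num.sqrt N%:R) *
  (p.1%:~R + p.2%:~R * Num.sqrt N%:R) :> R.
Proof.
have sN : Num.sqrt N%:R ^+ 2 = N%:R :> R by rewrite sqr_sqrtr.
rewrite /nrm rmorphB /= [(N%:Z * _)%:~R]rmorphM !rmorphXn /= -pmulrn.
by set s := Num.sqrt _ in sN *; rewrite -sN; ring.
Qed.

(** From |a - b sqrt N| < 1 / Q and b <= Q one gets |a^2 - N b^2| <= 2 sqrt N + 1 <= 2 N + 1, a
    bound that does not depend on e. *)
Lemma pell_small_norms (e : R) : 0 < e ->
  exists p : int * int, [/\ 0 < p.2, err p < e & (absz (nrm p) <= (2 * N).+1)%N].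
Proof.
move=> e0; pose Q := (Num.bound e^-1).+1.
have Qe : Q%:R^-1 < e.
  rewrite invf_plt ?posrE // ?ltr0n //.
  apply: le_lt_trans (ler_norm _) _; rewrite ger0_norm ?invr_ge0 ?ltW //.
  apply: lt_trans (archi_boundP _) _; first by rewrite invr_ge0 ltW.
  by rewrite ltr_nat.
have [a [b [/andP[b0 bQ] ab]]] := dirichlet_approximation (Num.sqrt N%:R : R) (isT : (0 < Q)%N).
exists (a, b%:Z); split=> //.
  by rewrite /err /= -pmulrn (lt_trans ab).
rewrite -(ler_nat R) natr_absz intr_norm nrmE /= -pmulrn normrM.
set s := Num.sqrt _ in ab *; have s0 : 0 <= s by apply: sqrtr_ge0.
have sN : s <= N%:R.
  rewrite -[leRHS]ger0_norm // -sqrtr_sqr ler_wsqrtr // -natrX ler_nat.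
  by rewrite leq_pmull.
have Q1 : 1 <= Q%:R :> R by rewrite ler1n.
have bQ' : b%:R <= Q%:R :> R by rewrite ler_nat.
have b0' : 0 <= b%:R :> R by [].
have ub : `|a%:~R + b%:R * s| <= 2 * (Q%:R * s) + 1.
  have -> : a%:~R + b%:R * s = (a%:~R - b%:R * s) + 2 * (b%:R * s) by ring.
  apply: le_trans (ler_normD _ _) _; rewrite addrC lerD //.
    by rewrite ger0_norm ?mulr_ge0 // ler_wpM2l // ler_wpM2r.
  by apply: le_trans (ltW ab) _; rewrite invf_le1 // ltr0n.
apply: (@le_trans _ _ (Q%:R^-1 * (2 * (Q%:R * s) + 1))).
  by rewrite ler_pM // ltW.
have -> : Q%:R^-1 * (2 * (Q%:R * s) + 1) = 2 * s + Q%:R^-1.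
  by field; rewrite pnatr_eq0.
have : Q%:R^-1 <= 1 :> R by rewrite invf_le1 // ltr0n.
have -> : (2 * N).+1%:R = 2 * N%:R + 1 :> R by rewrite -natr1 natrM.
by lra.
Qed.

(** The quotient of two numbers a + b sqrt N with the same norm k and congruent modulo k is an
    integral unit. Congruence modulo K! serves all norms |k| <= K at once, and the strictly
    decreasing errors keep the two numbers distinct, so that the unit is not trivial. *)
Lemma pell_exists : exists u s : int, s != 0 /\ u ^+ 2 = N%:Z * s ^+ 2 + 1.
Proof.
pose K := (2 * N).+1.
pose good (p : int * int) := 0 < p.2 /\ (absz (nrm p) <= K)%N.
have err_gt0 p : good p -> 0 < err p.
  move=> [p0 _]; rewrite normr_gt0; apply/eqP => e0.
  have := nrmE p; rewrite e0 mul0r => /eqP; rewrite intr_eq0.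
  by apply/negP/pell_form_neq0; rewrite gt_eqF.
have [p0 p0P] : exists p, good p.
  by have [//|p [h1 _ h2]] := @pell_small_norms 1; exists p.
have /choice[nx nxP] : forall p, exists p', good p -> good p' /\ err p' < err p.
  move=> p; have [gp|] := pselect (good p); last by exists p.
  by have [p' [h1 h2 h3]] := pell_small_norms (err_gt0 p gp); exists p'.
pose c k := iter k nx p0.
have cP k : good (c k) by elim: k => [//|k /nxP[]].
have cS k : err (c k.+1) < err (c k) by have [] := nxP _ (cP k).
have cdec i j : (i < j)%N -> err (c j) < err (c i).
  elim: j => // j IH; rewrite ltnS leq_eqVlt => /orP[/eqP->//|/IH].
  exact: lt_trans (cS j).
pose M := (K`!).-1; have ME : M.+1 = K`! by rewrite prednK // fact_gt0.
(* The norm is shifted by K into the range 0, ..., 2 K; residues are modulo M + 1 = K!. *)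
pose cl k : 'I_(2 * K).+1 * 'I_M.+1 * 'I_M.+1 :=
  (inord (absz (nrm (c k) + K%:Z)), inord (absz ((c k).1 %% M.+1)%Z),
   inord (absz ((c k).2 %% M.+1)%Z)).
have [i [j [ij]]] : exists i j : nat, (i < j)%N /\ cl i = cl j.
  by have [i [j h]] := @ord_collision _ _.+1 cl (ltnSn _); exists i, j.
move=> [/(congr1 val) h1 /(congr1 val) h2 /(congr1 val) h3].
have [b0 ki] := cP i; have [b0' kj] := cP j.
have errij := cdec _ _ ij.
have eqm (z z' : int) : val (inord (absz (z %% M.+1)%Z) : 'I_M.+1) =
    val (inord (absz (z' %% M.+1)%Z) : 'I_M.+1) -> (M.+1 %| z' - z)%Z.
  have bd y : (absz (y %% M.+1)%Z < M.+1)%N.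
    by have := @modz_ge0 y M.+1 isT; have := @ltz_pmod y M.+1 isT; lia.
  rewrite /= !inordK // => zz; rewrite -eqz_mod_dvd; apply/eqP.
  by have := @modz_ge0 z M.+1 isT; have := @modz_ge0 z' M.+1 isT; lia.
have {h2} := eqm _ _ h2; have {h3} := eqm _ _ h3.
have {h1} kE : nrm (c i) = nrm (c j).
  have key (L : nat) (k k' : int) : (absz k <= L)%N -> (absz k' <= L)%N ->
      val (inord (absz (k + L%:Z)) : 'I_(2 * L).+1) =
      val (inord (absz (k' + L%:Z)) : 'I_(2 * L).+1) -> k = k'.
    by move=> kL k'L; rewrite /= !inordK ?ltnS; lia.
  exact: key ki kj h1.
have kM : (nrm (c i) %| Posz M.+1)%Z.
  rewrite ME dvdzE absz_nat dvdn_fact // ki absz_gt0 andbT pell_form_neq0 //.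
  by rewrite gt_eqF.
move=> /(dvdz_trans kM) kb /(dvdz_trans kM) ka.
have k0 : nrm (c i) != 0 by rewrite pell_form_neq0 // gt_eqF.
move: kE ka kb k0 b0 b0' errij {kM ki kj}; rewrite /nrm /err.
move: (c i) (c j) => [a b] [a' b'] /=; set k := a ^+ 2 - _.
move=> kE /dvdzP[x xE] /dvdzP[y yE] k0 b0 b0' errij.
have a'E : a' = a + x * k by lia.
have b'E : b' = b + y * k by lia.
(* These are (a a' - N b b') / k and (a b' - a' b) / k. *)
exists (1 + a * x - N%:Z * b * y), (a * y - b * x).
have us : (1 + a * x - N%:Z * b * y) ^+ 2 = N%:Z * (a * y - b * x) ^+ 2 + 1.
  have k20 : k ^+ 2 != 0 by rewrite expf_neq0.
  apply: (mulfI k20).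
  have -> : k ^+ 2 * (1 + a * x - N%:Z * b * y) ^+ 2 =
      (a * a' - N%:Z * b * b') ^+ 2 by rewrite a'E b'E /k; ring.
  have -> : k ^+ 2 * (N%:Z * (a * y - b * x) ^+ 2 + 1) =
      N%:Z * (a * b' - a' * b) ^+ 2 + k * k by rewrite a'E b'E /k; ring.
  by rewrite {2}kE /k; ring.
split=> //; apply: contraTneq errij => s0.
have abE : a * b' = a' * b by rewrite a'E b'E; have : a * y * k = b * x * k; [congr (_ * k); lia|lia].
have bb : b' = b.
  have : k * b' ^+ 2 = k * b ^+ 2.
    rewrite {2}kE; rewrite /k.
    have : (a * b') ^+ 2 = (a' * b) ^+ 2 by rewrite abE.
    by rewrite !exprMn; lia.
  by move/(mulfI k0) => /eqP; rewrite eqf_sqr => /orP[/eqP//|/eqP]; lia.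
have -> : a' = a by apply: (mulIf (x := b)); [rewrite gt_eqF|rewrite -abE bb].
by rewrite bb ltxx.
Qed.

(** Squaring the unit u + s sqrt N yields a strictly larger one. *)
Lemma pell_large (B : nat) : exists u s : nat,
  [/\ (B < u)%N, (0 < s)%N & (u ^ 2 = N * s ^ 2 + 1)%N].
Proof.
elim: B => [|B [u [s [Bu s0 us]]]].
  have [u [s [s0 us]]] := pell_exists.
  exists (absz u), (absz s); rewrite !absz_gt0 s0; split=> //.
    have Ns : 0 <= N%:Z * s ^+ 2 by rewrite mulr_ge0 // sqr_ge0.
    by apply/eqP => u0; move: us; rewrite u0 expr0n /=; lia.
  rewrite -abszX us.
  have -> : N%:Z * s ^+ 2 + 1 = (N * absz s ^ 2 + 1)%N%:Z.
    by rewrite PoszD PoszM -abszX gez0_abs ?sqr_ge0.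
  by [].
exists (u ^ 2 + N * s ^ 2)%N, (2 * u * s)%N.
have u1 : (1 < u)%N.
  have Ns : (0 < N * s ^ 2)%N by rewrite muln_gt0 N0 expn_gt0 s0.
  by rewrite -(ltn_exp2r 1 u (isT : 0 < 2)%N) us exp1n; lia.
split; first by have : (u < u ^ 2)%N; [rewrite -{1}(expn1 u) ltn_exp2l|lia].
  by rewrite !muln_gt0 s0 andbT; lia.
have -> : (u ^ 2 + N * s ^ 2 = 2 * (N * s ^ 2) + 1)%N by lia.
have -> : (N * (2 * u * s) ^ 2 = 4 * u ^ 2 * (N * s ^ 2))%N.
  by rewrite !expnMn; ring.
by rewrite us; ring.
Qed.
End Pell.

(** * Initial vectors *)

(** Negativity is an open condition and rational vectors are dense. A perturbation of size e <= 1
    changes the form by at most e D, and e D <= - b / 2. *)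
Lemma rational_negative_vector (R : realType) n (A : 'M[rat]_n)
    (v : 'rV[R]_n) :
  bform (map_mx ratr A) v v < 0 -> exists x : 'rV[rat]_n, bform A x x < 0.
Proof.
move=> vneg; have [C C0 bC] := bform_bound (map_mx (@ratr R) A).
set b := bform _ v v in vneg; have V0 := l1_ge0 v.
pose D := C * (2 * l1 v + 1) + 1; have D1 : 0 < D.
  by rewrite ltr_wpDl // mulr_ge0 //; lra.
pose e := Num.min 1 (- b / (2 * D)).
have e0 : 0 < e by rewrite lt_min ltr01 divr_gt0 //; lra.
have e1 : e <= 1 by rewrite ge_min lexx.
have eD : e * D <= - b / 2.
  have : e <= - b / (2 * D) by rewrite ge_min lexx orbT.
  by rewrite ler_pdivlMr; lra.
pose h := e / n.+1%:R; have h0 : 0 < h by rewrite divr_gt0.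
have /choice[x xP] : forall i, exists x : rat, `|ratr x - v 0 i| < h.
  move=> i; have [|x] := @rat_in_itvoo R (v 0 i) (v 0 i + h); first by rewrite ltrDl.
  rewrite in_itv /= => /andP[x1 x2]; exists x.
  by rewrite ltr_norml; apply/andP; split; lra.
exists (\row_i x i); set X : 'rV[rat]_n := \row_i x i.
pose d := map_mx ratr X - v.
have dl : l1 d <= e.
  apply: (@le_trans _ _ (\sum_(i < n) h)).
    by apply: ler_sum => i _; rewrite !mxE ltW.
  rewrite sumr_const card_ord -mulr_natr /h -mulrA ger_pMr // mulrC.
  by rewrite ler_pdivrMr // mul1r ler_nat.
have XE : map_mx ratr X = v + d by rewrite addrC subrK.
rewrite -(ltr_rat R) rmorph0 -map_bform XE; clearbody d X.
rewrite !bformL -/b.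
have := bC v d; have := bC d v; have := bC d d; have D0 := l1_ge0 d.
rewrite !ler_norml => /andP[_ h1] /andP[_ h2] /andP[_ h3].
have k1 : C * l1 d * l1 d <= C * e.
  by rewrite -mulrA ler_wpM2l // -[leRHS]mulr1 ler_pM //; lra.
have k2 : C * l1 v * l1 d <= C * l1 v * e by rewrite ler_wpM2l // mulr_ge0.
by rewrite /D in eD; lra.
Qed.

(** For d > 0 this means that d is not the square of a rational number, in the form used for Pell's
    equation: up to a rational square, d is a natural number N. *)
Definition nonsquare (d : rat) := exists r N : nat,
  [/\ (0 < r)%N, forall k : nat, (k ^ 2)%N != N & d * r%:R ^+ 2 = N%:R].

Lemma nonsquare_gt0 d : nonsquare d -> 0 < d.
Proof.
move=> [r [N [r0 Nsq dr]]].
have N0 : (0 < N)%N by rewrite lt0n eq_sym; exact: (Nsq 0).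
have r20 : 0 < r%:R ^+ 2 :> rat by rewrite exprn_gt0 // ltr0n.
by rewrite -(pmulr_lgt0 _ r20) dr ltr0n.
Qed.

Lemma nonsquareP (d : rat) : 0 < d -> nonsquare d \/ exists2 r, 0 < r & d = r ^+ 2.
Proof.
move=> d0; pose p := absz (numq d); pose D := absz (denq d).
have D0 : (0 < D)%N by rewrite absz_gt0 denq_eq0.
have D0' : D%:R != 0 :> rat by rewrite pnatr_eq0 -lt0n.
have dE : d = p%:R / D%:R.
  rewrite /p /D !natr_absz !ger0_norm ?denq_ge0 ?numq_ge0 ?ltW //.
  by rewrite divq_num_den.
have [[k /eqP kE]|nk] := pselect (exists k : nat, (k ^ 2 == p * D)%N).
  right; exists (k%:R / D%:R).
    rewrite divr_gt0 ?ltr0n // lt0n; apply: contraTneq d0 => k0.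
    have : (p * D)%N = 0%N by rewrite -kE k0.
    move/eqP; rewrite muln_eq0 (gtn_eqF D0) orbF => /eqP p0.
    by rewrite dE p0 mul0r ltxx.
  by rewrite exprMn -natrX kE natrM dE; field.
left; exists D, (p * D)%N; split=> // [k|].
  by apply/eqP => kE; apply: nk; exists k; rewrite kE.
by rewrite dE natrM; field.
Qed.

(** Multiplied by (D s^2 t)^2, the number becomes A^2 - p s with 0 < |p s| < A: too close to A^2 to
    be another square. The factor t = |p| s + 1 makes A large enough. *)
Lemma nonsquare_perturbation (r g : rat) : 0 < r -> g != 0 ->
  exists2 m : nat, (0 < m)%N & nonsquare (r ^+ 2 - g / m%:R ^+ 2).
Proof.
move=> r0 g0; pose k := absz (numq r); pose D := absz (denq r).
pose s := absz (denq g); pose p := numq g.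
have D0 : (0 < D)%N by rewrite absz_gt0 denq_eq0.
have s0 : (0 < s)%N by rewrite absz_gt0 denq_eq0.
have D0' : D%:R != 0 :> rat by rewrite pnatr_eq0 -lt0n.
have s0' : s%:R != 0 :> rat by rewrite pnatr_eq0 -lt0n.
have rE : r = k%:R / D%:R.
  rewrite /k /D !natr_absz !ger0_norm ?denq_ge0 ?numq_ge0 ?ltW //.
  by rewrite divq_num_den.
have gE : g = p%:~R / s%:R.
  by rewrite /s natr_absz ger0_norm ?denq_ge0 // divq_num_den.
have k0 : (0 < k)%N by rewrite absz_gt0 numq_eq0 gt_eqF.
have p0 : p != 0 by rewrite numq_eq0.
clearbody k D s p; pose t := (absz p * s).+1; pose A := (k * s ^ 2 * t)%N.
have At : (t <= A)%N by rewrite leq_pmull // muln_gt0 k0 expn_gt0 s0.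
have pA : `|p * s%:Z| < A%:Z by rewrite normrM; lia.
have p0' : p * s%:Z != 0 by rewrite mulf_neq0 // -lt0n.
have AA : A%:Z <= A%:Z * A%:Z by rewrite -[leLHS]mulr1 ler_pM // /A; lia.
pose N := absz (A%:Z ^+ 2 - p * s%:Z)%R.
have NE : N%:Z = A%:Z ^+ 2 - p * s%:Z by rewrite /N gez0_abs //; rewrite expr2; lia.
have AE : A%:R = k%:R * s%:R ^+ 2 * t%:R :> rat by rewrite /A !natrM.
have t0 : t%:R != 0 :> rat by rewrite pnatr_eq0.
clearbody N A t; exists (D * s * t)%N; first by rewrite !muln_gt0 D0 s0 lt0n -(pnatr_eq0 rat).
exists (D * s * t * s)%N, N; split.
- by rewrite !muln_gt0 D0 s0 lt0n -(pnatr_eq0 rat) t0.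
- move=> z; apply/eqP => zN.
  have : (A%:Z - z%:Z) * (A%:Z + z%:Z) = p * s%:Z.
    by have : (z%:Z * z%:Z = N%:Z) by [rewrite -PoszM -zN|]; rewrite NE; lia.
  have zA : z%:Z <> A%:Z by move=> zA; move: p0' => /eqP; lia.
  by have := normr_ge0 (p * s%:Z); move: pA; nia.
have -> : r ^+ 2 - g / (D * s * t)%:R ^+ 2 =
    (A%:R ^+ 2 - p%:~R * s%:R) / (D * s * t * s)%:R ^+ 2.
  by rewrite rE gE AE !natrM; field; rewrite t0 s0' D0'.
rewrite divfK; last by rewrite expf_neq0 // !natrM !mulf_neq0.
by rewrite (pmulrn _ N) NE rmorphB rmorphXn rmorphM.
Qed.

(** * A rational plane with nonsquare discriminant *)

Section RationalPlane.
Context (R : realType) (n : nat) (S : 'M[int]_n.+1) (v : 'rV[R]_n.+1).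
Hypotheses (S0 : S != 0) (symS : S^T = S).
Hypotheses (vQ : Q_independent v) (v_iso : bform (map_mx intr S) v v = 0).

Let SQ : 'M[rat]_n.+1 := map_mx intr S.
Let SR : 'M[R]_n.+1 := map_mx intr S.

Let SRE : SR = map_mx ratr SQ.
Proof. exact: map_intr_ratr. Qed.

Let symSQ : SQ^T = SQ. Proof. by rewrite map_trmx symS. Qed.
Let symSR : SR^T = SR. Proof. by rewrite map_trmx symS. Qed.

(** b(v, w) is a rational linear form in the coordinates of v, nontrivial because w pairs
    nontrivially with x. *)
Lemma bform_rat_neq0 (w x : 'rV[rat]_n.+1) :
  bform SQ x w != 0 -> bform SR v (map_mx ratr w) != 0.
Proof.
move=> xw; have -> : bform SR v (map_mx ratr w) =
    \sum_i ratr ((SQ *m w^T) i 0) * v 0 i.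
  rewrite /bform -mulmxA SRE map_trmx -map_mxM mxE.
  by apply: eq_bigr => i _; rewrite mulrC; congr (_ * _); rewrite [LHS]mxE.
apply: dot_neq0 => //; apply: contra_neq xw.
by rewrite /bform -mulmxA => ->; rewrite mulmx0 mxE.
Qed.

Lemma exists_anisotropic : exists e : 'rV[rat]_n.+1, bform SQ e e != 0.
Proof.
apply: contrapT => ne; have e0 e : bform SQ e e = 0.
  by apply/eqP; apply: contraT => h; case: ne; exists e.
have : SQ = 0.
  apply/matrixP => i j; rewrite [RHS]mxE.
  have dE k l : bform SQ (delta_mx 0 k) (delta_mx 0 l) = SQ k l.
    by rewrite /bform -rowE trmx_delta -colE !mxE.
  have := e0 (delta_mx 0 i + delta_mx 0 j).
  by rewrite !bformL !e0 (bformC (delta_mx 0 j) _ symSQ) dE; lra.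
by move/eqP; rewrite map_intr_eq0 (negPf S0).
Qed.

(** Projection along e onto its orthogonal complement, acting on row vectors. *)
Let proj (K : fieldType) (T : 'M[K]_n.+1) (e : 'rV[K]_n.+1) : 'M[K]_n.+1 :=
  1%:M - (bform T e e)^-1 *: (T *m e^T *m e).

Let projE (K : fieldType) (T : 'M[K]_n.+1) (e x : 'rV[K]_n.+1) :
  x *m proj T e = x - (bform T x e / bform T e e) *: e.
Proof.
rewrite mulmxBr mulmx1 -scalemxAr !mulmxA.
have -> : x *m T *m e^T = (bform T x e)%:M by exact: mx11_scalar.
by rewrite mul_scalar_mx scalerA mulrC.
Qed.

Let map_proj (e : 'rV[rat]_n.+1) :
  map_mx (@ratr R) (proj SQ e) = proj SR (map_mx ratr e).
Proof.
rewrite /proj map_mxB map_mx1 map_mxZ !map_mxM map_trmx SRE map_bform fmorphV.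
by [].
Qed.

Let restr (K : fieldType) (T G : 'M[K]_n.+1) := G *m T *m G^T.

Let restrE (K : fieldType) (T G : 'M[K]_n.+1) x :
  bform (restr T G) x x = bform T (x *m G) (x *m G).
Proof. by rewrite /restr /bform trmx_mul !mulmxA. Qed.

Let map_restr (G : 'M[rat]_n.+1) :
  map_mx (@ratr R) (restr SQ G) = restr SR (map_mx ratr G).
Proof. by rewrite /restr !map_mxM map_trmx SRE. Qed.

(** Let v' be the projection of v orthogonal to e0 and t = b(v, e0), nonzero by independence. As v
    is isotropic, b(v', v') / a = - (t / a)^2 < 0, and a rational vector with the same sign exists
    by density. *)
Lemma exists_indefinite_pair : exists e0 e1 : 'rV[rat]_n.+1,
  [/\ bform SQ e0 e0 != 0, bform SQ e0 e1 = 0 &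
      0 < - (bform SQ e1 e1 / bform SQ e0 e0)].
Proof.
have [e0 a0] := exists_anisotropic; set a := bform SQ e0 e0 in a0.
have [x xneg] : exists x, bform (a^-1 *: restr SQ (proj SQ e0)) x x < 0.
  apply: (rational_negative_vector (v := v)).
  have -> : map_mx (@ratr R) (a^-1 *: restr SQ (proj SQ e0)) =
      (ratr a)^-1 *: restr SR (proj SR (map_mx ratr e0)).
    by rewrite map_mxZ map_restr map_proj fmorphV.
  rewrite /bform -scalemxAr -scalemxAl mxE -/(bform _ v v) restrE projE.
  set E0 := map_mx _ e0; have aE : bform SR E0 E0 = ratr a.
    by rewrite SRE map_bform.
  have ar0 : ratr a != 0 :> R by rewrite fmorph_eq0.
  have vE : bform SR v E0 != 0 by apply: (bform_rat_neq0 (x := e0)).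
  rewrite aE !bformL v_iso aE (bformC E0 v symSR).
  set t := bform SR v E0 in vE *.
  rewrite [ltLHS](_ : _ = - (t / ratr a) ^+ 2); last by field.
  by rewrite oppr_lt0 exprn_even_gt0 //= mulf_neq0 // invr_eq0.
exists e0, (x *m proj SQ e0); split=> //.
  by rewrite projE !bformL (bformC e0 x symSQ) -/a divfK // subrr.
move: xneg; rewrite /bform -scalemxAr -scalemxAl mxE -/(bform _ x x) restrE.
by rewrite mulrC oppr_gt0.
Qed.

(** If d = r^2, adding to e1 a small multiple of a nonisotropic f orthogonal to the plane makes d a
    nonsquare. If there is no such f, the form vanishes on the complement of the plane, and b(v, v)
    = 0 reads b(v, e0 + e1 / r) b(v, e0 - e1 / r) = 0. This contradicts the independence of v, since
    these two rational vectors are not in the kernel. *)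
Lemma exists_nonsquare_pair : exists (e0 e1 : 'rV[rat]_n.+1) (d : rat),
  [/\ bform SQ e0 e0 != 0, bform SQ e0 e1 = 0, nonsquare d &
      bform SQ e1 e1 = - d * bform SQ e0 e0].
Proof.
have [e0 [e1 [a0 e01]]] := exists_indefinite_pair.
set a := bform SQ e0 e0 in a0 *; set d := - _ => d0.
have e11 : bform SQ e1 e1 = - d * a by rewrite /d opprK divfK.
clearbody d; have [ns|[r r0 dE]] := nonsquareP d0; first by exists e0, e1, d.
have b0 : bform SQ e1 e1 != 0.
  by rewrite e11 mulf_neq0 // oppr_eq0 gt_eqF.
pose G := proj SQ e0 *m proj SQ e1.
have [[x xG]|none] := pselect (exists x, bform SQ (x *m G) (x *m G) != 0).
  set f := x *m G in xG.
  have fE : f = x *m proj SQ e0 *m proj SQ e1 by rewrite /f mulmxA.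
  have f1 : bform SQ f e1 = 0.
    by rewrite fE [in bform _ _ _]projE !bformL divfK // subrr.
  have f0 : bform SQ f e0 = 0.
    rewrite fE projE bformL bformNl bformZl (bformC e1 e0 symSQ) e01 mulr0 subr0.
    by rewrite projE !bformL divfK // subrr.
  pose g := bform SQ f f / a.
  have [|m m0 ns] := @nonsquare_perturbation r g r0.
    by rewrite mulf_neq0 // invr_eq0.
  exists e0, (e1 + m%:R^-1 *: f), (r ^+ 2 - g / m%:R ^+ 2); split=> //.
    by rewrite !bformL e01 (bformC e0 f symSQ) f0; ring.
  rewrite !bformL (bformC e1 f symSQ) f1 e11 dE /g -/a.
  by field; rewrite a0 pnatr_eq0 -lt0n m0.
exfalso; pose E0 : 'rV[R]_n.+1 := map_mx ratr e0.
pose E1 : 'rV[R]_n.+1 := map_mx ratr e1.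
pose GR := proj SR E0 *m proj SR E1.
have GRE : GR = map_mx ratr G by rewrite map_mxM !map_proj.
have vG : bform SR (v *m GR) (v *m GR) = 0.
  have restrR : map_mx ratr (restr SQ G) = restr SR GR.
    by rewrite map_restr GRE.
  (* A nonzero value at v, of either sign, would be inherited by a rational vector. *)
  have no (c : rat) : ~ (ratr c * bform SR (v *m GR) (v *m GR) < 0).
    rewrite -restrE -restrR => neg.
    have [|x] := @rational_negative_vector R _ (c *: restr SQ G) v.
      by rewrite map_mxZ /bform -scalemxAr -scalemxAl mxE.
    rewrite /bform -scalemxAr -scalemxAl mxE -/(bform _ x x) restrE => xG.
    by apply: none; exists x; apply: contraTneq xG => ->; rewrite mulr0 ltxx.
  have := no 1; have := no (-1); rewrite rmorphN /= !rmorph1 mul1r mulN1r.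
  by move=> h1 h2; apply/eqP; rewrite eq_le !leNgt; apply/andP; split;
    apply/negP => h; [apply: h1; rewrite oppr_lt0|apply: h2].
have E0E : bform SR E0 E0 = ratr a by rewrite SRE map_bform.
have E1E : bform SR E1 E1 = - ratr (r ^+ 2) * ratr a.
  by rewrite SRE map_bform e11 dE rmorphM rmorphN.
have E01 : bform SR E0 E1 = 0 by rewrite SRE map_bform e01 rmorph0.
have ar0 : ratr a != 0 :> R by rewrite fmorph_eq0.
have rr0 : ratr r != 0 :> R by rewrite fmorph_eq0 gt_eqF.
pose s := bform SR v E0; pose t := bform SR v E1.
have key : (s + t / ratr r) * (s - t / ratr r) = 0.
  move: vG; rewrite /GR mulmxA !projE !bformL (bformC E0 v symSR) (bformC E1 v symSR).
  rewrite (bformC E1 E0 symSR) E01 E0E E1E v_iso -/s -/t rmorphXn /= => vG.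
  rewrite -[RHS](mulr0 (- ratr a)) -[X in _ = _ * X]vG.
  by field; rewrite ar0 rr0.
have no (w : 'rV[rat]_n.+1) : bform SQ e0 w = a -> bform SR v (map_mx ratr w) <> 0.
  by move=> ew; apply/eqP/(bform_rat_neq0 (x := e0)); rewrite ew.
move/eqP: key; rewrite mulf_eq0 => /orP[] /eqP h.
  apply: (no (e0 + r^-1 *: e1)); first by rewrite !bformL e01 -/a; ring.
  by rewrite map_mxD map_mxZ !bformL -/s -/t -[RHS]h fmorphV mulrC.
apply: (no (e0 - r^-1 *: e1)); first by rewrite !bformL e01 -/a; ring.
by rewrite map_mxB map_mxZ !bformL -/s -/t -[RHS]h fmorphV mulrC.
Qed.
End RationalPlane.

(** This is Pell's equation for N M^2; the prescribed factor M will clear the denominators of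
    pairings. *)
Lemma nonsquare_pell (R : realType) (d : rat) (M : nat) (b : rat) :
    nonsquare d -> (0 < M)%N ->
  exists u s : nat, [/\ b < u%:R, (0 < s)%N &
    u%:R ^+ 2 = d * (M%:R * s%:R) ^+ 2 + 1].
Proof.
move=> [r [N [r0 Nsq dr]]] M0.
have NM k : (k ^ 2)%N != (N * M ^ 2)%N.
  apply/eqP => kE; have : (M ^ 2 %| k ^ 2)%N by rewrite kE dvdn_mull.
  rewrite dvdn_pexp2r // => /dvdnP[j jE].
  have /eqP := Nsq j; apply; move: kE; rewrite jE expnMn => /eqP.
  by rewrite eqn_pmul2r ?expn_gt0 ?M0 // => /eqP.
have [u [s [bu s0 us]]] := pell_large R NM (Num.bound `|b|).
exists u, (r * s)%N; split.
- apply: le_lt_trans (ler_norm b) _; apply: lt_trans (archi_boundP _) _ => //.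
  by rewrite ltr_nat.
- by rewrite muln_gt0 r0.
rewrite -natrX us natrD natrM natrM !natrX -dr.
by rewrite natrM; ring.
Qed.

Section InitialVectors.
Context (R : realType) (n : nat) (S : 'M[rat]_n.+1) (e0 e1 : 'rV[rat]_n.+1).
Context (d : rat).
Hypotheses (n_ge2 : (2 <= n)%N) (symS : S^T = S).
Hypotheses (a0 : bform S e0 e0 != 0) (e01 : bform S e0 e1 = 0).
Hypotheses (d_ns : nonsquare d) (e11 : bform S e1 e1 = - d * bform S e0 e0).

Let a := bform S e0 e0.
Let d0 : 0 < d := nonsquare_gt0 d_ns.
Let b0 : bform S e1 e1 != 0.
Proof. by rewrite e11 mulf_neq0 // oppr_eq0 gt_eqF. Qed.

(** The Gram matrix of e0 and e1 is invertible, so the two linear conditions are independent and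
    their kernel has dimension n - 1. *)
Lemma orthogonal_complement_rows : exists F : 'M[rat]_(n.-1, n.+1),
  forall x, (x <= F)%MS = (bform S x e0 == 0) && (bform S x e1 == 0).
Proof.
pose M : 'M[rat]_(n.+1, 1 + 1) := row_mx (S *m e0^T) (S *m e1^T).
have E u w : u *m S *m w^T = (bform S u w)%:M by exact: mx11_scalar.
have rM : \rank M = 2%N.
  apply/eqP; rewrite eqn_leq rank_leq_col /=.
  apply: leq_trans (mxrankM_maxr (col_mx e0 e1) M).
  have -> : col_mx e0 e1 *m M = block_mx (bform S e0 e0)%:M 0 0 (bform S e1 e1)%:M.
    rewrite mul_col_row !mulmxA !E (bformC e1 e0 symS) e01.
    by rewrite raddf0.
  have : block_mx (bform S e0 e0)%:M 0 0 (bform S e1 e1)%:M \in @unitmx rat (1 + 1).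
    by rewrite unitmxE unitfE det_ublock !det_scalar1 mulf_neq0.
  by rewrite -row_full_unit => /eqP->.
have rk : \rank (kermx M) = n.-1 by rewrite mxrank_ker rM; lia.
exists (castmx (rk, erefl) (row_base (kermx M))) => x.
rewrite eqmx_cast eq_row_base.
apply/sub_kermxP/andP => [xM|[/eqP x0 /eqP x1]].
  have := xM; rewrite mul_mx_row => /eqP; rewrite row_mx_eq0 !mulmxA.
  by rewrite /bform => /andP[/eqP-> /eqP->]; rewrite mxE eqxx.
rewrite mul_mx_row !mulmxA; apply/eqP; rewrite row_mx_eq0.
by rewrite !E x0 x1 raddf0 eqxx.
Qed.

(** f_1, ..., f_(n-1) span the complement of the plane, and f_0 = 0 provides for a vector inside the
    plane. Avoiding the value d keeps the later denominators g_i - d nonzero. Spanning is stated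
    dually, through functionals c. *)
Lemma exists_complement_basis : exists f : nat -> 'rV[rat]_n.+1,
  [/\ f 0%N = 0, forall i, bform S (f i) e0 = 0 /\ bform S (f i) e1 = 0,
      forall i, bform S (f i) (f i) / a != d &
      forall c : 'cV[rat]_n.+1,
        (forall i, (0 < i < n)%N -> f i *m c = 0) ->
        e0 *m c = 0 -> e1 *m c = 0 -> c = 0].
Proof.
have [F FE] := orthogonal_complement_rows.
pose g (i : nat) : 'rV[rat]_n.+1 :=
  if insub i.-1 is Some j then row (j : 'I_n.-1) F else 0.
have gP i : bform S (g i) e0 = 0 /\ bform S (g i) e1 = 0.
  rewrite /g; case: insubP => [j _ _|_]; last by rewrite !bform0l.
  by have := row_sub j F; rewrite FE => /andP[/eqP-> /eqP->].
(* Doubling changes a value d into 4 d. *)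
pose f i := if i is 0 then 0 else
  if bform S (g i) (g i) / a == d then 2 *: g i else g i.
have fg i : (0 < i)%N -> exists2 c : rat, c != 0 & f i = c *: g i.
  case: i => // i _; rewrite /f; case: ifP => _; first by exists 2.
  by exists 1; rewrite ?scale1r.
exists f; split=> // [i|i|c fc ec0 ec1].
- case: i => [|i]; first by rewrite !bform0l.
  have [c _ ->] := fg i.+1 isT.
  by rewrite !bformZl (gP i.+1).1 (gP i.+1).2 mulr0.
- case: i => [|i]; first by rewrite /f bform0l mul0r lt_eqF.
  rewrite /f; case: ifPn => // /eqP gd.
  rewrite !bformL mulrA -[_ / a]mulrA gd -[X in _ != X]mul1r.
  by rewrite (inj_eq (mulIf _)) // gt_eqF.
have Fc : F *m c = 0.
  apply/row_matrixP => j; rewrite row_mul row0.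
  have j1 : (0 < j.+1 < n)%N by have := ltn_ord j; lia.
  have [k k0 fE] := fg j.+1 isT; have := fc _ j1; rewrite fE.
  rewrite /g /= insubT ?ltn_ord // => lt_j; have -> : Sub (j : nat) lt_j = j by apply: val_inj.
  by rewrite -scalemxAl => /eqP; rewrite scaler_eq0 (negPf k0) => /eqP.
apply/row_matrixP => i; rewrite row0 rowE; set x := delta_mx _ _; clearbody x.
pose y := x - (bform S x e0 / a) *: e0 - (bform S x e1 / bform S e1 e1) *: e1.
have : (y <= F)%MS.
  rewrite FE /y !bformL (bformC e1 e0 symS) e01 !mulr0 !subr0 divfK // divfK //.
  by rewrite !subrr eqxx.
move=> /submxP[D yE]; have yc : y *m c = 0 by rewrite yE -mulmxA Fc mulmx0.
have xE : x = y + (bform S x e1 / bform S e1 e1) *: e1 + (bform S x e0 / a) *: e0.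
  by rewrite /y !subrK.
clearbody y; rewrite xE.
by rewrite !mulmxDl -!scalemxAl yc ec0 ec1 !scaler0 !addr0.
Qed.

(** With this scaling the reflection in a vector of value 2 is y - B(x, y) x, without
    denominator. *)
Definition nbform (x y : 'rV[rat]_n.+1) : rat := 2 * bform S x y / a.

(* Only [x 0], ..., [x n] matter. These conditions are preserved when the window
   moves to [x 1], ..., [x n], [t x_n - x_0] with [t = nbform x_n x_0]. *)
Definition admissible (x : nat -> 'rV[rat]_n.+1) :=
  [/\ forall i, (i <= n)%N -> nbform (x i) (x i) = 2,
      forall i j, (i <= n)%N -> (j <= n)%N -> nbform (x i) (x j) \is a Num.int,
      forall c : 'cV[rat]_n.+1, (forall i, (i <= n)%N -> x i *m c = 0) -> c = 0,
      forall i j, (j < i <= n)%N -> `|nbform (x i) (x j)| <= nbform (x n) (x 0%N) &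
      (forall i j, (i < j < n)%N -> nbform (x n) (x j) + 3 <= nbform (x n) (x i))
        /\ 3 <= nbform (x n) (x n.-1)].

(** There is one vector y_i for each f_i, and the last vector z lies in the plane of e0 and e1. The
    factor M in their coefficients makes all pairings integral. The Pell solutions are chosen larger
    and larger, for y_(n-1), ..., y_0 and finally z, which gives the inequalities. *)
Lemma exists_initial_vectors : exists x : nat -> 'rV[rat]_n.+1, admissible x.
Proof.
have [f [f0 fe fd fspan]] := exists_complement_basis.
pose g i := bform S (f i) (f i) / a.
(* Up to the sign of k, this is the second intersection of the conic - d k^2 + g_i w^2 = - d with
   the line k = 1 + w through (1, 0). *)
pose k i : rat := `|(g i + d) / (g i - d) : rat|; pose w i : rat := 2 * d / (g i - d).
have gd i : g i - d != 0 by rewrite subr_eq0 fd.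
(* Hence [U e0 - k s e1 + w s f] has the same norm as [U e0 - s e1], for which
   the norm condition is the Pell equation [U^2 - d s^2 = 1]. *)
have kw i : - d * k i ^+ 2 + g i * w i ^+ 2 = - d.
  by rewrite /k real_normK ?num_real // /w; field.
have w0 i : w i != 0 by rewrite mulf_neq0 ?invr_eq0 // mulf_neq0 // gt_eqF.
have k00 : k 0%N = 1.
  by rewrite /k /g f0 bform0l mul0r add0r sub0r invrN mulrN divff ?normrN1 // gt_eqF.
have k_ge0 i : 0 <= k i by exact: normr_ge0.
(* The three families of numbers whose denominators M must clear: the e1-part and the f-part of
   B(y_i, y_j), and the e1-part of B(z, y_i). *)
pose r (p : 'I_n * 'I_n * 'I_3) := let: (i, j, t) := p in
  if t == 0 then 2 * (d * (k i * k j)) else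
  if t == 1 then 2 * (w i * w j * (bform S (f i) (f j) / a)) else 2 * (d * k i).
have [M M0 Mint] := common_denominator r.
have Mint0 i j : (i < n)%N -> (j < n)%N -> M%:R * (2 * (d * (k i * k j))) \is a Num.int.
  by move=> i_n j_n; have := Mint (Ordinal i_n, Ordinal j_n, 0).
have Mint1 i j : (i < n)%N -> (j < n)%N ->
    M%:R * (2 * (w i * w j * (bform S (f i) (f j) / a))) \is a Num.int.
  by move=> i_n j_n; have := Mint (Ordinal i_n, Ordinal j_n, 1).
have Mint2 i : (i < n)%N -> M%:R * (2 * (d * k i)) \is a Num.int.
  by move=> i_n; have := Mint (Ordinal i_n, Ordinal i_n, 2).
have /choice[ps psP] : forall b : rat, exists p : nat * nat,
    [/\ b < p.1%:R, (0 < p.2)%N & p.1%:R ^+ 2 = d * (M%:R * p.2%:R) ^+ 2 + 1].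
  move=> b; have [u [s [h1 h2 h3]]] := nonsquare_pell R b d_ns M0.
  by exists (u, s).
(* Index j stands for i = n - 1 - j, because U_i has to exceed a bound that depends on U_(i+1). *)
pose us := fix us j := if j is j'.+1 then
  ps ((us j').1%:R + (d + 1) * (k (n.-1 - j')%N * (M%:R * (us j').2%:R)) + 2)
  else ps 2.
pose U i : rat := (us (n.-1 - i)%N).1%:R.
pose s i : rat := M%:R * (us (n.-1 - i)%N).2%:R.
pose y i := U i *: e0 - (k i * s i) *: e1 + (w i * s i) *: f i.
have usP j : [/\ 2 < (us j).1%:R :> rat, (0 < (us j).2)%N &
    (us j).1%:R ^+ 2 = d * (M%:R * (us j).2%:R) ^+ 2 + 1 :> rat].
  case: j => [|j]; first by have [] := psP 2.
  have [h1 h2 h3] := psP ((us j).1%:R +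
    (d + 1) * (k (n.-1 - j)%N * (M%:R * (us j).2%:R)) + 2).
  split=> //; apply: le_lt_trans h1.
  by rewrite lerDr addr_ge0 // !mulr_ge0 // addr_ge0 // ltW.
have s0 i : 0 < s i.
  by have [_ h _] := usP (n.-1 - i)%N; rewrite mulr_gt0 // ltr0n.
have U2 i : 2 < U i by have [] := usP (n.-1 - i)%N.
have Us i : U i ^+ 2 = d * s i ^+ 2 + 1 by have [] := usP (n.-1 - i)%N.
have Ustep i : (i.+1 < n)%N -> U i.+1 + (d + 1) * (k i.+1 * s i.+1) + 2 < U i.
  move=> i_n; rewrite /U /s.
  have -> : (n.-1 - i = (n.-1 - i.+1).+1)%N by lia.
  have [+ _ _] := psP ((us (n.-1 - i.+1)%N).1%:R +
    (d + 1) * (k i.+1 * (M%:R * (us (n.-1 - i.+1)%N).2%:R)) + 2).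
  have iE : (n.-1 - (n.-1 - i.+1) = i.+1)%N by lia.
  by move: iE; set j := (n.-1 - i.+1)%N => iE; rewrite -[X in k X]iE.
pose B (i j : nat) := nbform (y i) (y j).
have fe' i : bform S e0 (f i) = 0 /\ bform S e1 (f i) = 0.
  by rewrite (bformC e0 _ symS) (bformC e1 _ symS); exact: fe.
have e10 : bform S e1 e0 = 0 by rewrite bformC.
have BE i j : B i j = 2 * (U i * U j) - 2 * (d * (k i * k j)) * (s i * s j) +
    2 * (w i * w j * (bform S (f i) (f j) / a)) * (s i * s j).
  rewrite /B /nbform /y !bformL e01 e10 (fe i).1 (fe i).2 (fe' j).1 (fe' j).2.
  by rewrite e11 -/a; field.
have Bint i j : (i < n)%N -> (j < n)%N -> B i j \is a Num.int.
  move=> i_n j_n; rewrite BE /s.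
  set p := (us _).2; set p' := (us _).2.
  have E (z : rat) : z * (M%:R * p%:R * (M%:R * p'%:R)) =
    (M%:R * z) * (M * p * p')%:R by rewrite !natrM; ring.
  rewrite !E; apply: rpredD.
    apply: rpredB; last by apply: rpredM (Mint0 _ _ i_n j_n) _; exact: natr_int.
    by apply: rpredM; [|apply: rpredM]; exact: natr_int.
  by apply: rpredM (Mint1 _ _ i_n j_n) _; exact: natr_int.
have Bii i : B i i = 2.
  have kwi := kw i; have Usi := Us i; rewrite BE -/(g i).
  have -> : 2 * (U i * U i) - 2 * (d * (k i * k i)) * (s i * s i) +
      2 * (w i * w i * g i) * (s i * s i) =
      2 * (U i ^+ 2 + (- d * k i ^+ 2 + g i * w i ^+ 2) * s i ^+ 2) by ring.
  by rewrite kwi Usi; ring.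
pose Bd := \sum_(i < n) \sum_(j < n) `|B i j|.
have BdP i j : (i < n)%N -> (j < n)%N -> `|B i j| <= Bd.
  move=> i_n j_n; rewrite /Bd (bigD1 (Ordinal i_n)) //= (bigD1 (Ordinal j_n)) //=.
  by rewrite -addrA lerDl addr_ge0 // ?sumr_ge0 // => l _; rewrite sumr_ge0.
have Bd0 : 0 <= Bd by apply: le_trans (BdP 0%N 0%N _ _) => //; lia.
(* All pairings of z with the y_i are at least 2 v, hence exceed every |B(y_i, y_j)|. *)
have [u [t [ub t0 ut]]] := nonsquare_pell R (Bd + 2) d_ns M0.
set v : rat := u%:R in ub ut; pose q : rat := M%:R * t%:R.
have q0 : 0 < q by rewrite mulr_gt0 // ltr0n.
have vq : v ^+ 2 = d * q ^+ 2 + 1 by [].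
pose z := v *: e0 + q *: e1.
have zz : nbform z z = 2.
  rewrite /nbform !bformL e01 e10 e11 -/a.
  have -> : 2 * (v * (v * a) + v * (q * 0) + (q * (v * 0) + q * (q * (- d * a)))) / a =
    2 * (v ^+ 2 - d * q ^+ 2) by field.
  by rewrite vq; ring.
have zy i : nbform z (y i) = 2 * (v * U i) + 2 * (d * (q * (k i * s i))).
  by rewrite /nbform /y !bformL e01 e10 e11 (fe' i).1 (fe' i).2 -/a; field.
(* This explains the summand (d + 1) k s in the choice of U_i: it compensates the second term of
   B(z, y_(i+1)). *)
have dq : d * q <= (d + 1) * v.
  have v0 : 0 <= v by [].
  have d1 := d0; have h : (d * q) ^+ 2 <= ((d + 1) * v) ^+ 2.
    have : 0 <= d * q ^+ 2 by rewrite mulr_ge0 ?sqr_ge0 // ltW.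
    by rewrite !exprMn vq; nra.
  have p1 : 0 <= d * q by rewrite mulr_ge0 // ltW.
  have p2 : 0 <= (d + 1) * v by rewrite mulr_ge0 // addr_ge0 // ltW.
  by move: h; rewrite ler_pXn2r // nnegrE.
have v2 : 2 < v by lra.
have zstep i : (i.+1 < n)%N -> nbform z (y i.+1) + 3 <= nbform z (y i).
  move=> i_n; rewrite !zy.
  have h1 := Ustep i i_n; have h2 : 0 <= k i.+1 * s i.+1 by rewrite mulr_ge0 // ltW.
  have h3 : 0 <= d * (q * (k i * s i)) by rewrite !mulr_ge0 // ltW.
  have h4 : d * (q * (k i.+1 * s i.+1)) <= (d + 1) * v * (k i.+1 * s i.+1).
    by rewrite mulrA ler_wpM2r.
  have h5 : v * (U i.+1 + (d + 1) * (k i.+1 * s i.+1) + 2) <= v * U i.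
    by rewrite ler_wpM2l // ltW.
  by lra.
have zmono i j : (i < j < n)%N -> nbform z (y j) + 3 <= nbform z (y i).
  move=> /andP[]; elim: j => // j IH; rewrite ltnS leq_eqVlt => /orP[/eqP->|ij] j_n.
    exact: zstep.
  by have := IH ij (ltnW j_n); have := zstep j j_n; lra.
have zlow i : 2 * v <= nbform z (y i).
  rewrite zy; have := U2 i.
  have h3 : 0 <= d * (q * (k i * s i)) by rewrite !mulr_ge0 // ltW.
  by nra.
exists (fun i => if i == n then z else y i); rewrite /admissible eqxx.
have nn1 : (n.-1 == n) = false by lia.
have n0 : (0%N == n) = false by lia.
rewrite nn1 n0; split.
- by move=> i i_n; case: eqP => // _; apply: Bii.
- have zint i : (i < n)%N -> nbform z (y i) \is a Num.int.
    move=> i_n; rewrite zy /q /s; set p := (us _).2.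
    have -> : 2 * (d * (M%:R * t%:R * (k i * (M%:R * p%:R)))) =
      M%:R * (2 * (d * k i)) * (M * t * p)%:R by rewrite !natrM; ring.
    apply: rpredD; last by apply: rpredM (Mint2 _ i_n) _; exact: natr_int.
    by apply: rpredM; [|apply: rpredM]; exact: natr_int.
  move=> i j; have [_ _|ni i_n] := eqVneq i n; have [_ _|nj j_n] := eqVneq j n.
  + by rewrite zz; exact: natr_int.
  + by apply: zint; rewrite ltn_neqAle nj.
  + rewrite /nbform bformC //; apply: zint.
    by rewrite ltn_neqAle ni.
  + by apply: Bint; rewrite ltn_neqAle ?ni ?nj.
- move=> c xc; have := xc n (leqnn n); rewrite eqxx => zc.
  have := xc 0%N (leq0n n); rewrite n0 /y f0 scaler0 addr0 k00 mul1r => yc.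
  (* z and y_0 span the plane of e0 and e1, as their e1-coordinates have opposite signs. *)
  have ec0 : e0 *m c = 0.
    have D0 : s 0%N * v + q * U 0%N != 0.
      by rewrite gt_eqF // addr_gt0 // mulr_gt0 //; have := U2 0%N; lra.
    apply: (scalerI D0); rewrite scaler0.
    have : s 0%N *: (z *m c) + q *: ((U 0%N *: e0 - s 0%N *: e1) *m c) = 0.
      by rewrite zc yc !scaler0 addr0.
    rewrite /z mulmxDl mulmxBl -!scalemxAl => <-.
    by apply/matrixP => i j; rewrite !mxE; ring.
  have ec1 : e1 *m c = 0.
    apply: (scalerI (lt0r_neq0 q0)); rewrite scaler0.
    by move: zc; rewrite /z mulmxDl -!scalemxAl ec0 scaler0 add0r.
  apply: fspan => // i /andP[i0 i_n].
  have := xc i (ltnW i_n); rewrite ltn_eqF // /y !mulmxDl mulNmx -!scalemxAl.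
  rewrite ec0 ec1 !scaler0 subr0 add0r => /eqP.
  by rewrite scaler_eq0 mulf_eq0 (negPf (w0 i)) (gt_eqF (s0 i)) => /eqP.
- move=> i j /andP[ji i_n]; rewrite (ltn_eqF (leq_trans ji i_n)).
  have z0 := zlow 0%N; have [_|ni] := eqVneq i n.
    rewrite ger0_norm; last by apply: le_trans (zlow j); lra.
    case: j ji => // j ji; have := zmono 0%N j.+1 (leq_trans ji i_n).
    by lra.
  have j_n : (j < n)%N by apply: leq_trans i_n.
  have := BdP i j _ j_n; rewrite ltn_neqAle ni i_n => /(_ isT).
  by rewrite -/(B i j); lra.
split=> [i j /andP[ij j_n]|].
  by rewrite !ltn_eqF ?(ltn_trans ij) //; apply: zmono; rewrite ij.
by have := zlow n.-1; lra.
Qed.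
End InitialVectors.

(** * The recurrence *)

Section Windows.
Context (n : nat) (S : 'M[rat]_n.+1) (e0 : 'rV[rat]_n.+1).
Hypotheses (n_ge2 : (2 <= n)%N) (symS : S^T = S).
Local Notation B := (nbform S e0).
Local Notation admissible := (admissible S e0).

Lemma nbformC x y : B x y = B y x.
Proof. by rewrite /nbform bformC. Qed.

Lemma nbform_comb t x y z : B (t *: x - y) z = t * B x z - B y z.
Proof. by rewrite /nbform !bformL; ring. Qed.

Definition next_window (x : nat -> 'rV[rat]_n.+1) (i : nat) :=
  if (i < n)%N then x i.+1 else B (x n) (x 0%N) *: x n - x 0%N.

Lemma admissible_ge3 x i : admissible x -> (i < n)%N -> 3 <= B (x n) (x i).
Proof.
move=> [_ _ _ _ [E1 E2]] i_n; have [->|ne] := eqVneq i n.-1; first exact: E2.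
have : (i < n.-1 < n)%N by lia.
by move=> /E1; lra.
Qed.

(** B(y, x_i) = t B(x_n, x_i) - B(x_0, x_i), where |B(x_0, x_i)| <= t by admissibility. *)
Lemma next_window_bounds x i : admissible x -> (0 < i < n)%N ->
  let t := B (x n) (x 0%N) in
  let y := t *: x n - x 0%N in
  t * (B (x n) (x i) - 1) <= B y (x i) <= t * (B (x n) (x i) + 1).
Proof.
move=> adm /andP[i0 i_n] /=; have [_ _ _ D _] := adm.
have := D i 0%N; rewrite i0 ltnW // => /(_ isT).
rewrite nbform_comb (nbformC (x 0%N)) ler_norml => /andP[h1 h2].
by apply/andP; split; lra.
Qed.

(** The gap 3 reproduces itself: for inner indices B(y, x_i) - B(y, x_j) >= t (3 - 2) = t >= 3,
    while B(y, x_i) >= 2 t is well above B(y, x_n) = t. The old pairings are at most t <= B(y, x_1),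
    the new dominant one. *)
Lemma next_admissible x : admissible x -> admissible (next_window x).
Proof.
move=> adm; have [R1 R2 R3 D [E1 E2]] := adm.
set t := B (x n) (x 0%N) in D; pose y := t *: x n - x 0%N.
have wn : next_window x n = y by rewrite /next_window ltnn.
have wi i : (i < n)%N -> next_window x i = x i.+1 by rewrite /next_window => ->.
have n0 : (0 < n)%N by lia.
have tint : t \is a Num.int by apply: R2.
have t3 : 3 <= t by apply: (admissible_ge3 adm).
have yn : B y (x n) = t by rewrite nbform_comb R1 // (nbformC (x 0%N)) -/t; ring.
have yy : B y y = 2.
  rewrite nbform_comb !(nbformC _ y) yn /y nbform_comb R1 // -/t.
  by ring.
have ylow i : (0 < i < n)%N -> 2 * t <= B y (x i).
  move=> i_n; have /andP[+ _] := next_window_bounds adm i_n.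
  have /andP[_ /(admissible_ge3 adm)] := i_n; rewrite -/t -/y.
  by nra.
have yE i j : (0 < i < j)%N -> (j <= n)%N -> B y (x j) + 3 <= B y (x i).
  move=> /andP[i0 ij]; rewrite leq_eqVlt => /orP[/eqP jn|j_n].
    have i_n : (i < n)%N by rewrite -jn.
    by have := ylow i; rewrite jn yn i0 i_n => /(_ isT); lra.
  have /andP[+ _] := next_window_bounds adm (ltac:(lia) : (0 < i < n)%N).
  have /andP[_ +] := next_window_bounds adm (ltac:(lia) : (0 < j < n)%N).
  by have := E1 i j (ltac:(lia)); rewrite -/t -/y; nra.
have y1 : t <= B y (x 1%N) by have := ylow 1%N; rewrite n_ge2 => /(_ isT); lra.
split.
- move=> i; rewrite leq_eqVlt => /orP[/eqP->|i_n]; first by rewrite wn.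
  by rewrite wi // R1.
- have yint j : (j <= n)%N -> B y (x j) \is a Num.int.
    by move=> j_n; rewrite nbform_comb; apply: rpredB; [apply: rpredM => //|]; apply: R2.
  have lt_n i : i <> n -> (i <= n)%N -> (i < n)%N by lia.
  move=> i j; have [->|/eqP/lt_n i_n] := eqVneq i n;
    have [->|/eqP/lt_n j_n] := eqVneq j n => hi hj; rewrite ?wn ?wi ?i_n ?j_n //.
  + by rewrite yy; exact: natr_int.
  + by apply: yint; apply: j_n.
  + by rewrite nbformC; apply: yint; apply: i_n.
  + by apply: R2; [apply: i_n|apply: j_n].
- move=> c wc; have xc i : (0 < i <= n)%N -> x i *m c = 0.
    by case: i => // i i_n; have := wc i (ltnW i_n); rewrite wi.
  apply: R3 => -[_|i i_n]; last exact: xc.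
  have xn : x n *m c = 0 by apply: xc; rewrite n0 leqnn.
  have := wc n (leqnn n); rewrite wn /y mulmxBl -scalemxAl xn.
  by rewrite scaler0 sub0r => /eqP; rewrite oppr_eq0 => /eqP.
- rewrite wn wi //; move=> i j /andP[ji].
  rewrite leq_eqVlt => /orP[/eqP iE|i_n].
    have j_n : (j < n)%N by rewrite -iE.
    rewrite iE wn wi // ger0_norm.
      have [->//|j0] := posnP j.
      by have := yE 1%N j.+1 j0 j_n; lra.
    have [->|j1] := eqVneq j.+1 n; first by rewrite yn; lra.
    by have := ylow j.+1 (ltac:(lia)); lra.
  rewrite !wi ?(ltn_trans ji) //; apply: le_trans y1.
  by apply: D; rewrite ltnS ji.
rewrite wn; split=> [i j /andP[ij j_n]|].
  by rewrite !wi ?(ltn_trans ij) //; apply: yE; lia.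
by rewrite wi ?prednK // ?yn //; lia.
Qed.

End Windows.

Section WindowOrbit.
Context (n : nat) (S : 'M[rat]_n.+1) (e0 : 'rV[rat]_n.+1).
Hypotheses (n_ge2 : (2 <= n)%N) (symS : S^T = S).
Local Notation B := (nbform S e0).

Definition window_orbit (x : nat -> 'rV[rat]_n.+1) (k : nat) : 'rV[rat]_n.+1 :=
  iter k (next_window S e0) x 0%N.

Context (x : nat -> 'rV[rat]_n.+1) (adm : admissible S e0 x).
Local Notation X := (window_orbit x).

Lemma iter_next_window k j : (j <= n)%N ->
  iter k (next_window S e0) x j = X (k + j)%N.
Proof.
elim: j k => [|j IH] k; first by rewrite addn0.
move=> j_n; rewrite addnS -addSn -IH ?(ltnW j_n) // iterS.
by rewrite /next_window j_n.
Qed.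

Lemma iter_admissible k : admissible S e0 (iter k (next_window S e0) x).
Proof. by elim: k => // k IH; rewrite iterS; apply: next_admissible. Qed.

Lemma orbit_init i : (i <= n)%N -> X i = x i.
Proof. by move=> i_n; rewrite -(iter_next_window 0). Qed.

Definition orbit_coef k := B (X (k + n)) (X k).
Local Notation tau := orbit_coef.

Lemma orbit_rec k : X (k + n).+1 = tau k *: X (k + n) - X k.
Proof.
rewrite -addSn -iter_next_window // iterS /next_window ltnn.
by rewrite !iter_next_window // addn0.
Qed.

Lemma orbit_norm k : B (X k) (X k) = 2.
Proof.
have [R1 _ _ _ _] := iter_admissible k.
by have := R1 0%N (leq0n n); rewrite iter_next_window // addn0.
Qed.

Lemma orbit_coef_int k : tau k \is a Num.int.
Proof.
have [_ R2 _ _ _] := iter_admissible k.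
by have := R2 n 0%N (leqnn n) (leq0n n); rewrite !iter_next_window // addn0.
Qed.

Lemma orbit_window_ge3 k i : (i < n)%N -> 3 <= B (X (k + n)) (X (k + i)).
Proof.
move=> i_n; have := admissible_ge3 n_ge2 (iter_admissible k) i_n.
by rewrite !iter_next_window // ltnW.
Qed.

Lemma orbit_coef_ge3 k : 3 <= tau k.
Proof. by have := @orbit_window_ge3 k 0%N; rewrite addn0; apply; lia. Qed.

Lemma orbit_step_bounds k i : (0 < i < n)%N ->
  tau k * (B (X (k + n)) (X (k + i)) - 1)
    <= B (X (k + n).+1) (X (k + i))
    <= tau k * (B (X (k + n)) (X (k + i)) + 1).
Proof.
move=> i_n; have := next_window_bounds symS (iter_admissible k) i_n.
have /andP[_ /ltnW i_n'] := i_n.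
by rewrite orbit_rec /orbit_coef !iter_next_window // addn0.
Qed.

Lemma orbit_consecutive k : B (X (k + n).+1) (X (k + n)) = tau k.
Proof.
rewrite orbit_rec nbform_comb orbit_norm (nbformC e0 symS (X k)) -/(tau k).
by ring.
Qed.

(** The step bound at i = 1 multiplies tau_k by a pairing minus 1, and that pairing is at least
    3. *)
Lemma orbit_coef_double k : 2 * tau k <= tau k.+1.
Proof.
have /andP[+ _] := @orbit_step_bounds k 1%N (ltac:(lia)).
have := @orbit_window_ge3 k 1%N (ltac:(lia)); have := orbit_coef_ge3 k.
by rewrite /orbit_coef addSn addn1; nra.
Qed.

Lemma orbit_coef_exp k : 3 * 2 ^+ k <= tau k.
Proof.
elim: k => [|k IH]; first by rewrite mulr1 orbit_coef_ge3.
by have := orbit_coef_double k; rewrite exprS; lra.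
Qed.

(** The size of X_(k+n) is measured by a fixed linear form, so that heights and vectors satisfy the
    same recurrence. *)
Definition orbit_height k := B (X (k + n)) (X 0%N).
Local Notation L := orbit_height.

Lemma orbit_height_dominates k : 0 < L k /\
  forall j, (j < k + n)%N -> `|B (X j) (X 0%N)| <= L k.
Proof.
elim: k => [|k [L0 IH]].
  have t3 := orbit_coef_ge3 0; rewrite /orbit_coef in t3.
  rewrite /orbit_height; split; first by lra.
  move=> [_|j]; first by rewrite orbit_norm normr_nat; lra.
  rewrite !add0n => j_n; have [_ _ _ D _] := adm.
  by have := D j.+1 0%N; rewrite !orbit_init ?(ltnW j_n) //; apply.
have Lk : L k <= L k.+1.
  rewrite /orbit_height addSn orbit_rec nbform_comb -/(L k).
  have := IH k (ltac:(lia)); rewrite ler_norml => /andP[_].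
  by have := orbit_coef_ge3 k; nra.
split; first by apply: lt_le_trans Lk.
move=> j; rewrite addSn ltnS leq_eqVlt => /orP[/eqP->|/IH/le_trans]; last exact.
by rewrite -/(L k) ger0_norm // ltW.
Qed.

Lemma orbit_height_gt0 k : 0 < L k.
Proof. by have [] := orbit_height_dominates k. Qed.

Lemma orbit_height_bounds k :
  (tau k - 1) * L k <= L k.+1 <= (tau k + 1) * L k.
Proof.
have [_ /(_ k (ltac:(lia)))] := orbit_height_dominates k.
rewrite ler_norml => /andP[h1 h2].
rewrite [L k.+1]/orbit_height addSn orbit_rec nbform_comb -/(L k).
by apply/andP; split; lra.
Qed.

Lemma orbit_height_rec k : L (k + n).+1 = tau (k + n) * L (k + n) - L k.
Proof. by rewrite {1}/orbit_height addSn orbit_rec nbform_comb. Qed.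

Lemma orbit_height_growth k : 2 ^+ k * L k <= L k.+1.
Proof.
have /andP[h _] := orbit_height_bounds k; apply: le_trans h.
rewrite ler_pM2r ?orbit_height_gt0 //.
have := orbit_coef_exp k; have : 1 <= 2 ^+ k :> rat by rewrite exprn_ege1 ?ler1n.
by lra.
Qed.

(** The recurrence can be run backwards: a functional vanishing on all late vectors vanishes on the
    initial ones. *)
Lemma orbit_spans (c : 'cV[rat]_n.+1) K :
  (forall k, (K <= k)%N -> X k *m c = 0) -> c = 0.
Proof.
elim: K => [Xc|K IH Xc].
  have [_ _ R3 _ _] := adm; apply: R3 => i i_n.
  by rewrite -orbit_init // Xc.
apply: IH => k; rewrite leq_eqVlt => /orP[/eqP <-|]; last exact: Xc.
have n0 : (0 < n)%N by lia.
have := Xc (K + n).+1 (ltac:(lia)); rewrite orbit_rec mulmxBl -scalemxAl.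
rewrite (Xc (K + n)%N) ?scaler0 ?sub0r; last by lia.
by move=> /eqP; rewrite oppr_eq0 => /eqP.
Qed.

Lemma orbit_denominator :
  exists2 M : nat, (0 < M)%N & forall k j, M%:R * X k 0 j \is a Num.int.
Proof.
have [M M0 Mx] := common_denominator
  (fun p : 'I_n.+1 * 'I_n.+1 => x p.1 0 p.2).
exists M => // k; have [m] := ubnP k; elim: m k => // m IH k; rewrite ltnS => km j.
have [k_n|n_k] := leqP k n.
  by rewrite orbit_init //; apply: (Mx (Ordinal (k_n : (k < n.+1)%N), j)).
have -> : k = ((k - n.+1) + n).+1 by lia.
rewrite orbit_rec !mxE mulrBr mulrCA.
apply: rpredB; last by apply: IH; lia.
by apply: rpredM; [exact: orbit_coef_int|apply: IH; lia].
Qed.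

End WindowOrbit.

(** * Logarithmic growth of the orbit *)

(** Since s >= 2, b >= a / 2; then ln u - ln v <= (u - v) / v is applied in both directions. *)
Lemma ln_close (R : realType) (a b s : R) : 0 < a -> 2 <= s ->
  `|b - a| * s <= a -> `|ln b - ln a| <= 2 / s.
Proof.
move=> a0 s2 h; have s0 : 0 < s by lra.
have {h} h : `|b - a| <= a / s by rewrite ler_pdivlMr.
have as2 : a / s <= a / 2 by rewrite ler_pM2l // lef_pV2 ?posrE //; lra.
move: (h); rewrite ler_norml => /andP[h1 h2].
have b2 : a / 2 <= b by lra.
have b0 : 0 < b by lra.
have lnB (u v : R) : 0 < u -> 0 < v -> ln u - ln v <= (u - v) / v.
  move=> u0 v0; rewrite -ln_div ?posrE //.
  have -> : u / v = 1 + (u - v) / v by field; rewrite gt_eqF.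
  apply: le_ln1Dx; rewrite ltr_pdivlMr //; lra.
have sV : 0 <= s^-1 by rewrite invr_ge0; lra.
rewrite ler_norml; apply/andP; split.
  rewrite lerNl opprB; apply: le_trans (lnB _ _ a0 b0) _.
  rewrite ler_pdivrMr // mulrAC.
  move: h1 sV; clear -b2; set u := s^-1 => h1 sV; nra.
apply: le_trans (lnB _ _ b0 a0) _.
rewrite ler_pdivrMr //; move: h2 sV; clear -a0; set u := s^-1 => h2 sV; nra.
Qed.

Lemma ler_norm3 (R : numDomainType) (a b c A B C : R) :
  `|a| <= A -> `|b| <= B -> `|c| <= C -> `|a + b - c| <= A + B + C.
Proof.
move=> aA bB cC; apply: le_trans (ler_normB _ _) (lerD _ cC).
exact: le_trans (ler_normD _ _) (lerD aA bB).
Qed.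

Section OrbitGrowth.
Context (R : realType) (n : nat) (S : 'M[rat]_n.+1) (e0 : 'rV[rat]_n.+1).
Hypotheses (n_ge2 : (2 <= n)%N) (symS : S^T = S).
Local Notation B := (nbform S e0).
Context (x : nat -> 'rV[rat]_n.+1) (adm : admissible S e0 x).
Local Notation X := (window_orbit S e0 x).
Local Notation tau := (orbit_coef S e0 x).
Local Notation L := (orbit_height S e0 x).
Local Notation lnr y := (ln (ratr y : R)).

Lemma ln_ratr_close (a b c s : rat) : 0 < a -> 0 < b -> 2 <= s ->
  `|c - a * b| * s <= a * b -> `|lnr c - lnr b - lnr a| <= 2 / ratr s.
Proof.
move=> a0 b0 s2 h.
have : `|lnr c - ln (ratr (a * b))| <= 2 / ratr s.
  apply: ln_close; rewrite ?ltr0q ?mulr_gt0 //.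
    by rewrite -(ratr_nat R 2) ler_rat.
  by rewrite -rmorphB -ratr_norm -rmorphM ler_rat.
have -> : lnr (a * b) = lnr a + lnr b.
  by rewrite -lnM ?posrE ?ltr0q // -rmorphM.
by rewrite opprD addrCA addrC.
Qed.

Lemma orbit_coef_gt0 k : 0 < tau k.
Proof. by have := orbit_coef_ge3 n_ge2 symS adm k; lra. Qed.

Lemma orbit_coef_mono k l : (k <= l)%N -> tau k <= tau l.
Proof.
move=> /subnK <-; elim: (l - k)%N => // m IH; rewrite addSn.
have := orbit_coef_double n_ge2 symS adm (m + k).
by have := orbit_coef_gt0 (m + k); lra.
Qed.

Lemma orbit_height_ln k :
  `|lnr (L k.+1) - lnr (L k) - lnr (tau k)| <= 2 / ratr (tau k).
Proof.
have := orbit_coef_ge3 n_ge2 symS adm k.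
have := orbit_height_gt0 n_ge2 symS adm k.
have /andP[h1 h2] := orbit_height_bounds n_ge2 symS adm k.
move=> L0 t3; apply: ln_ratr_close; [lra|lra|lra|].
rewrite mulrC ler_wpM2l; [by []|by lra|].
by rewrite ler_norml; apply/andP; split; lra.
Qed.

Lemma orbit_pairing_ge k i : (0 < i <= n)%N ->
  tau k <= B (X (k + n).+1) (X (k + i)).
Proof.
move=> /andP[i0]; have [-> _|ni i_n] := eqVneq i n.
  by rewrite orbit_consecutive.
have i_n' : (i < n)%N by rewrite ltn_neqAle ni.
have i1 : (0 < i < n)%N by rewrite i0.
have /andP[+ _] := orbit_step_bounds n_ge2 symS adm k i1.
have := orbit_window_ge3 n_ge2 symS adm k i_n'.
by have := orbit_coef_gt0 k; nra.
Qed.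

(* When [m] grows by one, the pairing with [X (j + n)] and the height are both
   multiplied by almost the same [tau]. *)
Lemma orbit_pairing_ln j m : (m < n)%N ->
  `|lnr (B (X (j + m + n).+1) (X (j + n)))
     - (lnr (L (j + m).+1) - lnr (L j.+1)) - lnr (tau j)|
    <= (4 * m)%:R / ratr (tau j).
Proof.
elim: m => [|m IH] m_n.
  rewrite addn0 orbit_consecutive // subrr subr0 subrr normr0.
  by rewrite muln0 mul0r.
have {}IH := IH (ltnW m_n).
have t0 := orbit_coef_gt0 j.
have e1 := orbit_height_ln (j + m).+1.
have tj : tau j <= tau (j + m) by rewrite orbit_coef_mono // leq_addr.
have im : (0 < n - m.+1 < n)%N by lia.
set b := B (X (j + m + n).+1) (X (j + n)) in IH.
have bE : b = B (X ((j + m).+1 + n)) (X ((j + m).+1 + (n - m.+1))).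
  by rewrite /b addSn; congr (B _ (X _)); lia.
have b_ge : tau j <= b.
  apply: le_trans tj _; rewrite /b.
  have -> : (j + n = j + m + (n - m))%N by lia.
  by apply: orbit_pairing_ge; lia.
have b3 : 3 <= b by rewrite bE; apply: orbit_window_ge3 => //; lia.
have e2 : `|lnr (B (X (j + m.+1 + n).+1) (X (j + n))) - lnr b
    - lnr (tau (j + m).+1)| <= 2 / ratr b.
  have /andP[] := orbit_step_bounds n_ge2 symS adm (j + m).+1 im.
  rewrite -bE addnS; have -> : ((j + m).+1 + (n - m.+1) = j + n)%N by lia.
  move=> h1 h2; have t1 := orbit_coef_gt0 (j + m).+1.
  apply: ln_ratr_close; [lra|lra|lra|].
  rewrite ler_wpM2r //; first by lra.
  by rewrite ler_norml; apply/andP; split; lra.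
have V (u : rat) : tau j <= u -> 2 / ratr u <= 2 / ratr (tau j) :> R.
  move=> u_ge; rewrite ler_pM2l // lef_pV2 ?posrE ?ltr0q ?ler_rat //.
  by lra.
have {}e1 := le_trans e1 (V _ (le_trans tj (orbit_coef_mono (leqnSn _)))).
have {}e2 := le_trans e2 (V _ b_ge).
have -> : (4 * m.+1)%:R / ratr (tau j) =
    (4 * m)%:R / ratr (tau j) + 2 / ratr (tau j) + 2 / ratr (tau j) :> R.
  by rewrite -!mulrDl -!natrD; congr (_%:R / _); lia.
have combine (p p' q q' r t t' c c' c'' : R) :
    `|p - (q - r) - t| <= c -> `|p' - p - t'| <= c' -> `|q' - q - t'| <= c'' ->
    `|p' - (q' - r) - t| <= c + c' + c''.
  move=> h h' h''.
  have -> : p' - (q' - r) - t = (p - (q - r) - t) + (p' - p - t') - (q' - q - t').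
    by ring.
  exact: ler_norm3.
by apply: combine IH e2 _; rewrite addnS.
Qed.

(** For m = n - 1 the pairing in [orbit_pairing_ln] is tau_(j+n), so tau_(j+n) is close to tau_j
    L_(j+n) / L_(j+1). As L_(j+1) is close to tau_j L_j and L_(j+n+1) to tau_(j+n) L_(j+n), the
    product L_(j+n+1) L_j is close to L_(j+n)^2. *)
Lemma orbit_height_second_difference j :
  `|lnr (L (j + n).+1) + lnr (L j) - 2 * lnr (L (j + n))|
    <= (4 * n)%:R / 2 ^+ j.
Proof.
have t0 := orbit_coef_gt0 j.
have n0 : (n.-1 < n)%N by lia.
have e1 := orbit_pairing_ln j n0.
have nE : (j + n.-1).+1 = (j + n)%N by lia.
rewrite nE -addSn nE -/(tau (j + n)) in e1.
have e2 := orbit_height_ln j; have e3 := orbit_height_ln (j + n).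
have tj : tau j <= tau (j + n) by rewrite orbit_coef_mono // leq_addr.
have {}e3 : `|lnr (L (j + n).+1) - lnr (L (j + n)) - lnr (tau (j + n))|
    <= 2 / ratr (tau j).
  apply: le_trans e3 _.
  rewrite ler_pM2l // lef_pV2 ?posrE ?ltr0q ?ler_rat //.
  exact: orbit_coef_gt0.
apply: (@le_trans _ _ ((4 * n)%:R / ratr (tau j))); last first.
  rewrite ler_wpM2l // lef_pV2 ?posrE ?ltr0q ?exprn_gt0 //.
  have -> : (2 : R) ^+ j = ratr (2 ^+ j) by rewrite rmorphXn /= ratr_nat.
  have := orbit_coef_exp n_ge2 symS adm j; rewrite ler_rat.
  have : 0 < 2 ^+ j :> rat by rewrite exprn_gt0.
  by lra.
have -> : (4 * n)%:R / ratr (tau j) =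
    2 / ratr (tau j) + (4 * n.-1)%:R / ratr (tau j) + 2 / ratr (tau j) :> R.
  by rewrite -!mulrDl -!natrD; congr (_%:R / _); lia.
have combine (p q r u t t' c c' c'' : R) :
    `|p - q - t'| <= c -> `|t' - (q - r) - t| <= c' -> `|r - u - t| <= c'' ->
    `|p + u - 2 * q| <= c + c' + c''.
  move=> h h' h''.
  have -> : p + u - 2 * q = (p - q - t') + (t' - (q - r) - t) - (r - u - t) by ring.
  exact: ler_norm3.
exact: combine e3 e1 e2.
Qed.

End OrbitGrowth.

(** * Height sequences *)

(** Step k costs a factor exp(K / 2^k), and the product of all these factors is at most exp(2 K). *)
Lemma summable_errors_bounded (R : realType) (U : nat -> R) (K : R) (n : nat) :
    0 <= K ->
    (forall k A, 0 < A -> (forall j, (k <= j < k + n)%N -> U j <= A) ->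
       U (k + n)%N <= expR (K / 2 ^+ k) * A) ->
  exists2 A, 0 < A & forall j, U j <= A.
Proof.
move=> K0 step; pose A0 := 1 + \sum_(j < n) `|U j|.
have A0_gt0 : 0 < A0 by rewrite ltr_wpDr // sumr_ge0.
have key k : forall j, (j < k + n)%N -> U j <= expR (K * (2 - 2 / 2 ^+ k)) * A0.
  elim: k => [|k IH] j.
    rewrite add0n expr0 divr1 subrr mulr0 expR0 mul1r => j_n.
    rewrite /A0 (bigD1 (Ordinal j_n)) //= addrCA.
    apply: le_trans (ler_norm _) _; rewrite lerDl addr_ge0 ?sumr_ge0 //.
  pose A := expR (K * (2 - 2 / 2 ^+ k)) * A0.
  have A_gt0 : 0 < A by rewrite mulr_gt0 ?expR_gt0.
  have AE : expR (K / 2 ^+ k) * A = expR (K * (2 - 2 / 2 ^+ k.+1)) * A0.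
    rewrite /A mulrA -expRD; congr (expR _ * _).
    by rewrite exprS; field; rewrite expf_neq0.
  rewrite addSn ltnS; have [j_lt _|j_ge j_le] := ltnP j (k + n).
    apply: le_trans (IH j j_lt) _; rewrite -/A -AE ler_peMl ?(ltW A_gt0) //.
    by rewrite -expR0 ler_expR mulr_ge0 // invr_ge0 exprn_ge0.
  have -> : j = (k + n)%N by lia.
  rewrite -AE; apply: step => // i /andP[_]; exact: IH.
exists (expR (K * 2) * A0); first by rewrite mulr_gt0 ?expR_gt0.
move=> j; apply: le_trans (key j.+1 j _) _; first by lia.
rewrite ler_wpM2r ?(ltW A0_gt0) // ler_expR ler_wpM2l // lerBlDr lerDl.
by rewrite divr_ge0 ?exprn_ge0.
Qed.

Lemma nested_intervals (R : realType) (a b : nat -> R) :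
    (forall k, a k <= a k.+1) -> (forall k, b k.+1 <= b k) ->
    (forall k, a k <= b k) ->
  exists phi, forall k, a k <= phi <= b k.
Proof.
move=> a_mono b_mono ab.
have a_le k m : a k <= a (k + m)%N.
  by elim: m => [|m IH]; rewrite ?addn0 // addnS; apply: le_trans IH _.
have b_le k m : b (k + m)%N <= b k.
  by elim: m => [|m IH]; rewrite ?addn0 // addnS; apply: le_trans IH.
have abE k l : a k <= b l.
  apply: le_trans (a_le k l) _; apply: le_trans (ab _) _.
  by rewrite addnC.
have ubA l : ubound [set a k | k in [set: nat]] (b l) by move=> _ [k _ <-]; exact: abE.
exists (sup [set a k | k in [set: nat]]) => k; apply/andP; split.
  by apply: ub_le_sup; [exists (b 0%N)|exists k].
by apply: ge_sup => //; exists (a 0%N), 0%N.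
Qed.

Section HeightSequence.
Context (R : realType) (n : nat) (L : nat -> R) (K : R).
Hypotheses (n_gt0 : (0 < n)%N) (K0 : 0 <= K) (L0 : forall k, 0 < L k).
Hypothesis L_growth : forall k, 2 ^+ k * L k <= L k.+1.
Hypothesis L_second_difference : forall k,
  `|ln (L (k + n).+1) + ln (L k) - 2 * ln (L (k + n))| <= K / 2 ^+ k.

Lemma height_mono k l : (k <= l)%N -> L k <= L l.
Proof.
move=> /subnK <-; elim: (l - k)%N => // m IH; rewrite addSn.
apply: le_trans IH (le_trans _ (L_growth _)).
by rewrite ler_peMl ?(ltW (L0 _)) // exprn_ege1 // ler1n.
Qed.

Lemma height_ratio k l : (k < l)%N -> 2 ^+ k * L k <= L l.
Proof. by move=> kl; apply: le_trans (L_growth k) (height_mono kl). Qed.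

(** After taking logarithms the claim is that w_k = ln L_(k+1) - rho ln L_k is bounded above. *)
Lemma height_growth_exponent (rho : R) :
    1 < rho -> rho < 2 -> rho ^+ n = \sum_(i < n) rho ^+ i ->
  exists2 C, 0 < C & forall k, L k.+1 <= C * L k `^ rho.
Proof.
move=> rho1 rho2 rhoE.
have rho0 : 0 < rho by lra.
(* The equation of rho multiplied by rho - 1. *)
have rhoV : (2 - rho) * rho ^+ n = 1.
  by have := subrX1 rho n; rewrite -rhoE => h; lra.
(* Since [(2 - rho) rho^n = 1], [w (k + n)] is a weighted mean of
   [w k], ..., [w (k + n - 1)] up to a summable error. *)
pose y k := ln (L k); pose w k := y k.+1 - rho * y k.
have telescope_w a m : y (a + m)%N - rho ^+ m * y a =
    \sum_(j < m) rho ^+ (m.-1 - j) * w (a + j)%N.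
  elim: m => [|m IH]; first by rewrite big_ord0 addn0 expr0 mul1r subrr.
  rewrite big_ord_recr /= subnn expr0 mul1r.
  have -> : \sum_(i < m) rho ^+ (m - i) * w (a + i)%N =
      rho * \sum_(j < m) rho ^+ (m.-1 - j) * w (a + j)%N.
    rewrite mulr_sumr; apply: eq_bigr => i _; rewrite mulrA -exprS.
    by congr (rho ^+ _ * _); have := ltn_ord i; lia.
  by rewrite -IH /w addnS exprS; ring.
have [A A0 wA] : exists2 A, 0 < A & forall k, expR (w k) <= A.
  apply: (@summable_errors_bounded R _ K n K0) => k A A0 wA.
  have lnA j : (j < n)%N -> w (k + j)%N <= ln A.
    move=> j_n; rewrite -(expRK (w _)) ler_ln ?posrE ?expR_gt0 //.
    by apply: wA; lia.
  rewrite -[X in _ * X](lnK (A0 : A \in Num.pos)) -expRD ler_expR.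
  have := L_second_difference k; rewrite ler_norml => /andP[_ eta].
  have -> : w (k + n)%N = (y (k + n).+1 + y k - 2 * y (k + n)%N)
      + (2 - rho) * (y (k + n)%N - rho ^+ n * y k).
    by rewrite mulrBr mulrA rhoV /w; ring.
  apply: lerD => //; rewrite telescope_w.
  have -> : ln A = (2 - rho) * (rho ^+ n * ln A) by rewrite mulrA rhoV mul1r.
  rewrite ler_pM2l; last by lra.
  rewrite rhoE mulr_suml [X in _ <= X](reindex_inj rev_ord_inj) /=.
  apply: ler_sum => j _; have -> : (n - j.+1 = n.-1 - j)%N by lia.
  by rewrite ler_pM2l ?exprn_gt0 // lnA.
exists A => // k; have := wA k; rewrite /w /powR gt_eqF // expRD expRN.
rewrite lnK ?posrE // ler_pdivrMr ?expR_gt0 //.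
Qed.

(** The quotients g = f / L of two solutions of the recurrence have differences O(1 / L_k^2), so
    they converge to some phi with |g_k - phi| = O(1 / L_k^2). *)
Lemma recurrence_converges (tau f : nat -> R) :
    (forall k, L (k + n).+1 = tau k * L (k + n) - L k) ->
    (forall k, f (k + n).+1 = tau k * f (k + n) - f k) ->
  exists phi C, forall k, (0 < k)%N -> `|f k - L k * phi| <= C / L k.
Proof.
move=> L_rec f_rec.
pose g k : R := f k / L k; pose s k : R := `|g k.+1 - g k|.
(* The main term in the bound for [s (k + n)] is [s k], with the factor
   [L k / L (k + n).+1], which is almost [(L k / L (k + n))^2]. *)
pose U k : R := s k * L k ^+ 2.
have gE k : f k = L k * g k by rewrite /g mulrC divfK ?gt_eqF.
have U_ge0 k : 0 <= U k by rewrite mulr_ge0 ?normr_ge0 ?sqr_ge0.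
have sE k : s k = U k / L k ^+ 2 by rewrite /U mulfK // expf_neq0 // gt_eqF.
have g_dist a m : `|g (a + m)%N - g a| <= \sum_(j < m) s (a + j)%N.
  elim: m => [|m IH]; first by rewrite addn0 subrr normr0 big_ord0.
  rewrite big_ord_recr /= addnS; apply: le_trans (lerD IH (lexx _)).
  by rewrite [leRHS]addrC /s; apply: le_trans (ler_normD _ _); rewrite subrKA.
have s_step k : s (k + n)%N = L k / L (k + n).+1 * `|g (k + n)%N - g k|.
  have L1 := L0 (k + n).+1.
  have := f_rec k; rewrite !gE [in LHS]mulrC => /(canRL (mulfK (lt0r_neq0 L1))).
  move=> gS; rewrite -[L k / _]gtr0_norm ?divr_gt0 // -normrM /s gS.
  congr `|_|; rewrite L_rec; field.
  by rewrite -L_rec gt_eqF.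
have [A A0 UA] : exists2 A, 0 < A & forall k, U k <= A.
  (* K comes from the second difference, n from the n - 1 terms with j > 0, each at most A / 2^k. *)
  apply: (@summable_errors_bounded R _ (K + n%:R) n); first by rewrite addr_ge0.
  move=> k A A0 UA.
  have Lkn := L0 (k + n); have Lk := L0 k; have LS := L0 (k + n).+1.
  have UE : U (k + n)%N =
      (L (k + n) ^+ 2 / (L (k + n).+1 * L k)) * (L k ^+ 2 * `|g (k + n)%N - g k|).
    by rewrite /U s_step; field; rewrite !gt_eqF.
  rewrite UE mulrDl expRD -[leRHS]mulrA; apply: ler_pM.
  - by rewrite divr_ge0 ?sqr_ge0 // mulr_ge0 ?ltW.
  - by rewrite mulr_ge0 ?sqr_ge0.
  - rewrite -ler_ln ?posrE ?divr_gt0 ?mulr_gt0 ?exprn_gt0 ?expR_gt0 //.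
    rewrite expRK ln_div ?posrE ?mulr_gt0 ?exprn_gt0 // lnM ?posrE // lnXn //.
    have := L_second_difference k; rewrite ler_norml => /andP[+ _].
    by rewrite -mulr_natl; lra.
  apply: (@le_trans _ _ ((1 + n%:R / 2 ^+ k) * A)); last first.
    by rewrite ler_wpM2r ?(ltW A0) // expR_ge1Dx.
  have term j : (j < n)%N -> L k ^+ 2 * s (k + j)%N <= A * (L k ^+ 2 / L (k + j) ^+ 2).
    move=> j_n; rewrite sE mulrCA ler_pM2r ?divr_gt0 ?exprn_gt0 //.
    by apply: UA; lia.
  have small j : (0 < j)%N -> L k ^+ 2 / L (k + j) ^+ 2 <= (2 ^+ k)^-1.
    move=> j0; have h : 2 ^+ k * L k <= L (k + j) by rewrite height_ratio //; lia.
    have h' : L k <= L (k + j) by rewrite height_mono // leq_addr.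
    rewrite ler_pdivrMr ?exprn_gt0 // ler_pdivlMl ?exprn_gt0 //.
    by rewrite !expr2 mulrA; apply: ler_pM => //; rewrite ?mulr_ge0 ?exprn_ge0 ?ltW.
  apply: le_trans (ler_wpM2l (sqr_ge0 _) (g_dist k n)) _.
  rewrite mulr_sumr -(prednK n_gt0) big_ord_recl /=.
  rewrite mulrDl mul1r; apply: lerD.
    by have := term 0%N n_gt0; rewrite addn0 divff ?mulr1 // expf_neq0 // gt_eqF.
  apply: (@le_trans _ _ (\sum_(j < n.-1) A / 2 ^+ k)).
    apply: ler_sum => j _; have jn : (j.+1 < n)%N by have := ltn_ord j; lia.
    apply: le_trans (term _ jn) _; rewrite ler_pM2l //.
    exact: small.
  rewrite sumr_const card_ord -[_ *+ n.-1]mulr_natl -[leRHS]mulrA.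
  rewrite [_^-1 * A]mulrC ler_pM2r ?divr_gt0 ?exprn_gt0 // ler_nat; lia.
(* The intervals of radius V_k around g_k are nested, since s_k <= V_k / 2 and V_(k+1) <= V_k / 2.
   They start at index 1: at index 0 the growth factor 2^0 gives no halving. *)
pose V k : R := 2 * A / L k ^+ 2.
have V_half k : V k.+2 <= V k.+1 / 2.
  have h : 2 * L k.+1 <= L k.+2.
    apply: le_trans (L_growth _); rewrite ler_pM2r //.
    by rewrite exprS ler_peMr // exprn_ege1 // ler1n.
  rewrite /V -[leRHS]mulrA ler_pM2l ?mulr_gt0 //.
  rewrite -invfM lef_pV2 ?posrE ?mulr_gt0 ?exprn_gt0 //.
  by have := L0 k.+1; rewrite !expr2; nra.
have s_le k : s k <= V k / 2.
  have -> : V k / 2 = A / L k ^+ 2 by rewrite /V; field; rewrite gt_eqF.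
  by rewrite sE ler_pM2r ?invr_gt0 ?exprn_gt0.
have [| | |phi phiP] := @nested_intervals R (fun k => g k.+1 - V k.+1)
    (fun k => g k.+1 + V k.+1).
- move=> k; have := s_le k.+1; rewrite ler_norml => /andP[h _].
  by have := V_half k; lra.
- move=> k; have := s_le k.+1; rewrite ler_norml => /andP[_ h].
  by have := V_half k; lra.
- move=> k; have : 0 <= V k.+1 by rewrite divr_ge0 ?sqr_ge0 // mulr_ge0 ?ltW.
  by lra.
exists phi, (2 * A) => -[//|k] _; have /andP[h1 h2] := phiP k.
have -> : f k.+1 - L k.+1 * phi = L k.+1 * (g k.+1 - phi) by rewrite gE; ring.
rewrite normrM gtr0_norm //.
have -> : 2 * A / L k.+1 = L k.+1 * V k.+1 by rewrite /V; field; rewrite gt_eqF.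
by rewrite ler_pM2l // ler_norml; apply/andP; split; lra.
Qed.

End HeightSequence.

(** * The limit point and its reflections *)

(** Approximation data free of projective points and of minima, so that rational matrices can
    transport it. The growth condition limits the gaps between successive heights. *)
Definition well_approximable (R : realType) n (rho : R) (v : 'rV[R]_n.+1) :=
  exists (L : nat -> R) (Y : nat -> 'rV[rat]_n.+1) (C : R) (M : nat),
  [/\ forall k, 1 <= L k /\ L k.+1 <= C * L k `^ rho,
      forall B, exists k, B < L k,
      (0 < M)%N /\ forall k i, M%:R * Y k 0 i \is a Num.int,
      forall k, Y k != 0 &
      forall k, l1 (map_mx ratr (Y k) - L k *: v) <= C / L k].

(** For E L_k <= X < E L_(k+1) the vector z_k is allowed. Its distance is at most F / L_k, and
    X^(1/rho) is at most a constant times L_k. *)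
Lemma well_approximable_limsup (R : realType) n (rho : R)
    (xi : proj_space R n) (v : 'rV[R]_n.+1) :
    0 < rho -> represents v xi -> well_approximable rho v ->
  (limf_esup (fun X : R => (X `^ (1 / rho) * Dmin xi X)%:E) (pinfty_nbhs R)
     < +oo)%E.
Proof.
move=> rho0 vrep [L [Y [C [M [Lgrow Linf [M0 Yint] Y0 Yv]]]]].
have L0 k : 0 < L k by have [+ _] := Lgrow k; lra.
have C0 : 0 <= C.
  have := le_trans (l1_ge0 _) (Yv 0%N).
  by rewrite pmulr_lge0 // invr_gt0.
have M0' : 0 < M%:R :> R by rewrite ltr0n.
pose z k : 'rV[int]_n.+1 := \row_i Num.floor (M%:R * Y k 0 i).
have zE k : int_vec R (z k) = M%:R *: map_mx ratr (Y k).
  apply/rowP => i; rewrite !mxE -ratr_int floorK //.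
  by rewrite -(ratr_nat R M) -rmorphM.
have z0 k : z k != 0.
  apply: contra_neq (Y0 k) => zk; apply/rowP => i; rewrite mxE.
  have /rowP/(_ i) := zE k; rewrite zk !mxE => /esym/eqP.
  by rewrite mulf_eq0 gt_eqF //= fmorph_eq0 => /eqP.
have v0 : 0 < eucl_norm v by apply: eucl_norm_gt0; have [] := vrep.
pose E := n.+1%:R * (M%:R * (C + l1 v)) + 1.
have E0 : 0 < E by rewrite ltr_wpDl // !mulr_ge0 ?addr_ge0 ?l1_ge0.
have znorm k : eucl_norm (int_vec R (z k)) <= E * L k.
  have [L1 _] := Lgrow k.
  apply: le_trans (eucl_norm_le_l1 _) _.
  apply: (@le_trans _ _ (n.+1%:R * (M%:R * (C + l1 v)) * L k)); last first.
    by rewrite /E [in leRHS]mulrDl mul1r lerDl ltW.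
  rewrite -mulrA ler_pM2l // zE l1Z ger0_norm ?(ltW M0') // -mulrA ler_pM2l //.
  rewrite -[map_mx _ _](subrK (L k *: v)); apply: le_trans (l1D _ _) _.
  rewrite mulrDl lerD //; last by rewrite l1Z gtr0_norm // mulrC.
  apply: le_trans (Yv k) _; rewrite ler_pdivrMr // -mulrA ler_peMr //.
  by rewrite -expr2 exprn_ege1.
pose F := (n.+1 * n.+1)%:R * (2 * l1 v * (M%:R * C)) / eucl_norm v.
have F0 : 0 <= F by rewrite divr_ge0 ?(ltW v0) // !mulr_ge0 ?l1_ge0.
have zdist k : Dpt xi (int_vec R (z k)) <= F / L k.
  rewrite (Dpt_rep _ vrep) /F mulrAC ler_pM2r ?invr_gt0 //.
  apply: le_trans (wedge_norm_le _ _ (M%:R * L k)) _.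
  rewrite -!mulrA ler_wpM2l // ler_wpM2l // ler_wpM2l ?l1_ge0 //.
  rewrite zE -scalerA -scalerBr l1Z ger0_norm ?(ltW M0') //.
  by rewrite ler_pM2l.
pose b := F * (E * C) `^ (1 / rho).
apply: (@limf_esup_lty _ _ b (Num.max 1 (E * L 0%N))) => X.
rewrite gt_max => /andP[X1 XL].
have ex_k : exists k, X < E * L k.
  by have [k kP] := Linf (X / E); exists k; rewrite mulrC -ltr_pdivrMr.
case: (ex_minnP ex_k) => -[|k] Xk kmin; first by lra.
have Xk' : E * L k <= X by rewrite leNgt; apply/negP => /kmin; rewrite ltnn.
have [_ /(_ (z k) (z0 k) (le_trans (znorm k) Xk')) Dle] :=
  Dmin_attained xi (ltW X1).
have {}Dle := le_trans Dle (zdist k).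
apply: le_trans (ler_wpM2l (powR_ge0 _ _) Dle) _.
have [_ Lk] := Lgrow k.
have XE : X <= E * C * L k `^ rho.
  by apply: le_trans (ltW Xk) _; rewrite -mulrA ler_pM2l.
have -> : b = (E * C) `^ (1 / rho) * L k * (F / L k).
  by rewrite /b; field; rewrite gt_eqF.
have FL : 0 <= F / L k by rewrite mulr_ge0 // invr_ge0 ltW.
rewrite ler_wpM2r //.
have EC : 0 <= E * C by rewrite mulr_ge0 // ltW.
have -> : (E * C) `^ (1 / rho) * L k = (E * C * L k `^ rho) `^ (1 / rho).
  rewrite (powRM _ EC (powR_ge0 _ _)) -(powRrM (L k)).
  by rewrite mul1r divff ?gt_eqF // powRr1 // ltW.
apply: ge0_ler_powR => //.
- by rewrite mul1r invr_ge0 ltW.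
- by rewrite nnegrE; lra.
by rewrite nnegrE mulr_ge0 ?powR_ge0.
Qed.

Lemma l1_mulmx (R : realDomainType) n (P : 'M[R]_n) :
  exists2 K, 0 <= K & forall v, l1 (v *m P) <= K * l1 v.
Proof.
exists (\sum_i \sum_j `|P i j|) => [|v]; first by do 2!apply: sumr_ge0 => ? _.
rewrite exchange_big mulr_suml; apply: ler_sum => j _ /=.
have -> : (v *m P) 0 j = \sum_i P i j * v 0 i.
  by rewrite mxE; apply: eq_bigr => i _; rewrite mulrC.
exact: sum_mul_le_l1.
Qed.

Lemma well_approximable_mul (R : realType) n (rho : R) (v : 'rV[R]_n.+1)
    (P : 'M[rat]_n.+1) : P \in unitmx ->
  well_approximable rho v -> well_approximable rho (v *m map_mx ratr P).
Proof.
move=> unitP [L [Y [C [M [Lgrow Linf [M0 Yint] Y0 Yv]]]]].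
have [N N0 NP] := common_denominator (fun p : 'I_n.+1 * 'I_n.+1 => P p.1 p.2).
have [K K0 KP] := l1_mulmx (map_mx ratr P : 'M[R]_n.+1).
have L0 k : 0 < L k by have [+ _] := Lgrow k; lra.
have C0 : 0 <= C.
  have := le_trans (l1_ge0 _) (Yv 0%N).
  by rewrite pmulr_lge0 // invr_gt0.
(* One constant serves both the growth and the distance, hence K + 1 rather than K. *)
exists L, (fun k => Y k *m P), ((K + 1) * C), (M * N)%N; split=> //.
- move=> k; have [L1 LS] := Lgrow k; split=> //; apply: le_trans LS _.
  rewrite -mulrA ler_peMl ?mulr_ge0 ?powR_ge0 //; lra.
- split; first by rewrite muln_gt0 M0.
  move=> k i; rewrite mxE mulr_sumr; apply: rpred_sum => j _.
  rewrite natrM mulrACA; apply: rpredM; first exact: Yint.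
  exact: (NP (j, i)).
- by move=> k; apply: contra_neq (Y0 k) => YP; rewrite -(mulmxK unitP (Y k)) YP mul0mx.
move=> k; rewrite map_mxM scalemxAl -mulmxBl; apply: le_trans (KP _) _.
apply: le_trans (ler_wpM2l K0 (Yv k)) _.
by rewrite mulrA ler_pM2r ?invr_gt0 // ler_wpM2r //; lra.
Qed.

Section OrbitLimit.
Context (R : realType) (n : nat) (S : 'M[int]_n.+1) (e0 : 'rV[rat]_n.+1).
Hypotheses (n_ge2 : (2 <= n)%N) (symS : S^T = S).

Let SQ : 'M[rat]_n.+1 := map_mx intr S.
Let SR : 'M[R]_n.+1 := map_mx intr S.

Let SRE : SR = map_mx ratr SQ.
Proof. exact: map_intr_ratr. Qed.

Let symSQ : SQ^T = SQ. Proof. by rewrite map_trmx symS. Qed.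
Let symSR : SR^T = SR. Proof. by rewrite map_trmx symS. Qed.

Context (x : nat -> 'rV[rat]_n.+1) (adm : admissible SQ e0 x).
Context (rho : R).
Hypotheses (rho1 : 1 < rho) (rho2 : rho < 2).
Hypothesis rhoE : rho ^+ n = \sum_(i < n) rho ^+ i.
Local Notation X := (window_orbit SQ e0 x).
Local Notation tau := (orbit_coef SQ e0 x).

Let L k : R := ratr (orbit_height SQ e0 x k).
Let Y k : 'rV[R]_n.+1 := map_mx ratr (X (k + n)).

Let n_gt0 : (0 < n)%N. Proof. by lia. Qed.

Let K0 : 0 <= (4 * n)%:R :> R. Proof. by []. Qed.

Let L0 k : 0 < L k.
Proof. by rewrite ltr0q; apply: orbit_height_gt0. Qed.

Let L_growth k : 2 ^+ k * L k <= L k.+1.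
Proof.
have -> : (2 : R) ^+ k = ratr (2 ^+ k) by rewrite rmorphXn /= ratr_nat.
by rewrite -rmorphM ler_rat; apply: orbit_height_growth.
Qed.

Let L_second_difference k :
  `|ln (L (k + n).+1) + ln (L k) - 2 * ln (L (k + n))| <= (4 * n)%:R / 2 ^+ k.
Proof. exact: orbit_height_second_difference. Qed.

Let L_rec k : L (k + n).+1 = ratr (tau (k + n)) * L (k + n) - L k.
Proof. by rewrite /L orbit_height_rec // rmorphB rmorphM. Qed.

Let L_ge1 k : 1 <= L k.
Proof.
apply: le_trans (height_mono L0 L_growth (leq0n k)).
rewrite -[1](ratr_nat R 1) ler_rat.
by apply: le_trans (orbit_coef_ge3 n_ge2 symSQ adm 0); lra.
Qed.

Let L_unbounded (B : R) : exists K, forall k, (K <= k)%N -> B < L k.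
Proof.
exists (Num.bound `|B|).+1 => -[//|k] Bk; apply: lt_le_trans (L_growth k).
apply: (@lt_le_trans _ _ (2 ^+ k)); last by rewrite ler_peMr // exprn_ge0.
apply: le_lt_trans (ler_norm B) _.
apply: lt_le_trans (archi_boundP (normr_ge0 B)) _.
rewrite -natrX ler_nat.
by apply: leq_trans (ltnW (ltn_expl k (isT : (1 < 2)%N))); rewrite -ltnS.
Qed.

(** Each coordinate of the orbit satisfies the recurrence of the heights. *)
Lemma orbit_limit : exists (v : 'rV[R]_n.+1) (C : R),
  forall k, (0 < k)%N -> l1 (Y k - L k *: v) <= C / L k.
Proof.
have conv j : exists p : R * R, forall k, (0 < k)%N ->
    `|Y k 0 j - L k * p.1| <= p.2 / L k.
  have [|phi [C phiP]] := recurrence_converges n_gt0 K0 L0 L_growth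
    L_second_difference L_rec (f := fun k => Y k 0 j).
    by move=> k; rewrite !mxE addSn orbit_rec // !mxE rmorphB rmorphM.
  by exists (phi, C).
have [p pP] := choice conv.
exists (\row_j (p j).1), (\sum_j (p j).2) => k k0.
rewrite mulr_suml; apply: ler_sum => j _.
by have := pP j k k0; rewrite !mxE.
Qed.

Let bform_Y k : bform SR (Y k) (Y k) = ratr (bform SQ e0 e0).
Proof.
rewrite /Y SRE map_bform; congr ratr.
have := orbit_norm n_ge2 symSQ adm (k + n); rewrite /nbform.
(* If b(e0, e0) = 0, the convention for division by 0 makes B vanish, whereas B(x, x) = 2. *)
have [->|a0 h] := eqVneq (bform SQ e0 e0) 0; first by rewrite invr0 mulr0; lra.
apply: (mulfI (_ : (2 : rat) != 0)) => //; apply: (mulIf (invr_neq0 a0)).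
by rewrite h; field.
Qed.

(** b(Y_k, Y_k) does not depend on k, and it differs from L_k^2 b(v, v) by a bounded amount because
    the error is O(1 / L_k). *)
Lemma orbit_limit_isotropic (v : 'rV[R]_n.+1) (C : R) :
    (forall k, (0 < k)%N -> l1 (Y k - L k *: v) <= C / L k) ->
  bform SR v v = 0.
Proof.
move=> Yv; have [K K_ge0 KP] := bform_bound SR.
pose D := `|ratr (bform SQ e0 e0)| + 2 * (K * l1 v * C) + K * C * C.
apply/eqP; apply/negPn/negP => b0; have b_gt0 : 0 < `|bform SR v v| by rewrite normr_gt0.
have [k0 /(_ k0.+1 (leqnSn _))] := L_unbounded (D / `|bform SR v v|).
set k := k0.+1; have Lk := L0 k; have L1 := L_ge1 k; have Yk := Yv k isT.
rewrite ltr_pdivrMr // ltNge => /negP; apply.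
pose d := Y k - L k *: v.
have dE : Y k = L k *: v + d by rewrite /d addrC subrK.
have dC : l1 d <= C / L k by [].
have CL : C / L k <= C.
  rewrite ler_pdivrMr // ler_peMr // -(pmulr_lge0 _ (_ : 0 < (L k)^-1)) ?invr_gt0 //.
  by apply: le_trans dC; exact: l1_ge0.
have E : L k ^+ 2 * bform SR v v = ratr (bform SQ e0 e0)
    - 2 * (L k * bform SR v d) - bform SR d d.
  rewrite -(bform_Y k) dE; clearbody d.
  by rewrite !(bformDl, bformDr, bformZl, bformZr) (bformC d v symSR); ring.
apply: (@le_trans _ _ (`|L k ^+ 2 * bform SR v v|)).
  by rewrite normrM ler_wpM2r // ger0_norm ?sqr_ge0 // expr2 ler_peMl // ltW.
rewrite E; apply: le_trans (ler_normB _ _) _; apply: lerD.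
  apply: le_trans (ler_normB _ _) _; apply: lerD => //.
  rewrite normrM normr_nat [`|L k * _|]normrM (gtr0_norm Lk) ler_pM2l //.
  apply: (@le_trans _ _ (L k * (K * l1 v * (C / L k)))).
    rewrite ler_pM2l //; apply: le_trans (KP _ _) _.
    by rewrite ler_wpM2l // mulr_ge0 ?l1_ge0.
  by rewrite mulrCA [L k * _]mulrC divfK // gt_eqF.
apply: le_trans (KP _ _) _; rewrite -!mulrA ler_wpM2l //.
by apply: ler_pM; rewrite ?l1_ge0 //; apply: le_trans CL.
Qed.

(** If a rational form a vanishes at v, its values at the X_k tend to 0 with bounded denominators.
    They are eventually 0, and [orbit_spans] gives a = 0. *)
Lemma orbit_limit_independent (v : 'rV[R]_n.+1) (C : R) :
    (forall k, (0 < k)%N -> l1 (Y k - L k *: v) <= C / L k) ->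
  Q_independent v.
Proof.
move=> Yv a av; have [N N0 NP] := common_denominator (fun i => a 0 i).
have [M M0 MP] := orbit_denominator n_ge2 symSQ adm.
pose A : R := \sum_i `|ratr (a 0 i)|.
have A0 : 0 <= A by apply: sumr_ge0.
have [k0 k0P] := L_unbounded (N%:R * M%:R * (A * C)).
suff : a^T = 0 by move=> /(congr1 trmx); rewrite trmxK trmx0.
apply: (orbit_spans n_ge2 adm (K := (k0.+1 + n)%N)) => k' k'_ge.
have -> : k' = (k' - n + n)%N by lia.
set k := (k' - n)%N; have kk0 : (k0 < k)%N by lia.
have Lk := L0 k; have k_gt0 : (0 < k)%N by lia.
rewrite [LHS]mx11_scalar; set s := (_ *m _) 0 0.
suff -> : s = 0 by rewrite raddf0.
have sE : s = \sum_i X (k + n) 0 i * a 0 i.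
  by rewrite /s mxE; apply: eq_bigr => i _; rewrite [a^T _ _]mxE.
have s_int : N%:R * M%:R * s \is a Num.int.
  rewrite sE mulr_sumr; apply: rpred_sum => i _.
  rewrite [N%:R * _]mulrC mulrACA; apply: rpredM; [exact: MP|exact: NP].
have sR : ratr s = \sum_i ratr (a 0 i) * (Y k - L k *: v) 0 i.
  transitivity (\sum_i (ratr (a 0 i) * Y k 0 i - L k * (ratr (a 0 i) * v 0 i))).
    rewrite sumrB -mulr_sumr av mulr0 subr0 sE rmorph_sum.
    by apply: eq_bigr => i _; rewrite [Y k 0 i]mxE -rmorphM [a 0 i * _]mulrC.
  apply: eq_bigr => i _; rewrite mulrCA -mulrBr; congr (_ * _).
  by rewrite !mxE.
have s_small : `|N%:R * M%:R * s| < 1.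
  have sNM : ratr `|N%:R * M%:R * s| = N%:R * M%:R * `|ratr s| :> R.
    rewrite ratr_norm -natrM; have -> : ratr ((N * M)%:R * s) = (N * M)%:R * ratr s :> R.
      by rewrite -(ratr_nat R) -rmorphM.
    by rewrite normrM normr_nat natrM.
  rewrite -(ltr_rat R) sNM sR (ratr_nat R 1).
  apply: (@le_lt_trans _ _ (N%:R * M%:R * (A * (C / L k)))).
    rewrite ler_wpM2l ?mulr_ge0 //; apply: le_trans (sum_mul_le_l1 _ _) _.
    by rewrite ler_wpM2l // Yv.
  by rewrite !mulrA ltr_pdivrMr // mul1r -!mulrA mulrA k0P // ltnW.
have NM : N%:R * M%:R != 0 :> rat by rewrite mulf_neq0 // pnatr_eq0 -lt0n.
apply: contraTeq s_small => s0; rewrite -leNgt.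
by apply: norm_intr_ge1 => //; rewrite mulf_neq0.
Qed.

Lemma orbit_limit_approximable (v : 'rV[R]_n.+1) (C : R) :
    (forall k, (0 < k)%N -> l1 (Y k - L k *: v) <= C / L k) ->
  well_approximable rho v.
Proof.
move=> Yv; have [D D0 DP] := height_growth_exponent n_gt0 K0 L0
  L_second_difference rho1 rho2 rhoE.
have [M M0 MP] := orbit_denominator n_ge2 symSQ adm.
have C0 : 0 <= C.
  have := le_trans (l1_ge0 _) (Yv 1%N isT).
  by rewrite pmulr_lge0 // invr_gt0.
(* Index 0 is skipped because the distance estimate starts at 1; C + D serves for both growth and
   distance. *)
exists (fun k => L k.+1), (fun k => X (k.+1 + n)), (C + D), M; split=> //.
- move=> k; split; first exact: L_ge1.
  by apply: le_trans (DP _) _; rewrite ler_wpM2r ?powR_ge0 // lerDr.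
- by move=> B; have [k kP] := L_unbounded B; exists k; apply: kP.
- move=> k; apply: contra_eq_neq (orbit_norm n_ge2 symSQ adm (k.+1 + n)) => ->.
  by rewrite /nbform bform0l mulr0 mul0r.
move=> k; apply: le_trans (Yv k.+1 isT) _.
by rewrite ler_pM2r ?invr_gt0 // lerDl ltW.
Qed.

Lemma orbit_limit_point : exists v : 'rV[R]_n.+1,
  [/\ Q_independent v, bform SR v v = 0 & well_approximable rho v].
Proof.
have [v [C Yv]] := orbit_limit; exists v; split.
- exact: orbit_limit_independent Yv.
- exact: orbit_limit_isotropic Yv.
exact: orbit_limit_approximable Yv.
Qed.

End OrbitLimit.

(** * Rational reflections and independence *)

Section Reflection.
Context (K : fieldType) (n : nat) (S : 'M[K]_n).
Implicit Types (v x : 'rV[K]_n).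

Definition reflection v : 'M[K]_n :=
  1%:M - (2 / bform S v v) *: (S *m v^T *m v).

Lemma mul_reflection v x :
  x *m reflection v = x - (2 * bform S x v / bform S v v) *: v.
Proof.
rewrite /reflection mulmxBr mulmx1 -scalemxAr !mulmxA.
rewrite [x *m S *m v^T]mx11_scalar mul_scalar_mx scalerA -/(bform S x v).
by rewrite mulrAC.
Qed.

Context (symS : S^T = S).

Lemma reflection_isometry v x : bform S v v != 0 ->
  bform S (x *m reflection v) (x *m reflection v) = bform S x x.
Proof.
move=> v0; rewrite !mul_reflection.
rewrite !(bformDl, bformDr, bformNl, bformNr, bformZl, bformZr) (bformC v x symS).
by field.
Qed.

Lemma reflection_unit v : bform S v v != 0 -> reflection v \in unitmx.
Proof.
move=> v0; suff PP : reflection v *m reflection v = 1%:M by have [] := mulmx1_unit PP.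
apply/row_matrixP => i; rewrite !rowE mulmxA mulmx1; set x := delta_mx _ _.
rewrite !mul_reflection !(bformDl, bformNl, bformZl) -addrA -opprD -scalerDl.
rewrite [X in X *: _](_ : _ = 0) ?scale0r ?subr0 //.
by field.
Qed.

End Reflection.

Lemma map_reflection (K L : fieldType) (f : {rmorphism K -> L}) n
    (S : 'M[K]_n) v :
  map_mx f (reflection S v) = reflection (map_mx f S) (map_mx f v).
Proof.
rewrite /reflection map_mxB map_mx1 map_mxZ !map_mxM map_trmx map_bform.
by rewrite fmorph_div rmorph_nat.
Qed.

Section QIndependent.
Context (R : realType) (n : nat).
Implicit Type v : 'rV[R]_n.+1.

Lemma Q_independent_neq0 v : Q_independent v -> v != 0.
Proof.
move=> vQ; apply/eqP => v0; have /rowP/(_ 0)/eqP : delta_mx 0 0 = 0 :> 'rV[rat]_n.+1.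
  by apply: vQ; apply: big1 => i _; rewrite v0 [X in _ * X]mxE mulr0.
by rewrite !mxE !eqxx oner_eq0.
Qed.

Lemma Q_independentZ c v : c != 0 -> Q_independent v -> Q_independent (c *: v).
Proof.
move=> c0 vQ a av; apply: vQ; apply: (mulfI c0).
rewrite mulr0 mulr_sumr -[RHS]av; apply: eq_bigr => i _.
by rewrite [(c *: v) 0 i]mxE [RHS]mulrCA.
Qed.

Lemma Q_independent_mul v (P : 'M[rat]_n.+1) : P \in unitmx ->
  Q_independent v -> Q_independent (v *m map_mx ratr P).
Proof.
move=> unitP vQ a av; apply/eqP; apply: contraT => a0.
have : P *m a^T != 0.
  apply: contra_neq a0 => Pa; apply: trmx_inj; rewrite trmx0.
  by rewrite -[a^T](mulKmx unitP) Pa mulmx0.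
move=> /(dot_neq0 vQ) /negP[]; apply/eqP; rewrite -[RHS]av.
transitivity ((v *m map_mx ratr P *m map_mx ratr a^T) 0 0).
  rewrite -mulmxA -map_mxM mxE; apply: eq_bigr => i _.
  by rewrite mulrC; congr (_ * _); rewrite [RHS]mxE.
by rewrite mxE; apply: eq_bigr => i _; rewrite mulrC !mxE.
Qed.

Lemma proj_point v : v != 0 -> exists xi : proj_space R n, val xi = <[v]>%VS.
Proof.
move=> v0; have dimv : (\dim <[v]> == 1)%N by rewrite dim_vline v0.
by exists (exist _ <[v]>%VS dimv).
Qed.

End QIndependent.

Section ManyPoints.
Context (R : realType) (n : nat) (S : 'M[int]_n.+1).
Hypotheses (n_ge2 : (2 <= n)%N) (symS : S^T = S).

Let SQ : 'M[rat]_n.+1 := map_mx intr S.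
Let SR : 'M[R]_n.+1 := map_mx intr S.

Let SRE : SR = map_mx ratr SQ.
Proof. exact: map_intr_ratr. Qed.

Let symSQ : SQ^T = SQ. Proof. by rewrite map_trmx symS. Qed.

Context (e0 e1 : 'rV[rat]_n.+1) (d : rat).
Hypotheses (a0 : bform SQ e0 e0 != 0) (e01 : bform SQ e0 e1 = 0).
Hypotheses (d_ns : nonsquare d) (e11 : bform SQ e1 e1 = - d * bform SQ e0 e0).
Context (v : 'rV[R]_n.+1) (vQ : Q_independent v).

Let w (k : nat) : 'rV[rat]_n.+1 := e0 + k%:R *: e1.

(** b(w_k, w_k) = (1 - k^2 d) b(e0, e0), which is nonzero because d is not a square. *)
Lemma plane_vector_norm k : bform SQ (w k) (w k) != 0.
Proof.
have -> : bform SQ (w k) (w k) = (1 - k%:R ^+ 2 * d) * bform SQ e0 e0.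
  rewrite /w !(bformDl, bformDr, bformZl, bformZr) (bformC e1 e0 symSQ) e01 e11.
  by ring.
rewrite mulf_neq0 // subr_eq0 eq_sym.
apply/eqP => kd; have [r [N [r0 N_ns dN]]] := d_ns.
have rk : (r ^ 2 = k ^ 2 * N)%N.
  apply/eqP; rewrite -(eqr_nat rat) natrM !natrX -dN mulrA kd mul1r.
  exact: eqxx.
have k0 : (0 < k)%N by case: (k) kd => // /eqP; rewrite expr0n mul0r.
have k_r : (k %| r)%N by rewrite -(@dvdn_pexp2r _ _ 2) // rk dvdn_mulr.
move: (N_ns (r %/ k)%N) => /eqP; apply; apply/eqP.
rewrite -(eqn_pmul2l (_ : 0 < k ^ 2)%N) ?expn_gt0 ?k0 // -rk -expnMn.
by rewrite mulnC divnK.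
Qed.

(** The images are v - b_k w_k and v - b_l w_l with nonzero coefficients. Once c = 1 is known, b_k
    w_k = b_l w_l; pairing with e0 gives b_k = b_l, and pairing with e1 then gives k = l. *)
Lemma reflected_distinct k l (c : R) :
    v *m map_mx ratr (reflection SQ (w k)) =
      c *: (v *m map_mx ratr (reflection SQ (w l))) ->
  k = l.
Proof.
pose wR j : 'rV[R]_n.+1 := map_mx ratr (w j).
pose b j : R := 2 * bform SR v (wR j) / bform SR (wR j) (wR j).
have E j : v *m map_mx ratr (reflection SQ (w j)) = v - b j *: wR j.
  by rewrite map_reflection -SRE mul_reflection.
have b0 j : b j != 0.
  rewrite /b mulf_neq0 ?invr_eq0 ?mulf_neq0 //.
    exact: bform_rat_neq0 vQ _ _ (plane_vector_norm j).
  by rewrite SRE map_bform fmorph_eq0 plane_vector_norm.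
rewrite (E k) (E l) => eq_kl.
(* A rational functional vanishing on the plane of [e0] and [e1] does not see
   the reflections. *)
have [z z0 [z0e z1e]] : exists2 z : 'cV[rat]_n.+1, z != 0 &
    e0 *m z = 0 /\ e1 *m z = 0.
  pose M : 'M[rat]_(n.+1, 1 + 1) := row_mx e0^T e1^T.
  have : kermx M != 0.
    rewrite kermx_eq0 /row_free; have := rank_leq_col M; lia.
  move=> /rowV0Pn[u /sub_kermxP uM u0]; exists u^T.
    by rewrite -trmx0 (inj_eq trmx_inj).
  move: uM; rewrite /M mul_mx_row -row_mx0 => /eq_row_mx[h0 h1].
  by split; apply: trmx_inj; rewrite trmx_mul trmxK trmx0.
pose zR : 'cV[R]_n.+1 := map_mx ratr z.
have wz j : wR j *m zR = 0.
  by rewrite -map_mxM mulmxDl -scalemxAl z0e z1e scaler0 addr0 map_mx0.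
have vz : (v *m zR) 0 0 != 0.
  have := dot_neq0 vQ z0; rewrite mxE.
  suff -> : \sum_j v 0 j * zR j 0 = \sum_j ratr (z j 0) * v 0 j by [].
  apply: eq_bigr => i _.
  by rewrite [zR i 0]mxE [RHS]mulrC.
have c1 : c = 1.
  move: eq_kl => /(congr1 (fun u : 'rV[R]_n.+1 => (u *m zR) 0 0)).
  rewrite scalerBr !mulmxBl -!scalemxAl !wz !scaler0 !subr0 => h.
  by apply: (mulIf vz); rewrite mul1r [RHS]h [RHS]mxE.
move: eq_kl; rewrite c1 scale1r => /addrI /oppr_inj bw.
pose e0R : 'rV[R]_n.+1 := map_mx ratr e0; pose e1R : 'rV[R]_n.+1 := map_mx ratr e1.
have pair f j : bform SR (b j *: wR j) (map_mx ratr f) = b j * ratr (bform SQ (w j) f).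
  by rewrite bformZl SRE map_bform.
have w0 j : bform SQ (w j) e0 = bform SQ e0 e0.
  by rewrite /w bformDl bformZl (bformC e1 e0 symSQ) e01 mulr0 addr0.
have w1 j : bform SQ (w j) e1 = - j%:R * d * bform SQ e0 e0.
  by rewrite /w bformDl bformZl e01 e11; ring.
have bE : b k = b l.
  have := pair e0 k; rewrite bw pair !w0 => /mulIf -> //.
  by rewrite fmorph_eq0.
have := pair e1 k; rewrite bw pair bE => /(mulfI (b0 l)) /fmorph_inj.
rewrite !w1 => /(mulIf a0) /mulIf.
have d0 := nonsquare_gt0 d_ns.
rewrite gt_eqF // => /(_ isT) /oppr_inj /eqP; rewrite eqr_nat => /eqP.
by [].
Qed.

End ManyPoints.

(** * The upper bound *)

Section UpperBound.
Context (R : realType) (n : nat) (q : mpoly n.+1 rat) (rho : R).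
Hypotheses (n_ge2 : (2 <= n)%N) (q_form : is_quadratic_form q).
Hypothesis Zli_neq0 : li_part (zero_set (map_mpoly ratr q : mpoly n.+1 R)) !=set0.
Hypotheses (rho_gt0 : 0 < rho) (rho_root : root ('X^n - \sum_(i < n) 'X^i) rho).

(** The given point of Z^li serves to find the plane of e0 and e1. The points produced are the
    images of the limit of the orbit under the reflections in e0 + k e1. *)
Lemma limsup_lty_infinite :
  infinite_set [set xi : proj_space R n |
    li_part (zero_set (map_mpoly ratr q)) xi /\
    (limf_esup (fun X : R => (X `^ (1 / rho) * Dmin xi X)%:E) (pinfty_nbhs R)
       < +oo)%E].
Proof.
have [r1 r2 rhoE _] := root_sum_inv n_ge2 rho_gt0 rho_root.
have [c [S [c0 S0 symS qE qRE]]] := quadratic_form_bform R q_form.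
have [xi0 [xi0Z xi0li]] := Zli_neq0.
have v0rep := represents_vpick xi0; set v0 := vpick _ in v0rep.
have v0iso : bform (map_mx intr S) v0 v0 = 0.
  have := xi0Z v0 v0rep; rewrite qRE => /eqP; rewrite mulf_eq0 fmorph_eq0.
  by rewrite (negPf c0) => /eqP.
have [e0 [e1 [d [a0 e01 d_ns e11]]]] :=
  exists_nonsquare_pair S0 symS (xi0li v0 v0rep) v0iso.
have symSQ : (map_mx intr S : 'M[rat]_n.+1)^T = map_mx intr S.
  by rewrite map_trmx symS.
have [x adm] := exists_initial_vectors R n_ge2 symSQ a0 e01 d_ns e11.
have [v [vQ viso vapp]] := orbit_limit_point n_ge2 symS adm r1 r2 rhoE.
pose w k := e0 + k%:R *: e1; pose P k := reflection (map_mx intr S) (w k).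
have w0 k := plane_vector_norm symS a0 e01 d_ns e11 k.
pose u k : 'rV[R]_n.+1 := v *m map_mx ratr (P k).
have uP k : P k \in unitmx by apply: reflection_unit => //; apply: w0.
have SRE : map_mx intr S = map_mx ratr (map_mx intr S : 'M[rat]_n.+1) :> 'M[R]_n.+1.
  exact: map_intr_ratr.
have uQ k : Q_independent (u k) by apply: Q_independent_mul.
have uiso k : bform (map_mx intr S) (u k) (u k) = 0.
  rewrite /u map_reflection -SRE reflection_isometry ?map_trmx ?symS //.
  by rewrite SRE map_bform fmorph_eq0; apply: w0.
have [xi xiE] := choice (fun k => proj_point (Q_independent_neq0 (uQ k))).
set A := [set _ | _]; have xiA k : A (xi k).
  split; last first.
    apply: (@well_approximable_limsup _ _ _ _ (u k)) => //.
      by split; [exact: Q_independent_neq0|rewrite xiE memv_line].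
    exact: well_approximable_mul.
  split=> y [y0]; rewrite xiE => /vlineP[b yE].
    by rewrite qRE yE bformZl bformZr uiso !mulr0.
  rewrite yE; apply: Q_independentZ => //.
  by apply: contraNneq y0 => b0; rewrite yE b0 scale0r.
move=> finA; apply: infinite_nat.
have -> : [set: nat] = xi @^-1` A by apply/seteqP; split=> k // _; exact: xiA.
apply: finite_preimage finA => k l _ _ /(congr1 val); rewrite !xiE => kl.
have : u k \in <[u l]>%VS by rewrite -kl memv_line.
move=> /vlineP[b]; exact: (reflected_distinct n_ge2 symS a0 e01 d_ns e11 vQ).
Qed.

End UpperBound.

Theorem theorem2p1 (R : realType) (n : nat) (n_ge2 : (2 <= n)%N)
    (q : mpoly n.+1 rat) (q_form : is_quadratic_form q)
    (m : nat) (q_witt : has_Witt_index q m) (m_le1 : (m <= 1)%N)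
    (Z : set (proj_space R n)) (ZE : Z = zero_set (map_mpoly ratr q))
    (Zli_neq0 : li_part Z !=set0)
    (rho : R) (rho_gt0 : 0 < rho)
    (rho_root : root ('X^n - \sum_(i < n) 'X^i) rho) :
  (forall xi : proj_space R n, li_part Z xi ->
     (0 < limf_esup (fun X : R => (X `^ (1 / rho) * Dmin xi X)%:E)
                    (pinfty_nbhs R))%E) /\
  infinite_set [set xi : proj_space R n | li_part Z xi /\
     (limf_esup (fun X : R => (X `^ (1 / rho) * Dmin xi X)%:E)
                (pinfty_nbhs R) < +oo)%E].
Proof.
subst Z; split; last exact: limsup_lty_infinite.
move=> xi; exact: (limsup_gt0 n_ge2 q_form q_witt m_le1 rho_gt0 rho_root).
Qed.
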